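(* There is an algorithm which, given a finitely ambiguous max-plus automaton $\mathcal{A}$ over a finite alphabet $\Sigma$, decides whether the series $S(\mathcal{A})$ recognized by $\mathcal{A}$ is unambiguous. There is also an algorithm which, given such an $\mathcal{A}$, decides whether $S(\mathcal{A})$ is sequential.
   Context: $\mathbb{R}_{\max}=(\mathbb{R}\cup\{-\infty\},\max,+)$ is the max-plus semiring. A max-plus automaton of dimension $Q$ (a finite set) over $\Sigma$ is a triple $\mathcal{A}=(\alpha,\mu,\beta)$ with $\alpha\in\mathbb{R}_{\max}^{1\times Q}$, $\beta\in\mathbb{R}_{\max}^{Q\times 1}$ and $\mu:\Sigma^*\to\mathbb{R}_{\max}^{Q\times Q}$ a monoid morphism (max-plus matrix product). It recognizes the series $S(\mathcal{A}):\Sigma^*\to\mathbb{R}_{\max}$, $u\mapsto \alpha\mu(u)\beta$. State $i$ is initial if $\alpha_i\neq-\infty$, final if $\beta_i\neq-\infty$; there is a transition $i\xrightarrow{a} j$ if $\mu(a)_{ij}\neq-\infty$. A successful path with label $u$ is a path labelled $u$ from an initial to a final state. $\mathcal{A}$ is sequential if it has a unique initial state and for each state $i$ and letter $a$ there is at most one $j$ with $\mu(a)_{ij}\neq-\infty$; unambiguous if every word labels at most one successful path; finitely ambiguous if there is $k$ such that every word labels at most $k$ successful paths. A series is sequential (resp. unambiguous) if some sequential (resp. unambiguous) max-plus automaton recognizes it. Real numbers are assumed to be added and compared in constant time. *)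

(* Defs.v *)
From HB Require Import structures.
From mathcomp Require Import all_boot all_order all_algebra.
From mathcomp Require Import reals.

Set Implicit Arguments.
Unset Strict Implicit.
Unset Printing Implicit Defensive.

Import Order.TTheory GRing.Theory Num.Theory.
Local Open Scope ring_scope.

(** * The max-plus semiring

    [None] is -oo and [Some r] is the real number [r].  In the ring notations
    below, [x + y] is therefore [max(x, y)], [x * y] is the usual sum, [0] is
    -oo and [1] is the real number 0; sums and products of matrices are the
    max-plus ones. *)

Definition maxplus (R : realType) : Type := option R.

Section MaxPlus.
Variable R : realType.
Implicit Types x y z : maxplus R.

HB.instance Definition _ := Choice.on (maxplus R).

Definition mp_max x y : maxplus R :=
  match x, y with
  | None, _ => y
  | _, None => x
  | Some r, Some s => Some (Num.max r s)
  end.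

Definition mp_plus x y : maxplus R :=
  match x, y with
  | Some r, Some s => Some (r + s)
  | _, _ => None
  end.

Definition mp_le x y : bool :=
  match x, y with
  | None, _ => true
  | Some _, None => false
  | Some r, Some s => r <= s
  end.

Lemma mp_maxA : associative mp_max.
Proof. by move=> [r|] [s|] [t|] //=; rewrite maxA. Qed.

Lemma mp_maxC : commutative mp_max.
Proof. by move=> [r|] [s|] //=; rewrite maxC. Qed.

Lemma mp_max0 : left_id None mp_max.
Proof. by []. Qed.

Lemma mp_plusA : associative mp_plus.
Proof. by move=> [r|] [s|] [t|] //=; rewrite addrA. Qed.

Lemma mp_plusC : commutative mp_plus.
Proof. by move=> [r|] [s|] //=; rewrite addrC. Qed.

Lemma mp_plus1 : left_id (Some 0) mp_plus.
Proof. by move=> [r|] //=; rewrite add0r. Qed.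

Lemma mp_plusDl : left_distributive mp_plus mp_max.
Proof. by move=> [r|] [s|] [t|] //=; rewrite addr_maxl. Qed.

Lemma mp_plus0 : left_zero None mp_plus.
Proof. by []. Qed.

HB.instance Definition _ :=
  GRing.isNmodule.Build (maxplus R) mp_maxA mp_maxC mp_max0.
HB.instance Definition _ := GRing.Nmodule_isComNzSemiRing.Build (maxplus R)
  mp_plusA mp_plusC mp_plus1 mp_plusDl mp_plus0 (erefl : Some 0 != None).

End MaxPlus.

(** * Max-plus automata *)

(** The states are the elements of ['I_n].  A monoid morphism from the words
    over [Sigma] to matrices is given by its values on letters; [wordmx] below
    is the morphism itself. *)
Record automaton (R : realType) (Sigma : finType) (n : nat) := Automaton {
  init_wt : 'rV[maxplus R]_n;
  letmx : Sigma -> 'M[maxplus R]_n;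
  final_wt : 'cV[maxplus R]_n
}.

Section Automata.
Variables (R : realType) (Sigma : finType).

Section OneAutomaton.
Variables (n : nat) (A : automaton R Sigma n).
Implicit Types (i j : 'I_n) (a : Sigma) (u v : seq Sigma).

Definition wordmx u : 'M[maxplus R]_n := \prod_(a <- u) letmx A a.

Lemma wordmx_nil : wordmx [::] = 1%:M.
Proof. exact: big_nil. Qed.

Lemma wordmx_cat u v : wordmx (u ++ v) = wordmx u *m wordmx v.
Proof. exact: big_cat. Qed.

Definition series u : maxplus R := (init_wt A *m wordmx u *m final_wt A) 0 0.

(** Here [0] is the zero of the semiring, that is, -oo. *)
Definition initial i : bool := init_wt A 0 i != 0.
Definition final i : bool := final_wt A i 0 != 0.
Definition transition i a j : bool := letmx A a i j != 0.

(** [steps i u p]: [p] is the sequence of the states visited after [i] by a path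
    labelled [u] starting at [i]. *)
Fixpoint steps i u (p : seq 'I_n) : bool :=
  match u, p with
  | [::], [::] => true
  | a :: u', j :: p' => transition i a j && steps j u' p'
  | _, _ => false
  end.

Definition successful u (i : 'I_n) (p : seq 'I_n) : bool :=
  [&& initial i, steps i u p & final (last i p)].

(** There is at most one transition from [i] to [j] labelled [a], so that a path
    labelled [u] is determined by its [size u + 1] states. *)
Definition ambiguity u : nat :=
  #|[set p : 'I_n * (size u).-tuple 'I_n | successful u p.1 p.2]|.

Definition unambiguous : Prop := forall u, (ambiguity u <= 1)%N.

Definition finitely_ambiguous : Prop :=
  exists k, forall u, (ambiguity u <= k)%N.

Definition sequential : Prop :=
  #|[set i | initial i]| = 1%N /\
  forall i a, (#|[set j | transition i a j]| <= 1)%N.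

End OneAutomaton.

Definition unambiguous_series (S : seq Sigma -> maxplus R) : Prop :=
  exists (n : nat) (B : automaton R Sigma n), unambiguous B /\ series B =1 S.

Definition sequential_series (S : seq Sigma -> maxplus R) : Prop :=
  exists (n : nat) (B : automaton R Sigma n), sequential B /\ series B =1 S.

End Automata.

(** * Algorithms over the max-plus reals

    The programs of a WHILE language operate on binary trees, whose leaves are
    either [Nil] or an element of the max-plus semiring.  Without numeric leaves
    this is a Turing-complete language over finite trees.  Numbers are atomic:
    they can be added and compared, each in one step, and in no other way
    inspected; the only numeric constants are -oo and 0.  Programs do not depend
    on the type of real numbers. *)

Inductive tree (R : realType) :=
| Nil
| Num of maxplus R
| Node of tree R & tree R.
Arguments Nil {R}.

Inductive instr :=
| INil | INegInf | IZero
| IId | ILeft | IRight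
| IIsNode | IIsNum
| IAdd | ILe.

Inductive prog :=
| Do of instr
| Seq of prog & prog
| Fork of prog & prog
| If of prog & prog & prog
| While of prog & prog.

Section Semantics.
Variable R : realType.
Implicit Types (t x y z : tree R) (p q : prog).

(** [Nil] represents false, any other tree true. *)
Definition tbool (b : bool) : tree R := if b then Node Nil Nil else Nil.

(** Instructions applied to a tree of the wrong shape return [Nil]. *)
Definition exec (c : instr) t : tree R :=
  match c, t with
  | INil, _ => Nil
  | INegInf, _ => Num None
  | IZero, _ => Num (Some 0)
  | IId, _ => t
  | ILeft, Node x _ => x
  | IRight, Node _ y => y
  | IIsNode, Node _ _ => tbool true
  | IIsNum, Num _ => tbool true
  | IAdd, Node (Num r) (Num s) => Num (mp_plus r s)
  | ILe, Node (Num r) (Num s) => tbool (mp_le r s)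
  | _, _ => Nil
  end.

(** [eval p x y]: on input [x], the program [p] halts with output [y]. *)
Inductive eval : prog -> tree R -> tree R -> Prop :=
| eval_Do c x : eval (Do c) x (exec c x)
| eval_Seq p q x y z : eval p x y -> eval q y z -> eval (Seq p q) x z
| eval_Fork p q x y z : eval p x y -> eval q x z -> eval (Fork p q) x (Node y z)
| eval_If_true c p q x y z :
    eval c x y -> y <> Nil -> eval p x z -> eval (If c p q) x z
| eval_If_false c p q x z :
    eval c x Nil -> eval q x z -> eval (If c p q) x z
| eval_While_stop c p x :
    eval c x Nil -> eval (While c p) x x
| eval_While_step c p x b y z :
    eval c x b -> b <> Nil -> eval p x y -> eval (While c p) y z ->
    eval (While c p) x z.

Lemma eval_functional p x y z : eval p x y -> eval p x z -> y = z.
Proof.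
move=> py; elim: py z => {p x y}.
- by move=> c x z pz; inversion pz.
- move=> p q x y z _ IHp _ IHq w pw; inversion pw; subst.
  by apply: IHq; rewrite (IHp y0).
- move=> p q x y z _ IHp _ IHq w pw; inversion pw; subst.
  by rewrite (IHp y0) // (IHq z0).
- move=> c p q x y z _ IHc yN _ IHp w pw; inversion pw; subst; first exact: IHp.
  by case: yN; apply: IHc.
- move=> c p q x z _ IHc _ IHq w pw; inversion pw; subst; last exact: IHq.
  by match goal with cN : ?y <> Nil |- _ => case: cN; rewrite -(IHc y) end.
- move=> c p x _ IHc w pw; inversion pw; subst => //.
  by match goal with cN : ?y <> Nil |- _ => case: cN; rewrite -(IHc y) end.
- move=> c p x b y z _ IHc bN _ IHp _ IHw w pw; inversion pw; subst.
    by case: bN; apply: IHc.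
  apply: IHw.
  by match goal with py : eval p x ?y' |- _ => rewrite (IHp y') end.
Qed.

(** [p] halts on input [x] and tells whether [P] holds. *)
Definition decides p x (P : Prop) : Prop :=
  exists2 b : bool, eval p x (tbool b) & (b = true <-> P).

Definition tlist (s : seq (tree R)) : tree R := foldr (@Node R) Nil s.

Definition tmx m n (M : 'M[maxplus R]_(m, n)) : tree R :=
  tlist [seq tlist [seq Num (M i j) | j <- enum 'I_n] | i <- enum 'I_m].

Definition encode (Sigma : finType) n (A : automaton R Sigma n) : tree R :=
  Node (tmx (init_wt A))
    (Node (tlist [seq tmx (letmx A a) | a <- enum Sigma]) (tmx (final_wt A))).

End Semantics.

(* Main.v *)
(** Fix a finitely ambiguous automaton.  At a position of a word, let [P] be the set
    of the states reached so far, [C] the set of the states from which the rest of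
    the word is accepted, and call the states in both useful.  By finite ambiguity,
    a word that loops on [P] and on [C] permutes the useful states, each along one
    path, so some power of it acts on them as the identity.  A useful state is good
    if no useful state gains weight with respect to it on such a loop.

    The series is unambiguous iff every accepted word has a run through good states
    only.  If an unambiguous automaton exists, pump all loops on which a state loses:
    by linearity of its weights, the optimal run of the pumped word must win on each
    of these loops, and it projects to a good run.  Conversely, follow a good run and
    store the weights of the other runs relative to it: removing cycles shows that
    these are bounded above, and that those above a fixed bound lie in a finite set.

    It is sequential iff moreover the loops on good states have the same weight for
    all continuations of the same prefix, which is the twins property of the
    unambiguous automaton; under this property the usual determinization by
    normalized vectors is finite.

    Both conditions involve only simple cycles and words of bounded length, and they
    compare sums of weights, so they can be checked by programs without subtraction. *)

Require Import Defs.
From mathcomp Require Import all_boot all_order all_algebra all_fingroup.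
From mathcomp Require Import boolp reals lra zify.

Set Implicit Arguments.
Unset Strict Implicit.
Unset Printing Implicit Defensive.

Import Order.TTheory GRing.Theory Num.Theory.
Local Open Scope ring_scope.

(** Whether a state is good depends on the rest of the input, which has not been read yet. What the
    rest of the word accepts evolves deterministically from right to left, so the constructed
    automaton can guess a finite type of the remaining input: only the true guess survives to the
    end, and guessing creates no ambiguity. This is also why the twins property compares states
    under two continuations: two states of that automaton reached by the same prefix may hold
    different guesses. A given unambiguous automaton is known only through its series; its states
    bear no relation to those of [A]. The link is the growth of weights under repetition of a loop.
    Identity loops can be inserted without changing the sets of reached and of accepting states, so
    bad states are excluded one after the other and no earlier exclusion is undone. Relative weights
    have no lower bound. The amount that a run can still regain on a good run tells when it may be
    forgotten, and this gives the threshold above which only finitely many values occur. *)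

(** * Order and finite sums in the max-plus semiring *)

Section MaxPlusOrder.
Variable R : realType.
Implicit Types x y z t : maxplus R.

Lemma mp_le_refl x : mp_le x x.
Proof. by case: x => /=. Qed.

Lemma mp_le_trans y x z : mp_le x y -> mp_le y z -> mp_le x z.
Proof. by case: x y z => [r|] [s|] [t|] //=; apply: le_trans. Qed.

Lemma mp_le_anti x y : mp_le x y -> mp_le y x -> x = y.
Proof.
case: x y => [r|] [s|] //= rs sr; congr Some.
by apply/eqP; rewrite eq_le rs.
Qed.

Lemma mp_le0 x : mp_le 0 x.
Proof. by case: x. Qed.

Lemma mp_le_neq0 x y : mp_le x y -> x != 0 -> y != 0.
Proof. by case: x y => [r|] [s|]. Qed.

Lemma mp_geD x y z : mp_le (x + y) z = mp_le x z && mp_le y z.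
Proof.
by case: x y z => [r|] [s|] [t|] //=; rewrite ?andbT ?ge_max.
Qed.

Lemma mp_leDl x y : mp_le x (x + y).
Proof. by have := mp_le_refl (x + y); rewrite mp_geD => /andP[]. Qed.

Lemma mp_ge_sum (I : Type) (r : seq I) (P : pred I) (F : I -> maxplus R) z :
  (forall i, P i -> mp_le (F i) z) -> mp_le (\sum_(i <- r | P i) F i) z.
Proof.
move=> FP; elim/big_ind: _ => //.
by move=> x y xz yz; rewrite mp_geD xz.
Qed.

Lemma mp_le_sum (I : finType) (P : pred I) (F : I -> maxplus R) i :
  P i -> mp_le (F i) (\sum_(j | P j) F j).
Proof. by move=> Pi; rewrite (bigD1 i) //= mp_leDl. Qed.

Lemma mp_le_sumT (I : finType) (F : I -> maxplus R) i : mp_le (F i) (\sum_j F j).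
Proof. exact: mp_le_sum. Qed.

Lemma mp_add_sel x y : x + y = x \/ x + y = y.
Proof.
case: x y => [r|] [s|]; try by [left|right].
by have [rs|/ltW rs] := leP r s; [right|left]; congr Some; rewrite ?(max_r rs) ?(max_l rs).
Qed.

(** A sum is a maximum, hence one of its terms; the hypothesis rules out the empty sum. This is how
    an entry of a matrix product becomes the weight of a single path. *)
Lemma mp_sum_attain (I : finType) (P : pred I) (F : I -> maxplus R) :
  \sum_(i | P i) F i != 0 -> exists2 i, P i & \sum_(i | P i) F i = F i.
Proof.
elim/big_rec: _ => [|i x Pi IH]; first by rewrite eqxx.
have [->|->] := mp_add_sel (F i) x; first by exists i.
by move=> /IH[j Pj ->]; exists j.
Qed.

Lemma mp_sum_neq0 (I : finType) (P : pred I) (F : I -> maxplus R) i :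
  P i -> F i != 0 -> \sum_(j | P j) F j != 0.
Proof. by move=> Pi; apply: mp_le_neq0 (mp_le_sum _ Pi). Qed.

Lemma mp_mul_neq0 x y : (x * y != 0) = (x != 0) && (y != 0).
Proof. by case: x y => [r|] [s|]. Qed.

Lemma mp_leM x y z t : mp_le x y -> mp_le z t -> mp_le (x * z) (y * t).
Proof. by case: x y z t => [x|] [y|] [z|] [t|] //=; apply: lerD. Qed.

Lemma mp_le_mul2l x y z : x != 0 -> mp_le (x * y) (x * z) = mp_le y z.
Proof. by case: x y z => [x|] [y|] [z|] //= _; rewrite lerD2l. Qed.

(** The value at -oo is junk. *)
Definition mpval x : R := odflt 0 x.

Lemma mp_exp (r : R) k : (Some r : maxplus R) ^+ k = Some (r *+ k).
Proof. by elim: k => // k IH; rewrite exprS IH mulrS. Qed.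

End MaxPlusOrder.

(** * Walks in labelled weighted graphs *)

Section LabelledGraph.
Variables (R : realType) (V L : finType) (e : V -> L -> V -> bool).
Variable g : V -> L -> V -> R.
Implicit Types (z : V) (w c : seq (L * V)).

Fixpoint walk z w := if w is (a, z') :: w' then e z a z' && walk z' w' else true.
Definition wend z w := last z (map snd w).
Fixpoint wsum z w : R :=
  if w is (a, z') :: w' then g z a z' + wsum z' w' else 0.

Lemma walk_cat z w c : walk z (w ++ c) = walk z w && walk (wend z w) c.
Proof. by elim: w z => //= -[a z'] w IH z; rewrite IH andbA. Qed.

Lemma wend_cat z w c : wend z (w ++ c) = wend (wend z w) c.
Proof. by rewrite /wend map_cat last_cat. Qed.

Lemma wsum_cat z w c : wsum z (w ++ c) = wsum z w + wsum (wend z w) c.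
Proof.
by elim: w z => [|[a z'] w IH] z; rewrite /= ?add0r // IH addrA.
Qed.

Definition wnodes z w := z :: map snd w.

(** Pigeonhole on the first [#|V|.+1] nodes only: restricting to this prefix is what bounds the
    length of the cycle. *)
Lemma short_cycle z w : (#|V| <= size w)%N ->
  exists w1 c w2, [/\ w = w1 ++ c ++ w2, (0 < size c <= #|V|)%N
    & wend (wend z w1) c = wend z w1].
Proof.
move=> sw; set ns := take #|V|.+1 (wnodes z w).
have szn : size ns = #|V|.+1.
  by rewrite size_takel //= size_map ltnS.
have /(uniqPn z)[i [j [ij]]] : ~~ uniq ns.
  apply/negP => /card_uniqP cE; have := max_card [in ns].
  by rewrite cE szn ltnn.
rewrite szn ltnS => jV; rewrite !nth_take //; last exact: ltn_trans ij _.
move=> Nij; exists (take i w), (take (j - i) (drop i w)), (drop j w).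
have jw : (j <= size w)%N by apply: leq_trans sw.
have iw : (i <= size w)%N by rewrite ltnW // (leq_trans ij).
have wE k : (k <= size w)%N -> wend z (take k w) = nth z (wnodes z w) k.
  move=> kw; rewrite /wend -nth_last map_take size_takel ?size_map //.
  case: k kw => [|k] kw /=; first by rewrite take0.
  by rewrite nth_take.
split.
- by rewrite -{1}(cat_take_drop i w) -{1}(cat_take_drop (j - i) (drop i w))
    drop_drop subnK // ltnW.
- rewrite size_takel ?size_drop ?leq_sub2r // subn_gt0 ij /=.
  by rewrite (leq_trans (leq_subr _ _)).
- rewrite -wend_cat.
  have -> : take i w ++ take (j - i) (drop i w) = take j w.
    by rewrite -[in RHS](subnKC (ltnW ij)) takeD.
  by rewrite !wE.
Qed.

Lemma walk_shorten z w : walk z w ->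
  exists w', [/\ walk z w', wend z w' = wend z w & (size w' <= #|V|)%N].
Proof.
have [k] := ubnP (size w); elim: k => // k IH in w *; rewrite ltnS => wk ww.
have [sw|/ltnW sw] := leqP (size w) #|V|; first by exists w.
have [w1 [c [w2 [wE /andP[c0 _] cE]]]] := short_cycle z sw.
have [|| w' [w'w w'e w's]] := IH (w1 ++ w2).
- by apply: leq_trans wk; rewrite wE !size_cat addnCA -{1}[(_ + _)%N]add0n ltn_add2r.
- by move: ww; rewrite wE !walk_cat cE => /and3P[-> _ ->].
by exists w'; split=> //; rewrite w'e wE !wend_cat cE.
Qed.

(** A closed walk whose value has the property [pr] contains a short cycle with
    that property; the cycle cannot be reached by a short closed walk with the
    property, because the detour may have a large opposite value. *)
Lemma cycle_witness (pr : pred R) z w :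
    (forall x y, pr (x + y) -> pr x || pr y) ->
    walk z w -> wend z w = z -> pr (wsum z w) ->
  exists z' w1 w2 c, [/\ walk z w1 /\ wend z w1 = z', walk z' w2 /\ wend z' w2 = z,
    walk z' c /\ wend z' c = z', (size c <= #|V|)%N & pr (wsum z' c)].
Proof.
move=> prD; have [k] := ubnP (size w); elim: k => // k IH in w *.
rewrite ltnS => wk ww we wp.
have [sw|/ltnW sw] := leqP (size w) #|V|; first by exists z, [::], [::], w.
have [w1 [c [w2 [wE /andP[c0 sc] cE]]]] := short_cycle z sw.
move: ww we wp; rewrite wE !walk_cat !wend_cat !wsum_cat cE.
move=> /and3P[ww1 wc ww2] we wp.
have /orP[pc|p12] : pr (wsum (wend z w1) c) || pr (wsum z w1 + wsum (wend z w1) w2).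
  by apply: prD; rewrite addrCA.
  by exists (wend z w1), w1, w2, c.
apply: (IH (w1 ++ w2)); rewrite ?walk_cat ?wend_cat ?wsum_cat ?ww1 //.
by apply: leq_trans wk; rewrite wE !size_cat addnCA -{1}[(_ + _)%N]add0n ltn_add2r.
Qed.

Fixpoint wrep c k := if k is k'.+1 then c ++ wrep c k' else [::].

Lemma wrepP z c k : walk z c -> wend z c = z ->
  [/\ walk z (wrep c k), wend z (wrep c k) = z & wsum z (wrep c k) = wsum z c *+ k].
Proof.
move=> cw ce; elim: k => [|k [IH1 IH2 IH3]] //=.
by rewrite walk_cat wend_cat wsum_cat ce cw IH1 IH2 IH3 mulrS.
Qed.

(** * Walks whose cycles have nonpositive weight *)

Section NonPositiveCycles.
Variable ok : pred V.
Hypothesis okP : forall z w, ok z -> walk z w -> wend z w = z -> wsum z w <= 0.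

(** Every node must be [ok], because a cycle to be removed may start at any of them. *)
Definition okwalk z w := walk z w && all ok (wnodes z w).

Lemma okwalk_cut z w1 c w2 : wend (wend z w1) c = wend z w1 ->
  okwalk z (w1 ++ c ++ w2) -> okwalk z (w1 ++ w2) /\ wsum (wend z w1) c <= 0.
Proof.
move=> cE; rewrite /okwalk /wnodes /= !map_cat !all_cat !walk_cat cE.
case/and5P=> /and3P[ww1 wc ww2] okz okw1 okc okw2; split.
  by rewrite ww1 ww2 okz okw1 okw2.
apply: okP cE => //; rewrite /wend; case/lastP: (map snd w1) okw1 => //= s x.
by rewrite last_rcons all_rcons => /andP[].
Qed.

Let gs := [seq g x.1.1 x.1.2 x.2 | x : V * L * V].

(** The sums of at most [k] values of [g], taken over all triples whether they are edges or not: all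
    that matters is that the list is finite and depends only on [k]. *)
Fixpoint sums k : seq R :=
  if k is k'.+1 then sums k' ++ [seq x + y | x <- gs, y <- sums k'] else [:: 0].

Lemma sums_le k l : (k <= l)%N -> {subset sums k <= sums l}.
Proof.
move=> /subnK <-; elim: (l - k)%N => // i IH x xk.
by rewrite addSn mem_cat IH.
Qed.

Lemma sumsD k l x y : x \in sums k -> y \in sums l -> x + y \in sums (k + l).
Proof.
elim: k x => [|k IH] x /=.
  by rewrite inE => /eqP-> yl; rewrite add0r.
rewrite mem_cat => /orP[xk yl|/allpairsP[[a b] /= [ag bk ->]] yl].
  by rewrite mem_cat IH.
rewrite mem_cat -addrA; apply/orP; right; apply/allpairsP; exists (a, b + y).
by split=> //; apply: IH.
Qed.

Lemma wsum_sums z w : wsum z w \in sums (size w).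
Proof.
elim: w z => [|[a z'] w IH] z /=; first by rewrite inE.
rewrite mem_cat; apply/orP; right; apply/allpairsP; exists (g z a z', wsum z' w).
by split=> //=; apply/mapP; exists (z, a, z'); rewrite ?mem_enum.
Qed.

Lemma seq_ub (s : seq R) : exists M, 0 <= M /\ {in s, forall x, x <= M}.
Proof.
elim: s => [|x s [M [M0 sM]]]; first by exists 0.
exists (Num.max x M); split; first by rewrite le_max M0 orbT.
by move=> y; rewrite inE => /orP[/eqP->|/sM yM]; rewrite le_max ?lexx ?yM ?orbT.
Qed.

Lemma seq_gap (s : seq R) : exists2 eps, 0 < eps & {in s, forall x, x < 0 -> x <= - eps}.
Proof.
elim: s => [|x s [eps eps0 sP]]; first by exists 1.
have [x0|x0] := ltP x 0; last first.
  exists eps => // y; rewrite inE => /orP[/eqP-> y0|]; last exact: sP.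
  by move: (lt_le_trans y0 x0); rewrite ltxx.
exists (Num.min eps (- x)); first by rewrite lt_min eps0 oppr_gt0.
move=> y; rewrite inE lerNr ge_min => /orP[/eqP-> _|ys y0]; first by rewrite lexx orbT.
by rewrite lerNr sP.
Qed.

(** Removing a cycle never lowers the value, so the bound for walks of length at most [#|V|] holds
    for all. *)
Lemma wsum_bounded : exists M, forall z w, okwalk z w -> wsum z w <= M.
Proof.
have [M [_ MP]] := seq_ub (sums #|V|); exists M => z w.
have [k] := ubnP (size w); elim: k => // k IH in w *; rewrite ltnS => wk ww.
have [sw|/ltnW sw] := leqP (size w) #|V|.
  by apply: MP; apply: sums_le (wsum_sums z w).
have [w1 [c [w2 [wE /andP[c0 _] cE]]]] := short_cycle z sw.
move: ww; rewrite wE => /(okwalk_cut cE)[ok12 c_le0].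
rewrite !wsum_cat cE addrCA -[M]add0r -wsum_cat; apply: lerD => //.
apply: IH => //; apply: leq_trans wk.
by rewrite wE !size_cat addnCA -{1}[(_ + _)%N]add0n ltn_add2r.
Qed.

(** A negative short cycle costs at least a fixed [eps], so that the values above
    a given bound come from walks with a bounded number of negative cycles; the
    cycles of value zero do not matter. *)
Lemma wsum_finite T : exists Fs : seq R,
  forall z w, okwalk z w -> - T <= wsum z w -> wsum z w \in Fs.
Proof.
have [M [_ MP]] := seq_ub (sums #|V|).
have [eps eps0 epsP] := seq_gap (sums #|V|).
(* [k] counts the removed cycles of negative weight: each accounts for at most [#|V|] steps and
   costs at least [eps]. *)
have dec z w : okwalk z w ->
    exists2 k, wsum z w \in sums (#|V| * k.+1) & wsum z w <= M - eps *+ k.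
  have [k] := ubnP (size w); elim: k => // k IH in w *; rewrite ltnS => wk ww.
  have [sw|/ltnW sw] := leqP (size w) #|V|.
    have wV : wsum z w \in sums #|V| by apply: sums_le (wsum_sums z w).
    by exists 0; rewrite ?muln1 // subr0 MP.
  have [w1 [c [w2 [wE /andP[c0 sc] cE]]]] := short_cycle z sw.
  move: ww; rewrite wE => /(okwalk_cut cE)[ok12 c_le0].
  have [|l l1 l2] := IH (w1 ++ w2) _ ok12.
    apply: leq_trans wk.
    by rewrite wE !size_cat addnCA -{1}[(_ + _)%N]add0n ltn_add2r.
  rewrite !wsum_cat cE addrCA -wsum_cat.
  have cV : wsum (wend z w1) c \in sums #|V| by apply: sums_le (wsum_sums _ c).
  move: c_le0; rewrite le_eqVlt => /orP[/eqP->|c_lt0].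
    by exists l; rewrite add0r.
  exists l.+1; first by rewrite mulnS sumsD.
  by have := epsP _ cV c_lt0; rewrite [_ *+ l.+1]mulrS; lra.
exists (sums (#|V| * (Num.bound ((M + T) / eps)).+1)) => z w /dec[k wk wM] Tw.
apply: sums_le wk; rewrite leq_mul2l ltnS; apply/orP; right.
have : eps *+ k <= M + T by lra.
rewrite -mulr_natl -ler_pdivlMr // => kT; rewrite -(ler_nat R).
apply: le_trans kT _; apply/ltW/archi_boundP.
by rewrite divr_ge0 ?(ltW eps0) //; apply: le_trans (mulrn_wge0 k (ltW eps0)) _; lra.
Qed.

End NonPositiveCycles.
End LabelledGraph.

(** * Words, matrix entries and paths *)

Definition rept (T : Type) (v : seq T) k : seq T := flatten (nseq k v).

Lemma reptD (T : Type) (v : seq T) k l : rept v (k + l) = rept v k ++ rept v l.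
Proof. by rewrite /rept nseqD flatten_cat. Qed.

Lemma reptM (T : Type) (v : seq T) k l : rept v (k * l) = rept (rept v k) l.
Proof. by elim: l => [|l IH]; rewrite ?muln0 // mulnS reptD IH. Qed.

Lemma mulmx_neq0 (R : realType) m n p (A : 'M[maxplus R]_(m, n))
    (B : 'M[maxplus R]_(n, p)) i j :
  ((A *m B) i j != 0) = [exists k, (A i k != 0) && (B k j != 0)].
Proof.
apply/idP/existsP => [|[k /andP[Ak Bk]]]; rewrite mxE.
  move=> s0; have [k _ kE] := mp_sum_attain s0.
  by exists k; rewrite -mp_mul_neq0 -kE.
by apply: (mp_sum_neq0 (i := k)); rewrite ?mp_mul_neq0 ?Ak.
Qed.

Section Words.
Variables (R : realType) (Sigma : finType) (n : nat) (A : automaton R Sigma n).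
Implicit Types (a : Sigma) (u v x y z : seq Sigma) (P C : {set 'I_n}) (q r s : 'I_n).

Definition fwd x q := (init_wt A *m wordmx A x) 0 q.
Definition bwd y q := (wordmx A y *m final_wt A) q 0.

Lemma wordmx_cons a u : wordmx A (a :: u) = letmx A a *m wordmx A u.
Proof. exact: big_cons. Qed.

Lemma wordmx1 q r : (wordmx A [::] q r != 0) = (q == r).
Proof. by rewrite wordmx_nil mxE; case: (q == r). Qed.

Lemma bwd_nil q : bwd [::] q = final_wt A q 0.
Proof. by rewrite /bwd wordmx_nil mul1mx. Qed.

Lemma bwd_cat u y q : bwd (u ++ y) q = \sum_r wordmx A u q r * bwd y r.
Proof. by rewrite /bwd wordmx_cat -mulmxA mxE. Qed.

Lemma bwd_cons a y q : bwd (a :: y) q = \sum_r letmx A a q r * bwd y r.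
Proof. by rewrite /bwd wordmx_cons -mulmxA mxE. Qed.

Lemma fwd_nil q : fwd [::] q = init_wt A 0 q.
Proof. by rewrite /fwd wordmx_nil mulmx1. Qed.

Lemma fwd_cat x u q : fwd (x ++ u) q = \sum_r fwd x r * wordmx A u r q.
Proof. by rewrite /fwd wordmx_cat mulmxA mxE. Qed.

Lemma series_cat x y : series A (x ++ y) = \sum_q fwd x q * bwd y q.
Proof. by rewrite /series wordmx_cat mulmxA -mulmxA mxE. Qed.

Lemma series_ge x z y q r :
  mp_le (fwd x q * wordmx A z q r * bwd y r) (series A (x ++ z ++ y)).
Proof.
rewrite series_cat -mulrA; apply: mp_le_trans (mp_le_sumT (fun q => fwd x q * bwd (z ++ y) q) q).
apply: mp_leM (mp_le_refl _) _; rewrite bwd_cat.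
exact: (mp_le_sumT (fun r => wordmx A z q r * bwd y r)).
Qed.

Lemma series_ge2 x y q : mp_le (fwd x q * bwd y q) (series A (x ++ y)).
Proof. by rewrite series_cat (mp_le_sumT (fun q => fwd x q * bwd y q)). Qed.

Definition Psucc a P := [set r | [exists q in P, transition A q a r]].
Definition Cpre a C := [set q | [exists r in C, transition A q a r]].
Definition Pw P u := foldl (fun P a => Psucc a P) P u.
Definition Cw u C := foldr Cpre C u.
Definition Init := [set q | initial A q].
Definition Fin := [set q | final A q].

Lemma Pw_cat P u v : Pw P (u ++ v) = Pw (Pw P u) v.
Proof. exact: foldl_cat. Qed.

Lemma Cw_cat C u v : Cw (u ++ v) C = Cw u (Cw v C).
Proof. exact: foldr_cat. Qed.

Lemma Pw_rept P v k : Pw P v = P -> Pw P (rept v k) = P.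
Proof. by move=> vP; elim: k => //= k IH; rewrite /rept /= Pw_cat vP. Qed.

Lemma Cw_rept C v k : Cw v C = C -> Cw (rept v k) C = C.
Proof. by move=> vC; elim: k => //= k IH; rewrite /rept /= Cw_cat [X in Cw v X]IH. Qed.

Lemma mem_Pw P u r : (r \in Pw P u) = [exists q in P, wordmx A u q r != 0].
Proof.
elim: u P => [|a u IH] P.
  apply/idP/exists_inP => [rP|[q qP]]; first by exists r; rewrite ?wordmx1.
  by rewrite wordmx1 => /eqP <-.
rewrite [Pw _ _]/(Pw (Psucc a P) u) IH; apply/exists_inP/exists_inP.
  move=> [q]; rewrite inE => /exists_inP[s sP sq] qr; exists s => //.
  by rewrite wordmx_cons mulmx_neq0; apply/existsP; exists q; rewrite qr andbT.
move=> [q qP]; rewrite wordmx_cons mulmx_neq0 => /existsP[s /andP[qs sr]].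
by exists s => //; rewrite inE; apply/exists_inP; exists q.
Qed.

Lemma mem_Cw C u q : (q \in Cw u C) = [exists r in C, wordmx A u q r != 0].
Proof.
elim: u q => [|a u IH] q.
  apply/idP/exists_inP => [rP|[r rC]]; first by exists q; rewrite ?wordmx1.
  by rewrite wordmx1 => /eqP ->.
rewrite inE; apply/exists_inP/exists_inP.
  move=> [s]; rewrite IH => /exists_inP[r rC sr] qs; exists r => //.
  by rewrite wordmx_cons mulmx_neq0; apply/existsP; exists s; rewrite sr andbT.
move=> [r rC]; rewrite wordmx_cons mulmx_neq0 => /existsP[s /andP[qs sr]].
by exists s => //; rewrite IH; apply/exists_inP; exists r.
Qed.

Lemma mem_Pw_Init x r : (r \in Pw Init x) = (fwd x r != 0).
Proof.
rewrite mem_Pw /fwd mulmx_neq0; apply: eq_existsb => q.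
by rewrite inE.
Qed.

Lemma mem_Cw_Fin y q : (q \in Cw y Fin) = (bwd y q != 0).
Proof.
rewrite mem_Cw /bwd mulmx_neq0; apply: eq_existsb => r.
by rewrite inE andbC.
Qed.

Lemma series_neq0 x y :
  (series A (x ++ y) != 0) = [exists q in Pw Init x, q \in Cw y Fin].
Proof.
rewrite series_cat; apply/idP/exists_inP => [|[q]].
  move=> s0; have [q _ qE] := mp_sum_attain s0.
  move: s0; rewrite qE mp_mul_neq0 => /andP[xq qy].
  by exists q; rewrite ?mem_Pw_Init ?mem_Cw_Fin.
rewrite mem_Pw_Init mem_Cw_Fin => xq qy.
by apply: (mp_sum_neq0 (i := q)); rewrite ?mp_mul_neq0 ?xq.
Qed.

(** The weight of a path without its initial and final weights. Lists that are not paths get -oo, so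
    that the support of [pwt] is exactly [steps]. *)
Fixpoint pwt q u (p : seq 'I_n) : maxplus R :=
  match u, p with
  | [::], [::] => 1
  | a :: u', r :: p' => letmx A a q r * pwt r u' p'
  | _, _ => 0
  end.

Lemma pwt_neq0 q u p : (pwt q u p != 0) = steps A q u p.
Proof.
elim: u q p => [|a u IH] q [|r p] //=; rewrite ?eqxx //.
by rewrite mp_mul_neq0 IH.
Qed.

Lemma steps_size q u p : steps A q u p -> size p = size u.
Proof. by elim: u q p => [|a u IH] q [|r p] //= /andP[_ /IH->]. Qed.

Lemma pwt_cat q u v p1 p2 : size p1 = size u ->
  pwt q (u ++ v) (p1 ++ p2) = pwt q u p1 * pwt (last q p1) v p2.
Proof.
elim: u q p1 => [|a u IH] q [|r p1] //=; first by rewrite mul1r.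
by move=> [/IH->]; rewrite mulrA.
Qed.

Lemma pwt_le q u p : mp_le (pwt q u p) (wordmx A u q (last q p)).
Proof.
elim: u q p => [|a u IH] q [|r p] //=.
  by rewrite wordmx_nil mxE eqxx /= lexx.
rewrite wordmx_cons mxE.
apply: mp_le_trans (mp_le_sumT (fun s => letmx A a q s * wordmx A u s _) r).
exact: mp_leM (mp_le_refl _) (IH _ _).
Qed.

Lemma pwt_attain q u r : wordmx A u q r != 0 ->
  exists p, [/\ steps A q u p, last q p = r & pwt q u p = wordmx A u q r].
Proof.
elim: u q => [|a u IH] q.
  by rewrite wordmx1 => /eqP<-; exists [::]; rewrite wordmx_nil mxE eqxx.
rewrite wordmx_cons mxE => s0; have [s _ sE] := mp_sum_attain s0.
move: s0; rewrite sE mp_mul_neq0 => /andP[qs /IH[p [ps pr pE]]].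
by exists (s :: p); rewrite /= pE ps pr andbT.
Qed.

Lemma wordmx_path q u p r : steps A q u p -> last q p = r -> wordmx A u q r != 0.
Proof. by rewrite -pwt_neq0 => p0 <-; apply: mp_le_neq0 p0; apply: pwt_le. Qed.

(** * Counting paths *)

Section Counting.
Local Open Scope nat_scope.

(** [cnt] behaves well under concatenation of words, while the list [pths] of the paths themselves
    relates it to [ambiguity]. *)
Fixpoint cnt u q r : nat :=
  if u is a :: u' then \sum_s transition A q a s * cnt u' s r else q == r.

Fixpoint pths u q r : seq (seq 'I_n) :=
  if u is a :: u' then
    flatten [seq [seq s :: p | p <- pths u' s r] | s <- enum 'I_n & transition A q a s]
  else if q == r then [:: [::]] else [::].

Lemma mem_pths u q r p : (p \in pths u q r) = steps A q u p && (last q p == r).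
Proof.
elim: u q p => [|a u IH] q p /=.
  by case: p => [|s p]; case: eqP.
apply/flattenP/idP => [[l /mapP[s]]|].
  rewrite mem_filter => /andP[qs _] -> /mapP[p' p'P ->] /=.
  by move: p'P; rewrite IH qs.
case: p => [|s p] //= => /andP[/andP[qs sp] pr].
exists [seq s :: p | p <- pths u s r].
  by apply/mapP; exists s; rewrite // mem_filter qs mem_enum.
by rewrite map_f // IH sp.
Qed.

Lemma uniq_pths u q r : uniq (pths u q r).
Proof.
elim: u q => [|a u IH] q /=; first by case: eqP.
elim: [seq s <- _ | _] (filter_uniq (fun s => transition A q a s) (enum_uniq 'I_n)) => //=.
move=> s l IHl /andP[sl /IHl ul]; rewrite cat_uniq ul andbT.
rewrite map_inj_uniq ?IH; last by move=> p p' [].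
rewrite andTb; apply/hasPn => p /flattenP[l' /mapP[s' s'l ->] /mapP[p' _ ->]].
by apply/negP => /mapP[p'' _ [ss' _]]; rewrite -ss' s'l in sl.
Qed.

Lemma size_pths u q r : size (pths u q r) = cnt u q r.
Proof.
elim: u q => [|a u IH] q /=; first by case: eqP.
rewrite size_flatten /shape -map_comp sumnE big_map big_filter big_mkcond /=.
rewrite big_enum /=; apply: eq_bigr => s _; rewrite size_map IH.
by case: transition; rewrite ?mul1n.
Qed.

Lemma cnt_cat u v q r : cnt (u ++ v) q r = \sum_s cnt u q s * cnt v s r.
Proof.
elim: u q => [|a u IH] q /=.
  rewrite (bigD1 q) //= eqxx mul1n big1 ?addn0 // => s.
  by rewrite eq_sym => /negPf->.
under eq_bigr do rewrite IH big_distrr /=.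
rewrite exchange_big; apply: eq_bigr => s _; rewrite big_distrl /=.
by apply: eq_bigr => t _; rewrite mulnA.
Qed.

Lemma cnt_gt0 u q r : (0 < cnt u q r) = (wordmx A u q r != 0%R).
Proof.
rewrite -size_pths; apply/idP/idP.
  case E: pths => [|p l] // _.
  have : p \in pths u q r by rewrite E mem_head.
  by rewrite mem_pths => /andP[qp /eqP pr]; apply: wordmx_path pr.
move=> /pwt_attain[p [ps /eqP pr _]]; have : p \in pths u q r by rewrite mem_pths ps.
by case: pths.
Qed.

Lemma cnt_ambiguity u q r : initial A q -> final A r -> cnt u q r <= ambiguity A u.
Proof.
move=> qI rF; rewrite -size_pths -(size_map (fun p => (q, p))).
pose h (x : 'I_n * (size u).-tuple 'I_n) := (x.1, val x.2).
have hI : injective h by move=> [s p] [s' p'] [-> /val_inj->].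
rewrite /ambiguity cardE -(size_map h); apply: uniq_leq_size.
  by rewrite map_inj_uniq ?uniq_pths // => p p' [].
move=> _ /mapP[p pP ->]; move: pP; rewrite mem_pths => /andP[ps /eqP pr].
have sp := steps_size ps; apply/mapP; exists (q, Tuple (introT eqP sp)) => //.
by rewrite mem_enum inE /successful qI ps pr.
Qed.

End Counting.
End Words.

(** * Loops of a finitely ambiguous automaton *)

Section IdentityLoops.
Variables (R : realType) (Sigma : finType) (n : nat) (A : automaton R Sigma n).
Implicit Types (a : Sigma) (u v x y z : seq Sigma) (P C : {set 'I_n}) (q r s : 'I_n).

(** [v] is an identity loop between the states [P] reached so far and the states
    [C] from which the continuation is accepted. *)
Definition idl P C v := [/\ Pw A P v = P, Cw A v C = C
  & forall q r, q \in P -> r \in C -> wordmx A v q r != 0 -> q = r].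

Lemma Pw_step P v q r : q \in P -> wordmx A v q r != 0 -> r \in Pw A P v.
Proof. by move=> qP qr; rewrite mem_Pw; apply/exists_inP; exists q. Qed.

Lemma Cw_step C v q r : r \in C -> wordmx A v q r != 0 -> q \in Cw A v C.
Proof. by move=> rC qr; rewrite mem_Cw; apply/exists_inP; exists r. Qed.

Lemma wordmx_cat_neq0 u v q r : (wordmx A (u ++ v) q r != 0) =
  [exists s, (wordmx A u q s != 0) && (wordmx A v s r != 0)].
Proof. by rewrite wordmx_cat mulmx_neq0. Qed.

Lemma idl_nil P C : idl P C [::].
Proof. by split=> // q r _ _; rewrite wordmx1 => /eqP. Qed.

Lemma idl_cat P C u v : idl P C u -> idl P C v -> idl P C (u ++ v).
Proof.
move=> [uP uC uI] [vP vC vI]; split; rewrite ?Pw_cat ?Cw_cat ?uP ?vC //.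
move=> q r qP rC; rewrite wordmx_cat_neq0 => /existsP[s /andP[qs sr]].
have sP : s \in P by rewrite -uP (Pw_step qP).
have sC : s \in C by rewrite -vC (Cw_step rC).
by rewrite (uI q s) // (vI s r).
Qed.

Lemma idl_rept P C v k : idl P C v -> idl P C (rept v k).
Proof. by move=> vI; elim: k => [|k IH]; [exact: idl_nil | exact: idl_cat]. Qed.

Lemma idl_neq0 P C v q : idl P C v -> q \in P -> q \in C -> wordmx A v q q != 0.
Proof.
move=> [_ vC vI] qP; rewrite -{1}vC mem_Cw => /exists_inP[r rC qr].
by have e := vI q r qP rC qr; rewrite -e in qr.
Qed.

(** Only the diagonal term of the sum survives: from [q], the loop leads to no other state that
    accepts [y]. Hence the weights of pumped words are affine in the number of repetitions. *)
Lemma idl_bwd P v y q : idl P (Cw A y (Fin A)) v -> q \in P ->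
  bwd A (v ++ y) q = wordmx A v q q * bwd A y q.
Proof.
move=> [vP _ vI] qP; rewrite bwd_cat (bigD1 q) //= big1 ?addr0 // => r rq.
apply/eqP; apply: contraNT rq; rewrite mp_mul_neq0 -mem_Cw_Fin => /andP[qr rC].
by rewrite (vI q r).
Qed.

Lemma idl_bwd_rept P v y q k : idl P (Cw A y (Fin A)) v -> q \in P ->
  bwd A (rept v k ++ y) q = wordmx A v q q ^+ k * bwd A y q.
Proof.
move=> vI qP; elim: k => [|k IH]; first by rewrite mul1r.
have [_ vC _] := vI.
rewrite /rept /= -catA (@idl_bwd P) //; first by rewrite IH mulrA exprS.
by rewrite Cw_cat Cw_rept.
Qed.

Hypothesis finA : finitely_ambiguous A.

Section StableLoop.
Variables (x y v : seq Sigma).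
Let P := Pw A (Init A) x.
Let C := Cw A y (Fin A).
Hypotheses (vP : Pw A P v = P) (vC : Cw A v C = C).

Lemma loop_succ q : q \in P -> q \in C ->
  exists r, [/\ r \in P, r \in C & wordmx A v q r != 0].
Proof.
move=> qP; rewrite -{1}vC mem_Cw => /exists_inP[r rC qr].
by exists r; split=> //; rewrite -vP (Pw_step qP).
Qed.

Lemma loop_pred r : r \in P -> r \in C ->
  exists q, [/\ q \in P, q \in C & wordmx A v q r != 0].
Proof.
move=> rP rC; move: rP; rewrite -{1}vP mem_Pw => /exists_inP[q qP qr].
by exists q; split=> //; rewrite -vC (Cw_step rC).
Qed.

Lemma loop_succ_rept q k : q \in P -> q \in C ->
  exists r, [/\ r \in P, r \in C & wordmx A (rept v k) q r != 0].
Proof.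
elim: k q => [|k IH] q qP qC; first by exists q; rewrite wordmx1.
have [s [sP sC qs]] := loop_succ qP qC; have [r [rP rC sr]] := IH s sP sC.
exists r; split=> //; rewrite wordmx_cat_neq0.
by apply/existsP; exists s; rewrite qs.
Qed.

Section Counting.
Local Open Scope nat_scope.

(** Distinct paths from [q] to [r] extend, by fixed paths for [x] and [y], to distinct successful
    paths of the whole word. *)
Lemma loop_cnt_bounded : exists K, forall k q r, q \in P -> r \in C ->
  cnt A (rept v k) q r <= K.
Proof.
have [K KP] := finA; exists K => k q r; rewrite mem_Pw mem_Cw.
move=> /exists_inP[i iI iq] /exists_inP[f fF rf].
rewrite inE in iI; rewrite inE in fF.
apply: leq_trans (KP (x ++ rept v k ++ y)); apply: leq_trans (cnt_ambiguity _ iI fF).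
rewrite cnt_cat (bigD1 q) //= cnt_cat (bigD1 r) //=.
rewrite -cnt_gt0 in iq; rewrite -cnt_gt0 in rf.
move: iq rf; case: (cnt A x i q) => // a _; case: (cnt A y r f) => // b _.
by rewrite mulnDr mulnS mulSn; lia.
Qed.

(** If two paths labelled [v] between useful states end in the same state, the
    number of paths labelled [v^k] grows at least linearly in [k]. *)
Lemma loop_col s : s \in P -> s \in C -> \sum_(q in P :&: C) cnt A v q s <= 1.
Proof.
move=> sP sC; rewrite leqNgt; apply/negP => col2.
have [K KP] := loop_cnt_bounded.
pose Z k t := \sum_(r in P :&: C) cnt A (rept v k) t r.
have Z_gt0 k t : t \in P :&: C -> 0 < Z k t.
  rewrite inE => /andP[tP tC]; have [r [rP rC tr]] := loop_succ_rept k tP tC.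
  by rewrite /Z (bigD1 r) ?inE ?rP //= addn_gt0 cnt_gt0 tr.
have sPC : s \in P :&: C by rewrite inE sP.
(* One more copy of [v] in front multiplies the number [Z k t] of paths from each useful [t] by a
   column sum. It is at least 1 by [loop_pred], and at least 2 for [s], where [Z k s] is
   positive. *)
have grow k : k <= \sum_(q in P :&: C) Z k q.
  elim: k => // k IH.
  have -> : \sum_(q in P :&: C) Z k.+1 q =
      \sum_t (\sum_(q in P :&: C) cnt A v q t) * Z k t.
    rewrite /Z; under eq_bigr => q _.
      under eq_bigr => r _ do rewrite [rept _ _]/(v ++ rept v k) cnt_cat.
      rewrite exchange_big /=; over.
    rewrite exchange_big /=; apply: eq_bigr => t _.
    rewrite big_distrl /=; apply: eq_bigr => q _.
    by rewrite big_distrr.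
  rewrite (bigID (mem (P :&: C))) /= (bigD1 s) //=.
  rewrite (bigD1 s) //= in IH.
  have le : \sum_(t in P :&: C | t != s) Z k t <=
      \sum_(t in P :&: C | t != s) (\sum_(q in P :&: C) cnt A v q t) * Z k t.
    apply: leq_sum => t /andP[]; rewrite inE => /andP[tP tC] _.
    rewrite leq_pmull //; have [q [qP qC qt]] := loop_pred tP tC.
    by rewrite (bigD1 q) ?inE ?qP //= addn_gt0 cnt_gt0 qt.
  have ar (i b c d e : nat) : 2 <= i -> 0 < b -> k <= b + c -> c <= d -> k < i * b + d + e.
    by move=> i2 b0 kbc cd; have : 2 * b <= i * b by [rewrite leq_mul2r i2 orbT]; lia.
  exact: ar col2 (Z_gt0 k s sPC) IH le.
(* [grow] is applied to an exponent just above the total that [loop_cnt_bounded] allows. *)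
suff : #|P :&: C| * (#|P :&: C| * K) < #|P :&: C| * (#|P :&: C| * K) by rewrite ltnn.
apply: leq_trans (grow _) _; rewrite -sum_nat_const; apply: leq_sum => t.
rewrite inE => /andP[tP _]; rewrite -sum_nat_const; apply: leq_sum => r.
by rewrite inE => /andP[_ rC]; apply: KP.
Qed.

Lemma loop_inj q1 q2 p1 p2 : q1 \in P -> q2 \in P ->
  steps A q1 v p1 -> steps A q2 v p2 -> last q1 p1 = last q2 p2 ->
  last q1 p1 \in C -> q1 = q2 /\ p1 = p2.
Proof.
move=> q1P q2P s1 s2 e12 sC; set s := last q1 p1 in e12 sC *.
have c1 : wordmx A v q1 s != 0%R by apply: wordmx_path s1 _.
have c2 : wordmx A v q2 s != 0%R by apply: wordmx_path s2 _.
have sP : s \in P by rewrite -vP (Pw_step q1P).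
have q1C : q1 \in C by rewrite -vC (Cw_step sC).
have q2C : q2 \in C by rewrite -vC (Cw_step sC).
have := loop_col sP sC; rewrite (bigD1 q1) ?inE ?q1P //=.
case: (eqVneq q1 q2) => [q12 cle|q12]; last first.
  rewrite (bigD1 q2) ?inE ?q2P ?q2C 1?eq_sym //=.
  by move: c1 c2; rewrite -!cnt_gt0; lia.
split=> //; apply/eqP; apply: contraTT cle => p12; rewrite -ltnNge.
suff : 2 <= cnt A v q1 s by lia.
rewrite -size_pths; apply: (@uniq_leq_size _ [:: p1; p2]); first by rewrite /= inE p12.
move=> p; rewrite !inE mem_pths => /orP[/eqP->|/eqP->]; first by rewrite s1 eqxx.
by rewrite q12 s2 -e12 eqxx.
Qed.

End Counting.

Lemma loop_inj_mx q1 q2 r : q1 \in P -> q2 \in P -> r \in C ->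
  wordmx A v q1 r != 0 -> wordmx A v q2 r != 0 -> q1 = q2.
Proof.
move=> q1P q2P rC /pwt_attain[p1 [s1 l1 _]] /pwt_attain[p2 [s2 l2 _]].
by have [|//] := loop_inj q1P q2P s1 s2 (etrans l1 (esym l2)); rewrite l1.
Qed.

Lemma loop_pwt q p r : q \in P -> r \in C -> steps A q v p -> last q p = r ->
  pwt A q v p = wordmx A v q r.
Proof.
move=> qP rC qp pr; have /pwt_attain[p' [s' l' <-]] := wordmx_path qp pr.
by have [|_ ->//] := loop_inj qP qP qp s' (etrans pr (esym l')); rewrite pr.
Qed.

(** By [loop_inj_mx] each useful state has one useful predecessor under [v], and the map [f] to it
    is a permutation of the useful states. Extended by the identity, it lies in a finite group, and
    its order is the required exponent. *)
Lemma loop_idl : exists2 k, (0 < k)%N & idl P C (rept v k).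
Proof.
pose U := P :&: C.
pose f r := if r \in U then odflt r [pick q in U | wordmx A v q r != 0] else r.
have fP r : r \in U -> (f r \in U) && (wordmx A v (f r) r != 0).
  move=> rU; rewrite /f rU; case: pickP => [q //|/= N].
  move: rU; rewrite inE => /andP[rP rC]; have [q [qP qC qr]] := loop_pred rP rC.
  by have := N q; rewrite inE qP qC qr.
have fE q r : q \in P -> r \in U -> wordmx A v q r != 0 -> q = f r.
  move=> qP rU qr; have /andP[+ fr] := fP r rU; rewrite inE => /andP[fP' _].
  by move: rU; rewrite inE => /andP[_ rC]; apply: loop_inj_mx fr.
have fU : f @: U = U.
  apply/setP => q; apply/imsetP/idP => [[r rU ->]|qU].
    by have /andP[] := fP r rU.
  have := qU; rewrite inE => /andP[qP qC]; have [r [rP rC qr]] := loop_succ qP qC.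
  by exists r; rewrite ?inE ?rP //; apply: fE; rewrite ?inE ?rP.
have finj : injective f.
  have /imset_injP fI : #|f @: U| == #|U| by rewrite fU.
  move=> q r; case: (boolP (q \in U)) (boolP (r \in U)) => qU [] rU fqr.
  - exact: fI.
  - by have /andP[] := fP q qU; rewrite fqr {1}/f (negPf rU) (negPf rU).
  - by have /andP[] := fP r rU; rewrite -fqr {1}/f (negPf qU) (negPf qU).
  - by move: fqr; rewrite /f (negPf qU) (negPf rU).
pose s := perm finj.
have sE k q r : q \in P -> r \in C -> wordmx A (rept v k) q r != 0 -> q = (s ^+ k)%g r.
  elim: k q => [|k IH] q qP rC.
    by rewrite wordmx1 expg0 perm1 => /eqP.
  rewrite wordmx_cat_neq0 => /existsP[t /andP[qt tr]].
  have tP : t \in P by rewrite -vP (Pw_step qP).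
  have tC : t \in C by rewrite -(Cw_rept (v := v) k vC) (Cw_step rC).
  by rewrite expgSr permM -(IH t) // permE; apply: fE; rewrite // inE tP.
exists #[s]%g; first exact: order_gt0.
split; rewrite ?Pw_rept ?Cw_rept // => q r qP rC qr.
by rewrite (sE _ _ _ qP rC qr) expg_order perm1.
Qed.

End StableLoop.
End IdentityLoops.

Lemma mulrn_bounded_le0 (R : realType) (a K : R) :
  (forall t : nat, a *+ t <= K) -> a <= 0.
Proof.
move=> aK; rewrite leNgt; apply/negP => a0.
have K0 : 0 <= K by have := aK 0; rewrite mulr0n.
have := aK (Num.bound (K / a)); rewrite -mulr_natl -ler_pdivlMr // leNgt.
by rewrite archi_boundP // divr_ge0 // ltW.
Qed.

(** * Pumping in unambiguous automata *)

Section Unambiguous.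
Variables (R : realType) (Sigma : finType) (n : nat) (B : automaton R Sigma n).
Implicit Types (a : Sigma) (u v x y z : seq Sigma) (q r s : 'I_n).

Lemma series_attain u : series B u != 0 -> exists q p, successful B u q p /\
  series B u = init_wt B 0 q * pwt B q u p * final_wt B (last q p) 0.
Proof.
move=> u0; have uE := @series_cat _ _ _ B [::] u; rewrite cat0s in uE.
move: (u0); rewrite uE => /mp_sum_attain[q _ qE]; rewrite uE qE in u0 *.
move: u0; rewrite mp_mul_neq0 fwd_nil => /andP[qI u0].
have rE : bwd B u q = \sum_r wordmx B u q r * final_wt B r 0 by rewrite /bwd mxE.
rewrite rE in u0 *; have [r _ {}rE] := mp_sum_attain u0.
move: u0; rewrite rE mp_mul_neq0 => /andP[/pwt_attain[p [qp pr pE]] rF].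
exists q, p; rewrite -pE pr mulrA; split=> //.
by rewrite /successful /initial qI qp /final pr rF.
Qed.

Lemma successful_unique u q p q' p' : unambiguous B ->
  successful B u q p -> successful B u q' p' -> q = q' /\ p = p'.
Proof.
move=> uB s s'.
have sz : size p = size u by case/and3P: s => _ /steps_size.
have sz' : size p' = size u by case/and3P: s' => _ /steps_size.
have /card_le1_eqP := uB u.
move=> /(_ (q, Tuple (introT eqP sz)) (q', Tuple (introT eqP sz'))).
by rewrite !inE => /(_ s s')[-> ->].
Qed.

(** A nonzero product is the weight of a successful path, and so is the value of the series; both
    paths are the same one. *)
Lemma unambiguous_series3 x z y q r : unambiguous B ->
  fwd B x q * wordmx B z q r * bwd B y r != 0 ->
  series B (x ++ z ++ y) = fwd B x q * wordmx B z q r * bwd B y r.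
Proof.
move=> uB w0; apply: mp_le_anti; last exact: series_ge.
have [i [p [ps ->]]] : exists q' p, successful B (x ++ z ++ y) q' p /\
    series B (x ++ z ++ y) = init_wt B 0 q' * pwt B q' (x ++ z ++ y) p * final_wt B (last q' p) 0.
  by apply: series_attain; apply: mp_le_neq0 w0; apply: series_ge.
move: w0; rewrite !mp_mul_neq0 => /andP[/andP[+ /pwt_attain[p2 [s2 l2 e2]]]].
rewrite {1}/fwd mxE => f0; have [j _ fE] := mp_sum_attain f0.
move: f0; rewrite fE mp_mul_neq0 => /andP[jI /pwt_attain[p1 [s1 l1 e1]]].
rewrite {1}/bwd mxE => b0; have [k _ bE] := mp_sum_attain b0.
move: b0; rewrite bE mp_mul_neq0 => /andP[/pwt_attain[p3 [s3 l3 e3]] kF].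
have E : pwt B j (x ++ z ++ y) (p1 ++ p2 ++ p3) =
    wordmx B x j q * wordmx B z q r * wordmx B y r k.
  by rewrite !pwt_cat ?(steps_size s1) ?(steps_size s2) // l1 l2 e1 e2 e3 mulrA.
have ls : last j (p1 ++ p2 ++ p3) = k by rewrite !last_cat l1 l2.
have s' : successful B (x ++ z ++ y) j (p1 ++ p2 ++ p3).
  rewrite /successful /initial jI /final ls kF andbT -pwt_neq0 E !mp_mul_neq0.
  by rewrite -e1 -e2 -e3 !pwt_neq0 s1 s2.
have [-> ->] := successful_unique uB ps s'; rewrite E ls /fwd /bwd 2!mxE fE bE.
by rewrite !mulrA mp_le_refl.
Qed.

Lemma sequential_unambiguous : sequential B -> unambiguous B.
Proof.
move=> [/eqP/cards1P[i0 iE] det] u; apply/card_le1_eqP => -[i p] [j p'].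
rewrite !inE /= => /and3P[iI pi _] /and3P[jI pj _].
have /eqP ij : i == i0 by rewrite -in_set1 -iE inE.
have /eqP jj : j == i0 by rewrite -in_set1 -iE inE.
have stepsD w : forall k (s s' : seq 'I_n), steps B k w s -> steps B k w s' -> s = s'.
  elim: w => [|a w IH] k [|l s] [|l' s'] //= /andP[kl ls] /andP[kl' ls'].
  have /card_le1_eqP/(_ l l') := det k a.
  by rewrite !inE => /(_ kl kl') ll; rewrite ll in ls' *; rewrite (IH _ _ _ ls ls').
by rewrite ij jj in pi pj *; congr (_, _); apply: val_inj; exact: stepsD pj pi.
Qed.

(** The states at the ends of the blocks form a walk in the graph of [v], with [tt] as its only
    label, so that a cycle of this walk spans whole copies of [v]. *)
Lemma block_chain v y k q : bwd B (rept v k ++ y) q != 0 -> exists w : seq (unit * 'I_n),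
  [/\ size w = k, walk (fun s _ r => wordmx B v s r != 0) q w & bwd B y (wend q w) != 0].
Proof.
elim: k q => [|k IH] q; first by exists [::].
rewrite /rept /= -catA bwd_cat => q0; have [r _ rE] := mp_sum_attain q0.
move: q0; rewrite rE mp_mul_neq0 => /andP[qr /IH[w [<- ww we]]].
by exists ((tt, r) :: w); rewrite /= qr.
Qed.

Lemma block_walk v q (w : seq (unit * 'I_n)) :
  walk (fun s _ r => wordmx B v s r != 0) q w -> wordmx B (rept v (size w)) q (wend q w) != 0.
Proof.
elim: w q => [|[[] r] w IH] q /=; first by rewrite wordmx1 eqxx.
by move=> /andP[qr /IH rw]; rewrite wordmx_cat_neq0; apply/existsP; exists r; rewrite qr.
Qed.

(** The run repeats a state after [c] blocks. Taking this cycle [t] times still gives a run, which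
    is the only one of the new word, so each turn contributes the same [l]; [t = 1] is the original
    word. *)
Lemma unambiguous_pump x v y N : unambiguous B -> (n <= N)%N ->
  series B (x ++ rept v N ++ y) != 0 ->
  exists c l (s : maxplus R), [/\ (0 < c <= N)%N, l != 0, s != 0
    & forall t, series B (x ++ rept v (N - c + t * c) ++ y) = s * l ^+ t].
Proof.
move=> uB nN; rewrite series_cat => s0; have [q _ qE] := mp_sum_attain s0.
move: s0; rewrite qE mp_mul_neq0 => /andP[qx /block_chain[w [wN ww wy]]].
have [|w1 [c [w2 [wE /andP[c0 cn] cE]]]] := @short_cycle 'I_n _ q w.
  by rewrite card_ord wN.
set r := wend q w1 in cE *; rewrite card_ord in cn.
move: ww wy; rewrite wE !walk_cat !wend_cat cE -/r => /and3P[ww1 wc ww2] wy.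
set i := size w1; set k := size w2.
have rc0 := block_walk wc; rewrite cE in rc0; set l := wordmx B _ r r in rc0.
pose F t := fwd B (x ++ rept v i ++ rept v (t * size c)) r.
pose G := bwd B (rept v k ++ y) r.
have G0 : G != 0.
  rewrite /G bwd_cat; apply: (mp_sum_neq0 (i := wend r w2)) => //.
  by rewrite mp_mul_neq0 (block_walk ww2).
have F0 t : F t != 0.
  elim: t => [|t IH].
    rewrite /F cats0 fwd_cat; apply: (mp_sum_neq0 (i := q)) => //.
    by rewrite mp_mul_neq0 qx (block_walk ww1).
  rewrite /F mulSn addnC reptD !catA fwd_cat; apply: (mp_sum_neq0 (i := r)) => //.
  by rewrite mp_mul_neq0 -catA IH.
have N_eq t : (N - size c + t * size c = i + t * size c + k)%N.
  have : N = (i + (size c + k))%N by rewrite -wN wE !size_cat.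
  by lia.
have SE t : series B (x ++ rept v (N - size c + t * size c) ++ y) = F t * G.
  rewrite N_eq !reptD.
  have -> : x ++ ((rept v i ++ rept v (t * size c)) ++ rept v k) ++ y =
    (x ++ rept v i ++ rept v (t * size c)) ++ [::] ++ (rept v k ++ y) by rewrite /= -!catA.
  have w1E : wordmx B [::] r r = 1 by rewrite wordmx_nil mxE eqxx.
  by rewrite (@unambiguous_series3 _ _ _ r r) // w1E mulr1 // mp_mul_neq0 F0.
have SS t : series B (x ++ rept v (N - size c + t.+1 * size c) ++ y) = F t * G * l.
  rewrite N_eq mulSn [(size c + _)%N]addnC addnA !reptD.
  have -> : x ++ (((rept v i ++ rept v (t * size c)) ++ rept v (size c)) ++ rept v k) ++ y =
    (x ++ rept v i ++ rept v (t * size c)) ++ rept v (size c) ++ (rept v k ++ y)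
    by rewrite -!catA.
  by rewrite (@unambiguous_series3 _ _ _ r r) // ?mp_mul_neq0 ?F0 ?rc0 // mulrAC.
exists (size c), l, (F 0 * G); split; rewrite ?mp_mul_neq0 ?F0 //.
  by rewrite c0 (leq_trans cn).
by elim=> [|t IH]; [rewrite SE mulr1 | rewrite SS -SE IH -mulrA -exprSr].
Qed.

End Unambiguous.

(** * Optimal runs of pumped words *)

Section Win.
Variables (R : realType) (Sigma : finType) (n : nat) (A : automaton R Sigma n).
Variables (m : nat) (B : automaton R Sigma m).
Hypotheses (uB : unambiguous B) (AB : series B =1 series A).
Implicit Types (a : Sigma) (u v x y z : seq Sigma) (q r s : 'I_n).

Definition optimal x y q :=
  (series A (x ++ y) != 0) && (fwd A x q * bwd A y q == series A (x ++ y)).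

(** Unambiguity makes the weights of the words [x v^k y] affine along an arithmetic
    progression of exponents [k]; if the run through [q] is optimal for one of them,
    its slope must be the common one. *)
Lemma optimal_wins x v y q r :
  let P := Pw A (Init A) x in let C := Cw A y (Fin A) in
  idl A P C v -> q \in P -> q \in C -> r \in P -> r \in C ->
  optimal x (rept v m ++ y) q -> mp_le (wordmx A v r r) (wordmx A v q q).
Proof.
move=> P C vI qP qC rP rC /andP[S0 /eqP qS].
rewrite -AB in S0; have [c [l [s [/andP[c0 cm] l0 s0 SE]]]] := unambiguous_pump uB (leqnn m) S0.
pose val t k := fwd A x t * (wordmx A v t t ^+ k * bwd A y t).
have valE t k : t \in P -> fwd A x t * bwd A (rept v k ++ y) t = val t k.
  by move=> tP; rewrite (@idl_bwd_rept _ _ _ _ P).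
have val_le t k : t \in P -> mp_le (val t (m - c + k * c)%N) (s * l ^+ k).
  by move=> tP; rewrite -SE AB -valE // series_ge2.
have val_eq : val q (m - c + 1 * c)%N = s * l ^+ 1.
  by rewrite -SE AB -valE // mul1n subnK // qS.
have := val_le q 0 qP; have := val_le q 2 qP; have := val_le r ^~ rP.
move: val_eq l0 s0; rewrite /val.
have := idl_neq0 vI qP qC; have := idl_neq0 vI rP rC.
move: qP qC rP rC; rewrite !mem_Pw_Init !mem_Cw_Fin.
case: (fwd A x q) => // fq _; case: (bwd A y q) => // gq _.
case: (fwd A x r) => // fr _; case: (bwd A y r) => // gr _.
case: (wordmx A v r r) => // lr _; case: (wordmx A v q q) => // lq _.
case: l {SE val_le} => // l; case: s => // s + _ _.
have mc k : fr + (lr *+ (m - c + k * c) + gr) = (fr + lr *+ (m - c) + gr) + lr *+ c *+ k.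
  by rewrite mulrnDr mulnC mulrnA; lra.
rewrite !mp_exp /= => -[e1] H h2 h0.
have le k : (fr + lr *+ (m - c) + gr) + lr *+ c *+ k <= s + l *+ k.
  by have := H k; rewrite !mp_exp /= mc.
(* The affine weight through [q] meets the line [s + l t] at [t = 1] and is not above it at [t = 0]
   and [t = 2], so the slopes agree. The weight through [r] stays below this line for all [t], which
   bounds its slope. *)
have lE : l = lq *+ c.
  move: e1 h0 h2; rewrite mul0n mul1n addn0 mul2n -addnn addnA !mulrnDr.
  rewrite mulr0n mulr1n ?mulr2n.
  move: (lq *+ (m - c)) (lq *+ c) => b1 b2; lra.
have : lr *+ c - lq *+ c <= 0.
  apply: (@mulrn_bounded_le0 _ _ (s - (fr + lr *+ (m - c) + gr))) => k.
  by rewrite mulrnBl -lE; have := le k; lra.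
by rewrite -mulrnBl -mulr_natr pmulr_lle0 ?ltr0n // subr_le0.
Qed.

End Win.

(** * Good states *)

Section NodeGraph.
Variables (R : realType) (Sigma : finType) (n : nat) (A : automaton R Sigma n).
Implicit Types (a : Sigma) (u v x y : seq Sigma) (P C D : {set 'I_n}) (q r s : 'I_n).

(** A node [(P, C, D, q, r)] records two states [q] and [r] reached by the same
    word, the set [P] of the states reached by that word, and the sets [C] and [D]
    of the states that can still accept two given continuations. *)
Definition node : Type := ({set 'I_n} * {set 'I_n} * {set 'I_n} * 'I_n * 'I_n)%type.

(** [P] is determined forwards and [C], [D] backwards, so the old values of [C] and [D] are computed
    from the new ones. *)
Definition edge (z : node) a (z' : node) : bool :=
  let: (P, C, D, q, r) := z in let: (P', C', D', q', r') := z' in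
  [&& P' == Psucc A a P, C == Cpre A a C', D == Cpre A a D',
      transition A q a q' & transition A r a r'].

(** What the second state gains on the first. On an edge both entries are finite, so the default of
    [mpval] does not interfere. *)
Definition gain (z : node) a (z' : node) : R :=
  mpval (letmx A a z.2 z'.2) - mpval (letmx A a z.1.2 z'.1.2).

Local Notation nwalk := (walk edge).
Local Notation nsum := (wsum gain).

Lemma nwalk_paths P C D q r w P' C' D' q' r' :
  nwalk (P, C, D, q, r) w -> wend (P, C, D, q, r) w = (P', C', D', q', r') ->
  let u := map fst w in
  [/\ Pw A P u = P', Cw A u C' = C & Cw A u D' = D] /\
  exists p1 p2, [/\ steps A q u p1, steps A r u p2, last q p1 = q', last r p2 = r' &
    nsum (P, C, D, q, r) w = mpval (pwt A r u p2) - mpval (pwt A q u p1)].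
Proof.
elim: w P C D q r => [|[a [[[[P1 C1] D1] q1] r1]] w IH] P C D q r /=.
  move=> _ [-> -> -> -> ->]; split=> //; exists [::], [::]; split=> //=.
  by rewrite subrr.
move=> /andP[/and5P[/eqP-> /eqP-> /eqP-> qq1 rr1] ww1] we.
have [[PE CE DE] [p1 [p2 [s1 s2 l1 l2 ->]]]] := IH _ _ _ _ _ ww1 we.
split; first by rewrite -PE -CE -DE.
exists (q1 :: p1), (r1 :: p2); rewrite /= qq1 rr1 s1 s2; split=> //.
move: qq1 rr1 s1 s2; rewrite /gain /transition -!pwt_neq0 /=.
case: (letmx A a q q1) => // b _; case: (letmx A a r r1) => // c _.
by case: pwt => // d _; case: pwt => // e _ /=; lra.
Qed.

Lemma paths_nwalk P C D q r u p1 p2 : steps A q u p1 -> steps A r u p2 ->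
  exists w, [/\ nwalk (P, Cw A u C, Cw A u D, q, r) w, map fst w = u,
    wend (P, Cw A u C, Cw A u D, q, r) w = (Pw A P u, C, D, last q p1, last r p2) &
    nsum (P, Cw A u C, Cw A u D, q, r) w = mpval (pwt A r u p2) - mpval (pwt A q u p1)].
Proof.
elim: u P q r p1 p2 => [|a u IH] P q r [|q1 p1] [|r1 p2] //=.
  by exists [::]; split; rewrite //= subrr.
move=> /andP[qq1 s1] /andP[rr1 s2].
have [w [w1 w2 w3 w4]] := IH (Psucc A a P) _ _ _ _ s1 s2.
exists ((a, (Psucc A a P, Cw A u C, Cw A u D, q1, r1)) :: w).
split=> //=; rewrite ?w2 ?w1 ?eqxx ?qq1 ?rr1 // w4.
move: qq1 rr1 s1 s2; rewrite /gain /transition -!pwt_neq0 /=.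
case: (letmx A a q q1) => // b _; case: (letmx A a r r1) => // c _.
by case: pwt => // d _; case: pwt => // e _ /=; lra.
Qed.

(** No other useful state gains weight with respect to [q] on a common loop. *)
Definition good P C q := [/\ q \in P, q \in C & forall r, r \in P -> r \in C ->
  forall w, nwalk (P, C, C, q, r) w -> wend (P, C, C, q, r) w = (P, C, C, q, r) ->
  nsum (P, C, C, q, r) w <= 0].

Definition goodb P C q : bool := `[< good P C q >].

(** [(st u).1] is the set of the states from which [u] can be accepted and
    [(st u).2 P] the subset of those from which this is possible along good
    states, [P] being the set of the states reached before reading [u]. *)
Definition stype : Type := ({set 'I_n} * {ffun {set 'I_n} -> {set 'I_n}})%type.

Definition st0 : stype :=
  (Fin A, [ffun P : {set 'I_n} => [set q in P | goodb P (Fin A) q]]).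

Definition stnext a (X : stype) : stype := (Cpre A a X.1,
  [ffun P : {set 'I_n} => [set q in P | goodb P (Cpre A a X.1) q &&
     [exists r in X.2 (Psucc A a P), transition A q a r]]]).

Definition st u : stype := foldr stnext st0 u.

Lemma st1 u : (st u).1 = Cw A u (Fin A).
Proof. by elim: u => //= a u ->. Qed.

Definition dominant := forall u,
  [exists q in Init A, q \in (st u).1] -> [exists q in Init A, q \in (st u).2 (Init A)].

Definition twins := forall x y y' q q', 
  let P := Pw A (Init A) x in
  let C := Cw A y (Fin A) in let D := Cw A y' (Fin A) in
  good P C q -> good P D q' -> forall w, nwalk (P, C, D, q, q') w ->
  wend (P, C, D, q, q') w = (P, C, D, q, q') -> nsum (P, C, D, q, q') w = 0.

Hypothesis finA : finitely_ambiguous A.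

(** Repeating a closed walk makes its label an identity loop, for which the
    weights of the closed walk are entries of the matrix of the label. *)
Lemma closed_walk_idl x y y' w q r :
  let P := Pw A (Init A) x in
  let C := Cw A y (Fin A) in let D := Cw A y' (Fin A) in
  q \in P -> q \in C -> r \in P -> r \in D ->
  nwalk (P, C, D, q, r) w -> wend (P, C, D, q, r) w = (P, C, D, q, r) ->
  exists v k, [/\ (0 < k)%N, idl A P C v, idl A P D v &
   nsum (P, C, D, q, r) w *+ k = mpval (wordmx A v r r) - mpval (wordmx A v q q)].
Proof.
move=> P C D qP qC rP rD ww we.
have [[PE CE DE] _] := nwalk_paths ww we; set v0 := map fst w in PE CE DE.
have [k1 k1_gt0 I1] := loop_idl finA PE CE.
have [k2 k2_gt0 I2] := loop_idl finA PE DE.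
set v := rept v0 (k1 * k2).
have vC : idl A P C v by rewrite /v reptM; apply: idl_rept.
have vD : idl A P D v by rewrite /v mulnC reptM; apply: idl_rept.
exists v, (k1 * k2)%N; split=> //; first by rewrite muln_gt0 k1_gt0.
have [ww' we' <-] := wrepP gain (k1 * k2) ww we.
have lab : map fst (wrep w (k1 * k2)) = v.
  by rewrite /v; elim: (k1 * k2)%N => // k IH; rewrite /= map_cat IH.
have [_ [p1 [p2 [s1 s2 l1 l2 ->]]]] := nwalk_paths ww' we'.
rewrite lab in s1 s2 *.
have [PE' CE' _] := vC; have [_ DE' _] := vD.
by rewrite (loop_pwt finA PE' CE' qP qC s1 l1) (loop_pwt finA PE' DE' rP rD s2 l2).
Qed.

Lemma not_good_idl x y q :
  let P := Pw A (Init A) x in let C := Cw A y (Fin A) in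
  q \in P -> q \in C -> ~ good P C q -> exists r v,
  [/\ r \in P, r \in C, idl A P C v & ~~ mp_le (wordmx A v r r) (wordmx A v q q)].
Proof.
move=> P C qP qC Ng; apply: contrapT => H; case: Ng; split=> // r rP rC w ww we.
rewrite leNgt; apply/negP => w_gt0; case: H.
have [v [k [k0 vI _ wE]]] := closed_walk_idl qP qC rP rC ww we.
exists r, v; split=> //.
have : 0 < nsum (P, C, C, q, r) w *+ k by rewrite pmulrn_lgt0.
rewrite wE; move: (idl_neq0 vI qP qC) (idl_neq0 vI rP rC).
case: (wordmx A v q q) => // b _; case: (wordmx A v r r) => // c _ /=.
by rewrite subr_gt0 ltNge.
Qed.

Variables (m : nat) (B : automaton R Sigma m).
Hypotheses (uB : unambiguous B) (AB : series B =1 series A).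

Lemma optimal_mem x y q : optimal A x y q ->
  (q \in Pw A (Init A) x) && (q \in Cw A y (Fin A)).
Proof.
move=> /andP[S0 /eqP SE]; move: S0.
by rewrite -SE mp_mul_neq0 mem_Pw_Init mem_Cw_Fin.
Qed.

(** An identity loop brings the optimal run back to the same state, so the cut between prefix and
    suffix can move past it. *)
Lemma optimal_shift x v y q : idl A (Pw A (Init A) x) (Cw A y (Fin A)) v ->
  optimal A x (v ++ y) q -> optimal A (x ++ v) y q.
Proof.
move=> vI xq; have := optimal_mem xq; rewrite Cw_cat.
move: xq; rewrite /optimal -catA => /andP[-> /eqP SE] /andP[qP _] /=.
apply/eqP/mp_le_anti; first by rewrite catA series_ge2.
rewrite -SE (idl_bwd vI) // mulrA; apply: mp_leM (mp_le_refl _).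
by rewrite fwd_cat (mp_le_sumT (fun r => fwd A x r * wordmx A v r q)).
Qed.

(** For each bad useful state, [z] contains a block of copies of a loop on which it loses, and
    [optimal_wins] excludes that state. The blocks are identity loops, so [z] works for every [x]
    and [y] with the same sets, and [optimal_shift] passes from one block to the next. *)
Lemma filter_word x0 y0 (l : seq 'I_n) :
  let P := Pw A (Init A) x0 in let C := Cw A y0 (Fin A) in
  exists2 z, idl A P C z & forall x y, Pw A (Init A) x = P -> Cw A y (Fin A) = C ->
    forall q, q \in l -> optimal A x (z ++ y) q -> good P C q.
Proof.
move=> P C; elim: l => [|q0 l [z zI zP]]; first by exists [::]; [exact: idl_nil|].
have [q0g|q0Ng] := EM (good P C q0).
  exists z => // x y xP yC q; rewrite inE => /orP[/eqP->//|]; exact: zP.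
have [q0U|q0U] := boolP ((q0 \in P) && (q0 \in C)); last first.
  exists z => // x y xP yC q; rewrite inE => /orP[/eqP->|]; last exact: zP.
  move=> /optimal_mem; have [_ zC _] := zI.
  by rewrite Cw_cat xP yC zC (negPf q0U).
have /andP[q0P q0C] := q0U.
have [r [v [rP rC vI Nle]]] := not_good_idl q0P q0C q0Ng.
(* [m], the dimension of [B], is the number of copies that makes a run of [B] repeat a state. *)
exists (rept v m ++ z); first by apply: idl_cat => //; apply: idl_rept.
move=> x y xP yC q; have [zP' zC _] := zI; have [vP vC _] := vI.
have zyC : Cw A (z ++ y) (Fin A) = C by rewrite Cw_cat yC zC.
rewrite -catA inE => /orP[/eqP->|ql] xq.
  case/negP: Nle; have := @optimal_wins _ _ _ A _ B uB AB x v (z ++ y) q0 r.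
  by rewrite /= xP zyC; apply.
apply: (zP (x ++ rept v m) y) => //; first by rewrite Pw_cat xP Pw_rept.
by apply: optimal_shift xq; rewrite xP zyC; apply: idl_rept.
Qed.

(** Inserting long repetitions of the loops on which a state loses forces the
    optimal runs through good states only. *)
Lemma filtered_word u : forall P, (exists x, Pw A (Init A) x = P) ->
  exists2 u', Cw A u' (Fin A) = Cw A u (Fin A) &
    forall x, Pw A (Init A) x = P -> forall q, optimal A x u' q -> q \in (st u).2 P.
Proof.
elim: u => [|a u IH] P [x0 x0P].
  have [z zI zP] := filter_word x0 [::] (enum 'I_n).
  rewrite x0P in zI zP; exists z; first by case: zI.
  move=> x xP q xq; have := optimal_mem xq; rewrite xP => /andP[qP _].
  rewrite ffunE inE qP; apply/asboolP.
  by have := zP x [::] xP erefl q; rewrite mem_enum cats0 => /(_ isT xq).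
have [|u' u'C u'P] := IH (Psucc A a P).
  by exists (rcons x0 a); rewrite -cats1 Pw_cat x0P.
have [z zI zP] := filter_word x0 (a :: u') (enum 'I_n).
rewrite x0P in zI zP; have [zP' zC _] := zI.
have auC : Cw A (a :: u') (Fin A) = Cw A (a :: u) (Fin A) by rewrite /= u'C.
exists (z ++ a :: u'); first by rewrite Cw_cat zC.
move=> x xP q xq; have := optimal_mem xq; rewrite xP Cw_cat zC => /andP[qP qC].
have gq : good P (Cw A (a :: u) (Fin A)) q.
  by rewrite -auC; apply: (zP x (a :: u')); rewrite ?mem_enum.
have {}gq : goodb P (Cpre A a (Cw A u (Fin A))) q by apply/asboolP.
rewrite /= ffunE inE qP st1 gq /=.
have := optimal_shift; move=> /(_ x z (a :: u') q); rewrite xP => /(_ zI xq).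
rewrite /optimal => /andP[S0 /eqP SE].
(* [r] is a next state of an optimal run. It is optimal for the prefix extended by [z] and [a], so
   the induction hypothesis applies to it. *)
move: (S0); rewrite -SE bwd_cons big_distrr /= => /mp_sum_attain[r _ rE].
have r0 : fwd A (x ++ z) q * (letmx A a q r * bwd A u' r) != 0.
  by rewrite -rE -big_distrr /= -bwd_cons SE.
apply/exists_inP; exists r; last by move: r0; rewrite !mp_mul_neq0 => /and3P[].
apply: (u'P (x ++ z ++ [:: a])); first by rewrite !Pw_cat xP zP'.
have cE : x ++ (z ++ [:: a]) = (x ++ z) ++ [:: a] by rewrite catA.
have cE' : ((x ++ z) ++ [:: a]) ++ u' = (x ++ z) ++ a :: u' by rewrite -catA.
rewrite /optimal cE cE' S0 /=; apply/eqP/mp_le_anti.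
  by rewrite -cE' series_ge2.
rewrite -SE bwd_cons big_distrr /= rE mulrA; apply: mp_leM (mp_le_refl _).
rewrite (fwd_cat _ (x ++ z)); have -> : letmx A a q r = wordmx A [:: a] q r.
  by rewrite wordmx_cons wordmx_nil mulmx1.
exact: (mp_le_sumT (fun q => fwd A (x ++ z) q * wordmx A [:: a] q r) q).
Qed.

Lemma unambiguous_dominant : dominant.
Proof.
move=> u /exists_inP[q0 q0I]; rewrite st1 => q0u.
have [|u' u'C u'P] := @filtered_word u (Init A); first by exists [::].
have S0 : series A ([::] ++ u') != 0.
  by rewrite series_neq0; apply/exists_inP; exists q0; rewrite // u'C.
move: (S0); rewrite series_cat => /mp_sum_attain[q _ qE].
have oq : optimal A [::] u' q by rewrite /optimal S0 -qE -series_cat /=.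
apply/exists_inP; exists q; last exact: u'P oq.
by have /andP[] := optimal_mem oq.
Qed.

End NodeGraph.

(** * The twins property of sequential series *)

Section SequentialTwins.
Variables (R : realType) (Sigma : finType) (n : nat) (A : automaton R Sigma n).
Variables (m : nat) (B : automaton R Sigma m).
Hypotheses (seqB : sequential B) (AB : series B =1 series A).
Implicit Types (a : Sigma) (u v x y : seq Sigma).

Lemma sequential_fwd x s t : fwd B x s != 0 -> fwd B x t != 0 -> s = t.
Proof.
rewrite -!mem_Pw_Init; have [/eqP/cards1P[i iE] det] := seqB.
have : forall s t, s \in Init B -> t \in Init B -> s = t.
  by move=> s' t'; rewrite /Init iE !inE => /eqP-> /eqP->.
move: (Init B) => P; elim: x P => [|a x IH] P PI; first exact: PI.
apply: IH => s' t'; rewrite !inE => /exists_inP[k kP ks] /exists_inP[l lP lt].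
have kl := PI _ _ kP lP; rewrite -kl in lt.
have /card_le1_eqP/(_ t' s') := det k a.
by rewrite !inE => /(_ lt ks).
Qed.

(** After [x] both words continue from the same state of [B], and the difference of the two values
    depends only on that state. *)
Lemma sequential_lipschitz y y' : exists K : R, forall x,
  series A (x ++ y) != 0 -> series A (x ++ y') != 0 ->
  mpval (series A (x ++ y')) <= mpval (series A (x ++ y)) + K.
Proof.
have [K [_ KP]] := seq_ub [seq mpval (bwd B y' s) - mpval (bwd B y s) | s <- enum 'I_m].
exists K => x; rewrite -!AB !series_cat => S0 S0'.
have [s _ sE] := mp_sum_attain S0; have [t _ tE] := mp_sum_attain S0'.
move: S0 S0'; rewrite sE tE !mp_mul_neq0 => /andP[sx sy] /andP[tx ty].
have ts := sequential_fwd tx sx; rewrite ts in ty *.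
have : mpval (bwd B y' s) - mpval (bwd B y s) <= K by apply/KP/map_f; rewrite mem_enum.
move: sx sy ty; case: (fwd B x s) => // f _; case: (bwd B y s) => // b _.
by case: (bwd B y' s) => // c _ /=; lra.
Qed.

Lemma good_max x y v q r :
  let P := Pw A (Init A) x in let C := Cw A y (Fin A) in
  idl A P C v -> good A P C q -> r \in P -> r \in C ->
  mp_le (wordmx A v r r) (wordmx A v q q).
Proof.
move=> P C vI [qP qC qgood] rP rC.
have /pwt_attain[p1 [s1 l1 e1]] := idl_neq0 vI qP qC.
have /pwt_attain[p2 [s2 l2 e2]] := idl_neq0 vI rP rC.
have [w] := paths_nwalk P C C s1 s2; have [vP vC _] := vI.
rewrite vC vP l1 l2 => -[ww _ we wsE].
have := qgood r rP rC w ww we; rewrite wsE e1 e2.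
move: (idl_neq0 vI qP qC) (idl_neq0 vI rP rC).
by case: (wordmx A v q q) => // b _; case: (wordmx A v r r) => // c _ /=; lra.
Qed.

(** On each turn of the loop, no useful state gains more than the good state [q] does, and hence
    neither does the maximum. *)
Lemma good_series_le x y v q k :
  let P := Pw A (Init A) x in let C := Cw A y (Fin A) in
  idl A P C v -> good A P C q ->
  mp_le (series A (x ++ rept v k ++ y)) (series A (x ++ y) * wordmx A v q q ^+ k).
Proof.
move=> P C vI gq; rewrite series_cat; apply: mp_ge_sum => r _.
have [r0|] := boolP (fwd A x r * bwd A (rept v k ++ y) r == 0).
  by rewrite (eqP r0) mp_le0.
have rk : idl A P C (rept v k) by apply: idl_rept.
rewrite mp_mul_neq0 -mem_Pw_Init -mem_Cw_Fin Cw_cat => /andP[rP].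
have [_ -> _] := rk; move=> rC.
rewrite (idl_bwd_rept k vI rP) mulrCA mulrC.
apply: mp_leM; first exact: series_ge2.
by elim: k {rk} => [|k IH]; rewrite ?mp_le_refl // !exprS mp_leM // (good_max vI).
Qed.

(** Under repetition of [v], the series grows at least as fast as [q'] before [y'], and at most as
    fast as [q] before [y]. If [q'] were faster, the gap would grow linearly, against
    [sequential_lipschitz]. *)
Lemma twin_slope x y y' v q q' :
  let P := Pw A (Init A) x in
  let C := Cw A y (Fin A) in let D := Cw A y' (Fin A) in
  idl A P C v -> idl A P D v -> good A P C q -> good A P D q' ->
  mp_le (wordmx A v q' q') (wordmx A v q q).
Proof.
move=> P C D vC vD gq gq'; have [K KP] := sequential_lipschitz y y'.
have [qP qC _] := gq; have [q'P q'C _] := gq'.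
have lo z t k : idl A P (Cw A z (Fin A)) v -> t \in P ->
    mp_le (fwd A x t * bwd A z t * wordmx A v t t ^+ k) (series A (x ++ rept v k ++ z)).
  by move=> vz tP; rewrite -mulrA [bwd _ _ _ * _]mulrC -(idl_bwd_rept k vz tP) series_ge2.
have loq k := lo y q k vC qP; have loq' k := lo y' q' k vD q'P.
have hiq k := good_series_le k vC gq.
have q0 := idl_neq0 vC qP qC; have q'0 := idl_neq0 vD q'P q'C.
have fq : fwd A x q != 0 by rewrite -mem_Pw_Init.
have bq : bwd A y q != 0 by rewrite -mem_Cw_Fin.
have fq' : fwd A x q' != 0 by rewrite -mem_Pw_Init.
have bq' : bwd A y' q' != 0 by rewrite -mem_Cw_Fin.
have ex0 (z : maxplus R) k : z != 0 -> z ^+ k != 0 by case: z => // z _; rewrite mp_exp.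
have S0 k : series A (x ++ rept v k ++ y) != 0.
  by apply: mp_le_neq0 (loq k) _; rewrite !mp_mul_neq0 fq bq ex0.
have S0' k : series A (x ++ rept v k ++ y') != 0.
  by apply: mp_le_neq0 (loq' k) _; rewrite !mp_mul_neq0 fq' bq' ex0.
have SK k : mpval (series A (x ++ rept v k ++ y')) <= mpval (series A (x ++ rept v k ++ y)) + K.
  by have := KP (x ++ rept v k); rewrite -!catA => /(_ (S0 k) (S0' k)).
have Sxy : series A (x ++ y) != 0 := S0 0%N.
case: (wordmx A v q q) q0 hiq => // l _ hiq; case: (wordmx A v q' q') q'0 loq' => // l' _ loq'.
move: fq' bq' loq' hiq Sxy.
case: (fwd A x q') => // f _; case: (bwd A y' q') => // b _ loq'.
case: (series A (x ++ y)) => // s hiq _.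
rewrite /= -subr_le0; apply: (@mulrn_bounded_le0 _ _ (s + K - f - b)) => k.
move: (loq' k) (hiq k) (SK k) (S0 k) (S0' k); rewrite !mp_exp.
case: (series A (x ++ rept v k ++ y)) => // c; case: (series A (x ++ rept v k ++ y')) => // d.
by rewrite /= mulrnBl; lra.
Qed.

Hypothesis finA : finitely_ambiguous A.

Lemma sequential_twins : twins A.
Proof.
move=> x y y' q q' P C D gq gq' w ww we; have [qP qC _] := gq; have [q'P q'D _] := gq'.
have [v [k [k0 vC vD wk]]] := closed_walk_idl finA qP qC q'P q'D ww we.
have := mp_le_anti (twin_slope vC vD gq gq') (twin_slope vD vC gq' gq).
move=> e; move/eqP: wk; rewrite e subrr mulrn_eq0 => /orP[/eqP k00|/eqP//].
by rewrite k00 in k0.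
Qed.

End SequentialTwins.

(** * Automata over an arbitrary finite type of states *)

Section FinTypeAutomaton.
Variables (R : realType) (Sigma S : finType) (i0 : S -> maxplus R).
Variables (mm : Sigma -> S -> S -> maxplus R) (ff : S -> maxplus R).

Definition mk_aut : automaton R Sigma #|S| := Automaton
  (\row_j i0 (enum_val j)) (fun a => \matrix_(i, j) mm a (enum_val i) (enum_val j))
  (\col_j ff (enum_val j)).

Fixpoint fbw u s : maxplus R :=
  if u is a :: u' then \sum_t mm a s t * fbw u' t else ff s.

Lemma bwd_mk_aut u i : bwd mk_aut u i = fbw u (enum_val i).
Proof.
elim: u i => [|a u IH] i; first by rewrite bwd_nil mxE.
rewrite bwd_cons /= [RHS](reindex (@enum_val S S)) /=; last exact/onW_bij/enum_val_bij.
by apply: eq_bigr => j _; rewrite IH mxE.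
Qed.

Lemma series_mk_aut u : series mk_aut u = \sum_s i0 s * fbw u s.
Proof.
have := series_cat mk_aut [::] u; rewrite cat0s => ->.
rewrite [RHS](reindex (@enum_val S S)) /=; last exact/onW_bij/enum_val_bij.
by apply: eq_bigr => j _; rewrite fwd_nil bwd_mk_aut mxE.
Qed.

(** [fbw u s != 0] says that [u] is accepted from [s]. It suffices that at the start and at each
    step only one choice leads to acceptance. *)
Lemma mk_aut_unambiguous :
  (forall u s t, i0 s != 0 -> i0 t != 0 -> fbw u s != 0 -> fbw u t != 0 -> s = t) ->
  (forall a u s t t', mm a s t != 0 -> mm a s t' != 0 ->
     fbw u t != 0 -> fbw u t' != 0 -> t = t') ->
  unambiguous mk_aut.
Proof.
move=> uI uT u; apply/card_le1_eqP => -[i p] [j p'].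
rewrite !inE /= /successful /initial /final !mxE => /and3P[iI ip pF] /and3P[jI jp' p'F].
have fbw0 w k (s : seq 'I_#|S|) : steps mk_aut k w s -> ff (enum_val (last k s)) != 0 ->
    fbw w (enum_val k) != 0.
  move=> ks sF; rewrite -bwd_mk_aut /bwd mulmx_neq0; apply/existsP; exists (last k s).
  by rewrite (wordmx_path ks) //= mxE.
have ij : i = j by apply: enum_val_inj; apply: uI (fbw0 _ _ _ ip pF) (fbw0 _ _ _ jp' p'F).
rewrite -ij in jp' p'F *; congr (_, _); apply: val_inj => /=.
move: (val p) (val p') ip pF jp' p'F => /= s s'.
elim: u i s s' {iI jI uI p p' ij} => [|a u IH] i [|k s] [|k' s'] //=.
move=> /andP[ik ks] sF /andP[ik' ks'] sF'.
have kk : k = k'.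
  apply: enum_val_inj; apply: (uT a u (enum_val i)).
  - by move: ik; rewrite /transition mxE.
  - by move: ik'; rewrite /transition mxE.
  - exact: fbw0 ks sF.
  - exact: fbw0 ks' sF'.
by rewrite -kk in ks' sF' *; rewrite (IH _ _ _ ks sF ks' sF').
Qed.

Lemma mk_aut_sequential s0 : (forall s, (i0 s != 0) = (s == s0)) ->
  (forall a s t t', mm a s t != 0 -> mm a s t' != 0 -> t = t') -> sequential mk_aut.
Proof.
move=> sI sT; split.
  apply/eqP/cards1P; exists (enum_rank s0); apply/setP => i.
  rewrite !inE /initial mxE sI; apply/eqP/eqP => [<-|->]; last exact: enum_rankK.
  by rewrite enum_valK.
move=> i a; apply/card_le1_eqP => j k; rewrite !inE /transition !mxE => ij ik.
by apply: enum_val_inj; apply: sT ik ij.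
Qed.

End FinTypeAutomaton.

Definition mpinv (R : realType) (x : maxplus R) : maxplus R := omap -%R x.

Lemma mp_mulV (R : realType) (x : maxplus R) : x != 0 -> x * mpinv x = 1.
Proof. by case: x => // r _; congr Some; rewrite subrr. Qed.

(** * Determinization under the twins property *)

Section FiniteVectors.
Variables (R : realType) (Q : finType) (Fs : seq R).

(** Vectors with entries in [Fs] or -oo, the latter being [None]; [seq_sub] makes the listed reals a
    finite type. *)
Definition fvec : finType := {ffun Q -> option (seq_sub Fs)}.

(** [fenc] loses the coordinates whose value is not in [Fs]. *)
Definition fdec (d : fvec) q : maxplus R := omap (@ssval _ _) (d q).
Definition fenc (f : Q -> maxplus R) : fvec := [ffun q => obind insub (f q)].

Lemma fencK f : (forall q, f q != 0 -> mpval (f q) \in Fs) -> fdec (fenc f) =1 f.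
Proof.
move=> fF q; rewrite /fdec ffunE; case: (f q) (fF q) => // r /(_ isT) rF /=.
by rewrite insubT.
Qed.

End FiniteVectors.

Section Determinization.
Variables (R : realType) (Sigma : finType) (n : nat) (B : automaton R Sigma n).
Implicit Types (a : Sigma) (u v x y : seq Sigma) (q r s t : 'I_n).

Hypothesis twinB : forall x q r, fwd B x q != 0 -> fwd B x r != 0 ->
  forall v p1 p2, steps B q v p1 -> steps B r v p2 -> last q p1 = q -> last r p2 = r ->
  pwt B q v p1 = pwt B r v p2.

Let pedge (z : 'I_n * 'I_n) a (z' : 'I_n * 'I_n) :=
  transition B z.1 a z'.1 && transition B z.2 a z'.2.
Let pgain (z : 'I_n * 'I_n) a (z' : 'I_n * 'I_n) : R :=
  mpval (letmx B a z.2 z'.2) - mpval (letmx B a z.1 z'.1).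
Let pok (z : 'I_n * 'I_n) : bool :=
  `[< exists x, fwd B x z.1 != 0 /\ fwd B x z.2 != 0 >].

Lemma fwd_attain x s : fwd B x s != 0 -> exists q p, [/\ initial B q, steps B q x p,
  last q p = s & fwd B x s = init_wt B 0 q * pwt B q x p].
Proof.
rewrite /fwd mxE => s0; have [q _ qE] := mp_sum_attain s0.
move: s0; rewrite qE mp_mul_neq0 => /andP[qI /pwt_attain[p [qp ps <-]]].
by exists q, p.
Qed.

Lemma fwd_rcons x a s : fwd B (rcons x a) s = \sum_t fwd B x t * letmx B a t s.
Proof.
rewrite -cats1 fwd_cat; apply: eq_bigr => t _.
by rewrite wordmx_cons wordmx_nil mulmx1.
Qed.

Lemma pwalk_paths z w : walk pedge z w -> exists p1 p2,
  [/\ steps B z.1 (map fst w) p1, steps B z.2 (map fst w) p2,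
     wend z w = (last z.1 p1, last z.2 p2) &
     wsum pgain z w = mpval (pwt B z.2 (map fst w) p2) - mpval (pwt B z.1 (map fst w) p1)].
Proof.
elim: w z => [|[a z'] w IH] z /=.
  by move=> _; exists [::], [::]; rewrite /= subrr -surjective_pairing.
move=> /andP[/andP[e1 e2] /IH[p1 [p2 [s1 s2 we ->]]]].
exists (z'.1 :: p1), (z'.2 :: p2); rewrite /= e1 e2 s1 s2; split=> //.
move: e1 e2 s1 s2; rewrite /pgain /transition -!pwt_neq0.
case: (letmx B a z.1 z'.1) => // b _; case: (letmx B a z.2 z'.2) => // c _.
by case: pwt => // d _; case: pwt => // e _ /=; lra.
Qed.

Lemma paths_pwalk x q r u p1 p2 : fwd B x q != 0 -> fwd B x r != 0 ->
  steps B q u p1 -> steps B r u p2 -> exists w, okwalk pedge pok (q, r) w /\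
  wsum pgain (q, r) w = mpval (pwt B r u p2) - mpval (pwt B q u p1).
Proof.
rewrite /okwalk; elim: u x q r p1 p2 => [|a u IH] x q r [|q1 p1] [|r1 p2] //= xq xr.
  move=> _ _; exists [::]; rewrite /= subrr; split=> //.
  by rewrite andbT; apply/asboolP; exists x.
move=> /andP[qq1 s1] /andP[rr1 s2].
have [||w [ww wE]] := IH (rcons x a) _ _ _ _ _ _ s1 s2.
- by rewrite fwd_rcons; apply: (mp_sum_neq0 (i := q)) => //; rewrite mp_mul_neq0 xq.
- by rewrite fwd_rcons; apply: (mp_sum_neq0 (i := r)) => //; rewrite mp_mul_neq0 xr.
exists ((a, (q1, r1)) :: w); split.
  have /andP[w1 w2] := ww; apply/andP; split; first by rewrite /= {1}/pedge /= qq1 rr1.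
  by apply/andP; split=> //; apply/asboolP; exists x.
rewrite /= wE.
move: qq1 rr1 s1 s2; rewrite /pgain /transition -!pwt_neq0 /=.
case: (letmx B a q q1) => // b _; case: (letmx B a r r1) => // c _.
by case: pwt => // d _; case: pwt => // e _ /=; lra.
Qed.

Lemma pok_cycle z w : pok z -> walk pedge z w -> wend z w = z -> wsum pgain z w = 0.
Proof.
move=> /asboolP[x [x1 x2]] /pwalk_paths[p1 [p2 [s1 s2 -> ->]]].
rewrite [in RHS](surjective_pairing z) => -[l1 l2].
by rewrite (twinB x1 x2 s1 s2 l1 l2) subrr.
Qed.

(** The removal of a cycle from a pair of runs does not change the difference of
    their weights. *)
Lemma fwd_finite : exists Fs : seq R, forall x s, fwd B x s != 0 ->
  mpval (fwd B x s) - mpval (\sum_t fwd B x t) \in Fs.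
Proof.
have le0 z w : pok z -> walk pedge z w -> wend z w = z -> wsum pgain z w <= 0.
  by move=> *; rewrite (@pok_cycle z).
(* All cycles at reachable pairs have weight zero, so the negated gains satisfy the same hypothesis.
   Their upper bound [M] is the lower bound on gains that [wsum_finite] needs. *)
pose ngain (z : 'I_n * 'I_n) a (z' : 'I_n * 'I_n) : R := - pgain z a z'.
have ngE z w : wsum ngain z w = - wsum pgain z w.
  by elim: w z => [|[a z'] w IH] z /=; rewrite ?oppr0 // IH opprD.
have nle0 z w : pok z -> walk pedge z w -> wend z w = z -> wsum ngain z w <= 0.
  by move=> *; rewrite ngE (@pok_cycle z) // oppr0.
have [M MP] := wsum_bounded nle0.
have [F0 F0P] := wsum_finite le0 M.
exists [seq e + d | e <- [seq mpval (init_wt B 0 qr.2) - mpval (init_wt B 0 qr.1) |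
  qr : 'I_n * 'I_n], d <- F0] => x s s0.
have t0 : \sum_t fwd B x t != 0 by apply: mp_sum_neq0 s0.
have [t _ tE] := mp_sum_attain t0; rewrite tE in t0 *.
have [r [p2 [rI rp2 _ ->]]] := fwd_attain s0.
have [q [p1 [qI qp1 _ ->]]] := fwd_attain t0.
have [||w [ww wE]] := paths_pwalk (x := [::]) _ _ qp1 rp2; rewrite ?fwd_nil //.
apply/allpairsP; exists (mpval (init_wt B 0 r) - mpval (init_wt B 0 q), wsum pgain (q, r) w).
split=> /=.
- by apply/mapP; exists (q, r); rewrite ?mem_enum.
- by apply: F0P => //; have := MP _ _ ww; rewrite ngE lerNl.
rewrite wE; move: rI qI qp1 rp2; rewrite /initial -!pwt_neq0.
case: (init_wt B 0 r) => // b _; case: (init_wt B 0 q) => // c _.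
by case: pwt => // d _; case: pwt => // e _ /=; lra.
Qed.

Section Automaton.
Variables (Fs : seq R).
Hypothesis FsP : forall x s, fwd B x s != 0 ->
  mpval (fwd B x s) - mpval (\sum_t fwd B x t) \in Fs.

(** The value [1] for a vector of -oo keeps the scale invertible. *)
Let scale (V : 'I_n -> maxplus R) : maxplus R :=
  if \sum_t V t == 0 then 1 else \sum_t V t.
Let normed V s := V s * mpinv (scale V).

Lemma scale_neq0 V : scale V != 0.
Proof. by rewrite /scale; case: ifP => // /negbT. Qed.

Lemma scale_normed V s : scale V * normed V s = V s.
Proof. by rewrite mulrCA mp_mulV ?mulr1 // scale_neq0. Qed.

(** A common factor disappears on normalization, so [normed V] has the relative weights of
    [fwd B x], which [FsP] places in [Fs]; no coordinate is lost. *)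
Lemma scale_fenc x c V : c != 0 -> (forall s, fwd B x s = c * V s) ->
  fdec (fenc Fs (normed V)) =1 normed V.
Proof.
move=> c0 xV; apply: fencK => s; rewrite mp_mul_neq0 => /andP[Vs0 _].
have V0 : \sum_t V t != 0 by apply: mp_sum_neq0 Vs0.
have := @FsP x s; rewrite xV mp_mul_neq0 c0 Vs0 => /(_ isT).
under eq_bigr do rewrite xV.
rewrite -big_distrr /= /normed /scale (negPf V0).
case: c c0 {xV} => // c _; case: (V s) Vs0 => // b _; case: (\sum_t V t) V0 => // d _.
by rewrite /= opprD addrACA subrr add0r.
Qed.

Let vstep a (d : fvec 'I_n Fs) s := \sum_t fdec d t * letmx B a t s.
Let dinit d := if d == fenc Fs (normed (init_wt B 0)) then scale (init_wt B 0) else 0.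
Let dstep a d d' :=
  if d' == fenc Fs (normed (vstep a d)) then scale (vstep a d) else 0.
Let dfinal (d : fvec 'I_n Fs) := \sum_s fdec d s * final_wt B s 0.

(** The invariant is that [d] represents the weights after some prefix [x] up to a finite factor
    [c]; the factor dropped at each step is the weight of the transition. *)
Lemma det_fbw u x c d : c != 0 -> (forall s, fwd B x s = c * fdec d s) ->
  fbw dstep dfinal u d = \sum_s fdec d s * bwd B u s.
Proof.
elim: u x c d => [|a u IH] x c d c0 xd /=.
  by apply: eq_bigr => s _; rewrite bwd_nil.
have xa s : fwd B (rcons x a) s = c * vstep a d s.
  rewrite fwd_rcons big_distrr /=; apply: eq_bigr => t _.
  by rewrite xd mulrA.
have dK := scale_fenc c0 xa.
rewrite (bigD1 (fenc Fs (normed (vstep a d)))) //= big1 ?addr0; last first.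
  by move=> d' d'N; rewrite /dstep (negPf d'N) mul0r.
rewrite /dstep eqxx (IH (rcons x a) (c * scale (vstep a d))).
- rewrite big_distrr /=; under [RHS]eq_bigr do rewrite bwd_cons big_distrr /=.
  rewrite exchange_big /=; apply: eq_bigr => s _; rewrite mulrA dK scale_normed.
  by rewrite big_distrl /=; apply: eq_bigr => t _; rewrite mulrA.
- by rewrite mp_mul_neq0 c0 scale_neq0.
- by move=> s; rewrite dK -mulrA scale_normed.
Qed.

Lemma det_sequential : sequential_series (series B).
Proof.
exists #|fvec 'I_n Fs|, (mk_aut dinit dstep dfinal); split.
  apply: (@mk_aut_sequential _ _ _ _ _ _ (fenc Fs (normed (init_wt B 0)))).
    by move=> d; rewrite /dinit; case: ifP => _; rewrite ?scale_neq0 ?eqxx.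
  move=> a d t t'; rewrite /dstep.
  by case: (t =P _) => [->|]; case: (t' =P _) => [->|]; rewrite ?eqxx.
move=> u; rewrite series_mk_aut (bigD1 (fenc Fs (normed (init_wt B 0)))) //= big1 ?addr0.
  have init1 s : fwd B [::] s = 1 * init_wt B 0 s by rewrite mul1r fwd_nil.
  have dK := scale_fenc (oner_neq0 _) init1.
  rewrite /dinit eqxx (@det_fbw u [::] (scale (init_wt B 0))) ?scale_neq0 //.
    have := series_cat B [::] u; rewrite cat0s => ->.
    by rewrite big_distrr /=; apply: eq_bigr => s _; rewrite dK mulrA scale_normed fwd_nil.
  by move=> s; rewrite dK scale_normed fwd_nil.
by move=> d dN; rewrite /dinit (negPf dN) mul0r.
Qed.

End Automaton.

Theorem determinization : sequential_series (series B).
Proof. by have [Fs FsP] := fwd_finite; apply: det_sequential FsP. Qed.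

End Determinization.

(** * Disambiguation along good runs *)

Section Disambiguation.
Variables (R : realType) (Sigma : finType) (n : nat) (A : automaton R Sigma n).
Implicit Types (a : Sigma) (u v x y : seq Sigma) (P C : {set 'I_n}) (q r s t : 'I_n).

Local Notation nwalk := (walk (edge A)).
Local Notation nsum := (wsum (gain A)).

Definition ok_node (z : node n) : bool := let: (P, C, D, q, r) := z in
  [&& C == D, goodb A P C q, r \in P & r \in C].

Lemma ok_node_cycle z w : ok_node z -> nwalk z w -> wend z w = z -> nsum z w <= 0.
Proof.
case: z => -[[[P C] D] q] r /and4P[/eqP<- /asboolP[_ _ gq] rP rC].
exact: gq.
Qed.

Local Notation okw := (okwalk (edge A) ok_node).

Lemma st2_good u P q : q \in (st A u).2 P -> good A P (Cw A u (Fin A)) q.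
Proof.
case: u => [|a u]; rewrite ffunE inE => /andP[_].
  by move=> /asboolP.
by rewrite st1 => /andP[/asboolP].
Qed.

Lemma bwd_attain u r : bwd A u r != 0 -> exists p, [/\ steps A r u p, last r p \in Fin A &
  bwd A u r = pwt A r u p * final_wt A (last r p) 0].
Proof.
rewrite /bwd mxE => s0; have [t _ tE] := mp_sum_attain s0.
move: s0; rewrite tE mp_mul_neq0 => /andP[/pwt_attain[p [rp pt <-]] tF].
by exists p; rewrite inE /final pt.
Qed.

Lemma bwd_ge u q p : mp_le (pwt A q u p * final_wt A (last q p) 0) (bwd A u q).
Proof.
rewrite /bwd mxE.
apply: mp_le_trans (mp_le_sumT (fun t => wordmx A u q t * final_wt A t 0) (last q p)).
exact: mp_leM (pwt_le _ _ _ _) (mp_le_refl _).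
Qed.

(** Membership in [(st A u).2 P] provides a good run step by step. Paired with the given run, it is
    a walk through [ok_node]s, to which the bounds on walks apply. *)
Lemma good_pair_walk u P q r p2 : q \in (st A u).2 P -> r \in P ->
  steps A r u p2 -> last r p2 \in Fin A -> exists p1 w,
  [/\ steps A q u p1, last q p1 \in Fin A,
    okw (P, Cw A u (Fin A), Cw A u (Fin A), q, r) w &
    nsum (P, Cw A u (Fin A), Cw A u (Fin A), q, r) w =
      mpval (pwt A r u p2) - mpval (pwt A q u p1)].
Proof.
rewrite /okwalk; elim: u P q r p2 => [|a u IH] P q r [|r1 p2] //= qst rP.
  move=> _ rF; have [qP qF _] := st2_good (u := [::]) qst.
  exists [::], [::]; rewrite /= subrr qF eqxx rP rF !andbT; split=> //.
  by apply/asboolP; apply: (st2_good (u := [::])).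
move=> /andP[rr1 s2] lF; have gq := st2_good (u := a :: u) qst.
have r1C : r1 \in Cw A u (Fin A).
  by apply: Cw_step lF _; apply: wordmx_path s2 _.
have rC : r \in Cpre A a (Cw A u (Fin A)) by rewrite inE; apply/exists_inP; exists r1.
move: qst; rewrite ffunE inE => /and3P[qP _ /exists_inP[q1 q1st qq1]].
have r1P : r1 \in Psucc A a P by rewrite inE; apply/exists_inP; exists r.
have [p1 [w [s1 l1 w1 wE]]] := IH _ _ _ _ q1st r1P s2 lF.
exists (q1 :: p1), ((a, (Psucc A a P, Cw A u (Fin A), Cw A u (Fin A), q1, r1)) :: w).
split=> //=; first by rewrite qq1.
  case/andP: w1 => w1 w2; apply/andP; split; first by rewrite !eqxx qq1 rr1.
  by apply/andP; split=> //; rewrite eqxx rP rC !andbT; apply/asboolP.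
rewrite wE; move: qq1 rr1 s1 s2; rewrite /gain /transition -!pwt_neq0 /=.
case: (letmx A a q q1) => // b _; case: (letmx A a r r1) => // c _.
by case: pwt => // d _; case: pwt => // e _ /=; lra.
Qed.

(** [M] bounds what another run gains on a good run while the word is read, and [K] what it gains
    through the final weights. *)
Lemma good_gap : exists2 T : R, 0 <= T & forall u P q r, q \in (st A u).2 P ->
  r \in P -> mp_le (bwd A u r) ((Some T : maxplus R) * bwd A u q).
Proof.
have [M MP] := wsum_bounded ok_node_cycle.
have [K [K0 KP]] := seq_ub [seq mpval (final_wt A qr.2 0) - mpval (final_wt A qr.1 0) |
  qr : 'I_n * 'I_n].
exists (Num.max 0 (M + K)); first by rewrite le_max lexx.
move=> u P q r qst rP; have [/eqP->|r0] := boolP (bwd A u r == 0); first by rewrite mp_le0.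
have [p2 [s2 rF ->]] := bwd_attain r0.
have [p1 [w [s1 qF ww wE]]] := good_pair_walk qst rP s2 rF.
apply: mp_le_trans (mp_leM (mp_le_refl _) (bwd_ge u q p1)).
have := MP _ _ ww; rewrite wE.
have : mpval (final_wt A (last r p2) 0) - mpval (final_wt A (last q p1) 0) <= K.
  by apply: KP; apply/mapP; exists (last q p1, last r p2); rewrite ?mem_enum.
move: s1 s2 rF qF; rewrite !inE /final -!pwt_neq0.
case: (final_wt A (last r p2) 0) => // b; case: (final_wt A (last q p1) 0) => // c.
case: pwt => // d _; case: pwt => // e _ _ _ /= cb de.
by have : M + K <= Num.max 0 (M + K) by [rewrite le_max lexx orbT]; lra.
Qed.

(** The possible values of the difference between the weight of a run to [r] and
    that of a good run to [q]. *)
Definition offset P C q r (d : R) := exists q0 r0 C0 w,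
  [/\ initial A q0, initial A r0, okw (Init A, C0, C0, q0, r0) w,
    wend (Init A, C0, C0, q0, r0) w = (P, C, C, q, r) &
    d = mpval (init_wt A 0 r0) - mpval (init_wt A 0 q0) + nsum (Init A, C0, C0, q0, r0) w].

Lemma offset_finite T : exists Fs : seq R,
  forall P C q r d, offset P C q r d -> - T <= d -> d \in Fs.
Proof.
pose I := [seq mpval (init_wt A 0 qr.2) - mpval (init_wt A 0 qr.1) | qr : 'I_n * 'I_n].
have [K [_ KP]] := seq_ub I; have [F0 F0P] := wsum_finite ok_node_cycle (T + K).
exists [seq e + d | e <- I, d <- F0].
move=> P C q r d [q0 [r0 [C0 [w [q0I r0I ww we ->]]]]] Td.
have dI : mpval (init_wt A 0 r0) - mpval (init_wt A 0 q0) \in I.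
  by apply/mapP; exists (q0, r0); rewrite ?mem_enum.
apply/allpairsP; exists (mpval (init_wt A 0 r0) - mpval (init_wt A 0 q0),
  nsum (Init A, C0, C0, q0, r0) w); split=> //=.
by apply: F0P => //; have := KP _ dI; lra.
Qed.

Section Automaton.
Variables (T : R) (Fs : seq R).
Hypothesis T0 : 0 <= T.
Hypothesis gapT : forall u P q r, q \in (st A u).2 P ->
  r \in P -> mp_le (bwd A u r) ((Some T : maxplus R) * bwd A u q).
Hypothesis FsP : forall P C q r d, offset P C q r d -> - T <= d -> d \in Fs.

(** By [gapT], a run that lags by more than [T] behind the good one never matters
    again. *)
Let cut C (V : 'I_n -> maxplus R) r :=
  if (r \in C) && mp_le (Some (- T)) (V r) then V r else 0.

(** The good run itself is never cut, because its relative weight is at least [1] and [T] is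
    nonnegative; it dominates whatever is cut. *)
Lemma cut_sum u P q V : q \in (st A u).2 P -> mp_le 1 (V q) ->
  (forall r, V r != 0 -> r \in P) ->
  \sum_r cut (Cw A u (Fin A)) V r * bwd A u r = \sum_r V r * bwd A u r.
Proof.
move=> qst q1 VP; have [qP qC _] := st2_good qst.
apply: mp_le_anti; apply: mp_ge_sum => r _.
  apply: mp_le_trans (mp_le_sumT (fun r => V r * bwd A u r) r).
  by rewrite /cut; case: ifP => _; rewrite ?mp_le_refl // mul0r mp_le0.
have [/eqP->|] := boolP (V r * bwd A u r == 0); first exact: mp_le0.
rewrite mp_mul_neq0 -mem_Cw_Fin => /andP[r0 rC].
have [Tr|Tr] := boolP (mp_le (Some (- T)) (V r)).
  apply: mp_le_trans (mp_le_sumT (fun r => cut (Cw A u (Fin A)) V r * bwd A u r) r).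
  by rewrite /cut rC Tr mp_le_refl.
apply: mp_le_trans (mp_le_sumT (fun r => cut (Cw A u (Fin A)) V r * bwd A u r) q).
have Tq : mp_le (Some (- T)) (V q).
  by apply: mp_le_trans q1; rewrite /= oppr_le0.
rewrite /cut qC Tq /=; have := gapT qst (VP r r0).
rewrite mem_Cw_Fin in qC; rewrite mem_Cw_Fin in rC.
move: q1 r0 Tr qC rC; case: (V q) => // b; case: (V r) => // c.
case: (bwd A u q) => // d; case: (bwd A u r) => // e /= b0 _.
by rewrite -ltNge => cT _ _; lra.
Qed.

(** A state [(P, X, q, d)] guesses the value [X] of [st] at the remaining input,
    follows a good run through [q], and keeps in [d] the weights of the other runs
    relative to that run. *)
Definition dstate : finType :=
  ({set 'I_n} * stype n * 'I_n * fvec 'I_n Fs)%type.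

Let V0 q r := init_wt A 0 r * mpinv (init_wt A 0 q).
Let V1 a q q' (d : fvec 'I_n Fs) r :=
  (\sum_t fdec d t * letmx A a t r) * mpinv (letmx A a q q').

(** Restricting guesses to the types of actual words supplies the continuations to which [twins] is
    applied. *)
Let realizable (X : stype n) : bool := `[< exists u, X = st A u >].

(** [pick] makes the good state a function of the guess, so that different good runs cause no
    ambiguity. *)
Let binit (s : dstate) := let: (P, X, q, d) := s in
  if [&& P == Init A, realizable X, [pick t in Init A | t \in X.2 (Init A)] == Some q
    & d == fenc Fs (cut X.1 (V0 q))] then init_wt A 0 q else 0.

Let bstep a (s s' : dstate) :=
  let: (P, X, q, d) := s in let: (P', X', q', d') := s' in
  if [&& P' == Psucc A a P, realizable X', X == stnext A a X',
    [pick t | transition A q a t && (t \in X'.2 P')] == Some q'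
    & d' == fenc Fs (cut X'.1 (V1 a q q' d))] then letmx A a q q' else 0.

Let bfinal (s : dstate) := let: (P, X, q, d) := s in
  if X == st0 A then \sum_r fdec d r * final_wt A r 0 else 0.

Let bw := fbw bstep bfinal.

(** [bstep] links the types from right to left and [bfinal] demands [st0 A] at the end, so a wrong
    guess accepts nothing. *)
Lemma bw_st u P X q d : bw u (P, X, q, d) != 0 -> X = st A u.
Proof.
rewrite /bw; elim: u P X q d => [|a u IH] P X q d /=; first by case: (X =P _); rewrite ?eqxx.
move=> s0; have [[[[P' X'] q'] d'] _ E] := mp_sum_attain s0.
move: s0; rewrite E mp_mul_neq0 => /andP[+ /IH XE].
by rewrite /bstep; case: ifP => [/and5P[_ _ /eqP-> _ _] _|]; rewrite ?eqxx // XE.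
Qed.

(** The entry at [q] may exceed [1], since a run other than the one being followed may reach [q]
    with a larger weight. *)
Definition dinv P C q (d : 'I_n -> maxplus R) := mp_le 1 (d q) /\
  forall r, d r != 0 -> [/\ r \in P, r \in C & offset P C q r (mpval (d r))].

(** The entries that survive the cut are offsets not below [- T], hence in [Fs], and the encoding
    loses none of them. *)
Lemma fenc_cut P C q V : mp_le 1 (V q) -> q \in C ->
  (forall r, V r != 0 -> r \in P) ->
  (forall r, V r != 0 -> r \in C -> offset P C q r (mpval (V r))) ->
  fdec (fenc Fs (cut C V)) =1 cut C V /\ dinv P C q (fdec (fenc Fs (cut C V))).
Proof.
move=> q1 qC VP VF.
have K : fdec (fenc Fs (cut C V)) =1 cut C V.
  apply: fencK => r; rewrite /cut; case: ifP => [/andP[rC]|]; rewrite ?eqxx //.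
  move=> Tr r0; apply: (FsP (VF r r0 rC)).
  by move: Tr r0; case: (V r).
split=> //; split.
  have Tq : mp_le (Some (- T)) (V q) by apply: mp_le_trans q1; rewrite /= oppr_le0.
  by rewrite K /cut qC Tq.
move=> r; rewrite K /cut; case: ifP => [/andP[rC]|]; rewrite ?eqxx //.
by move=> _ r0; split; [exact: VP | | exact: VF].
Qed.

(** One successor contributes: the one with the true type, the picked state and the cut vector. By
    [cut_sum], cutting does not change the value of the remaining word. *)
Lemma bw_eq u P q d : q \in (st A u).2 P -> dinv P (Cw A u (Fin A)) q (fdec d) ->
  bw u (P, st A u, q, d) = \sum_r fdec d r * bwd A u r.
Proof.
elim: u P q d => [|a u IH] P q d qst dI.
  by rewrite /bw /= eqxx; apply: eq_bigr => r _; rewrite bwd_nil.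
have := st2_good qst; move: (qst); rewrite ffunE inE => /and3P[qP _ /exists_inP[t tst qt]] gq.
case pE: [pick t | transition A q a t && (t \in (st A u).2 (Psucc A a P))] => [q'|]; last first.
  by move: pE; case: pickP => // /(_ t); rewrite qt tst.
have /andP[qq' q'st] : transition A q a q' && (q' \in (st A u).2 (Psucc A a P)).
  by move: pE; case: pickP => // s sP [<-].
have [q'P q'C _] := st2_good q'st.
have [q1 dF] := dI; set C := Cw A (a :: u) (Fin A) in dI dF gq *.
set V := V1 a q q' d.
have V1E r : letmx A a q q' * V r = \sum_t fdec d t * letmx A a t r.
  by rewrite /V /V1 mulrCA mp_mulV ?mulr1.
have [K K'] : fdec (fenc Fs (cut (Cw A u (Fin A)) V)) =1 cut (Cw A u (Fin A)) V /\
    dinv (Psucc A a P) (Cw A u (Fin A)) q' (fdec (fenc Fs (cut (Cw A u (Fin A)) V))).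
  apply: fenc_cut => //.
  - rewrite -(mp_le_mul2l _ _ qq') mulr1 V1E.
    apply: mp_le_trans (mp_le_sumT (fun t => fdec d t * letmx A a t q') q).
    by rewrite -{1}[letmx _ _ _ _]mul1r mp_leM // mp_le_refl.
  - move=> r; rewrite mp_mul_neq0 => /andP[s0 _]; have [s _ sE] := mp_sum_attain s0.
    move: s0; rewrite sE mp_mul_neq0 => /andP[s0 sr]; have [sP _ _] := dF s s0.
    by rewrite inE; apply/exists_inP; exists s.
  - move=> r r0 rC; move: (r0); rewrite /V /V1 mp_mul_neq0 => /andP[s0 _].
    have [s _ sE] := mp_sum_attain s0; rewrite sE.
    move: s0; rewrite sE mp_mul_neq0 => /andP[s0 sr].
    have [sP sC [q0 [r0' [C0 [w [q0I r0I ww we dE]]]]]] := dF s s0.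
    (* The walk that witnesses the offset of [s] is extended by the transitions from [q] to [q'] and
       from [s] to [r]. *)
    exists q0, r0', C0, (rcons w (a, (Psucc A a P, Cw A u (Fin A), Cw A u (Fin A), q', r))).
    have rP : r \in Psucc A a P by rewrite inE; apply/exists_inP; exists s.
    split=> //.
    + case/andP: ww => w1 w2; rewrite /okwalk /wnodes map_rcons -rcons_cons all_rcons w2.
      have sr' : transition A s a r := sr.
      rewrite -cats1 walk_cat w1 we /= !eqxx qq' sr' rC rP !andbT /=.
      by apply/asboolP; apply: st2_good.
    + by rewrite -cats1 wend_cat.
    rewrite -cats1 wsum_cat we /= addr0 addrA -dE /gain /=.
    move: s0 sr qq'; rewrite /transition.
    case: (fdec d s) => // b _; case: (letmx A a s r) => // c _.
    by case: (letmx A a q q') => // e _ /=; lra.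
rewrite /bw /= (bigD1 (Psucc A a P, st A u, q', fenc Fs (cut (Cw A u (Fin A)) V))) //=.
rewrite big1 ?addr0; last first.
  move=> [[[P' X'] q''] d'] N; apply/eqP; apply: contraNT N.
  rewrite mp_mul_neq0 => /andP[+ /bw_st XE]; rewrite XE /bstep.
  case: ifP => [|]; rewrite ?eqxx // => /and5P[/eqP-> _ _].
  by rewrite pE => /eqP[<-] /eqP-> _; rewrite st1.
have re : realizable (st A u) by apply/asboolP; exists u.
rewrite /bstep !eqxx re pE eqxx st1 eqxx /= -/bw IH // (eq_bigr (fun r =>
  cut (Cw A u (Fin A)) V r * bwd A u r)); last by move=> r _; rewrite K.
rewrite (cut_sum q'st).
- rewrite big_distrr /=; under [RHS]eq_bigr do rewrite bwd_cons big_distrr /=.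
  rewrite exchange_big /=; apply: eq_bigr => s _; rewrite mulrA V1E.
  by rewrite big_distrl /=; apply: eq_bigr => r _; rewrite mulrA.
- case: K' => + _; rewrite K /cut; case: ifP => //.
- move=> r; rewrite mp_mul_neq0 => /andP[s0 _]; have [s _ sE] := mp_sum_attain s0.
  move: s0; rewrite sE mp_mul_neq0 => /andP[s0 sr]; have [sP _ _] := dF s s0.
  by rewrite inE; apply/exists_inP; exists s.
Qed.

Let daut := mk_aut binit bstep bfinal.

Lemma daut_series : dominant A -> series daut =1 series A.
Proof.
move=> dom u; rewrite series_mk_aut.
have uE : series A u = \sum_r init_wt A 0 r * bwd A u r.
  have := series_cat A [::] u; rewrite cat0s => ->.
  by apply: eq_bigr => r _; rewrite fwd_nil.
have re : realizable (st A u) by apply/asboolP; exists u.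
case pE: [pick t in Init A | t \in (st A u).2 (Init A)] => [q|]; last first.
  (* Without a good initial state, [dom] tells that [u] is not accepted, and both sides are -oo. *)
  rewrite big1 => [|[[[P X] q] d] _].
    apply/esym/eqP; apply: contraT; rewrite -[u]cat0s series_neq0 => H.
    have /dom : [exists q in Init A, q \in (st A u).1] by rewrite st1.
    move=> /exists_inP[q qI qst]; move: pE; case: pickP => // /(_ q).
    by rewrite qI qst.
  apply/eqP; apply: contraT; rewrite mp_mul_neq0 => /andP[+ /bw_st XE].
  by rewrite XE /binit; case: ifP => [|]; rewrite ?eqxx // => /and4P[_ _]; rewrite pE.
have /andP[qI qst] : (q \in Init A) && (q \in (st A u).2 (Init A)).
  by move: pE; case: pickP => // s sP [<-].
have [_ qC _] := st2_good qst; rewrite inE in qI.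
set C := Cw A u (Fin A) in qC.
have V0E r : init_wt A 0 q * V0 q r = init_wt A 0 r.
  by rewrite /V0 mulrCA mp_mulV ?mulr1.
have q1 : mp_le 1 (V0 q q) by rewrite -(mp_le_mul2l _ _ qI) mulr1 V0E mp_le_refl.
have VI r : V0 q r != 0 -> r \in Init A by rewrite mp_mul_neq0 inE => /andP[].
have [K K'] : fdec (fenc Fs (cut C (V0 q))) =1 cut C (V0 q) /\
    dinv (Init A) C q (fdec (fenc Fs (cut C (V0 q)))).
  apply: fenc_cut => // r r0 rC; have rI := VI r r0.
  exists q, r, C, [::]; split=> //; first by rewrite inE in rI.
    by rewrite /okwalk /= eqxx rI rC !andbT; apply/asboolP; apply: st2_good.
  rewrite inE /initial in rI; rewrite /= addr0 /V0; move: qI rI; rewrite /initial.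
  by case: (init_wt A 0 q) => // b _; case: (init_wt A 0 r).
rewrite (bigD1 (Init A, st A u, q, fenc Fs (cut C (V0 q)))) //= big1 ?addr0.
  rewrite !eqxx re pE eqxx st1 eqxx /= -/bw bw_eq //.
  rewrite (eq_bigr (fun r => cut C (V0 q) r * bwd A u r)); last by move=> r _; rewrite K.
  rewrite (cut_sum qst q1 VI) big_distrr /= uE; apply: eq_bigr => r _.
  by rewrite mulrA V0E.
move=> [[[P' X'] q''] d'] N; apply/eqP; apply: contraNT N.
rewrite mp_mul_neq0 => /andP[+ /bw_st XE]; rewrite XE /binit.
case: ifP => [|]; rewrite ?eqxx // => /and4P[/eqP-> _].
by rewrite pE => /eqP[<-] /eqP-> _; rewrite st1.
Qed.

Lemma daut_unambiguous : unambiguous daut.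
Proof.
apply: mk_aut_unambiguous => [u|a u] [[[P X] q] d] [[[P1 X1] q1] d1].
  move=> + + /bw_st XE /bw_st X1E; rewrite /binit -XE in X1E *; rewrite X1E.
  case: ifP => [|]; rewrite ?eqxx // => /and4P[/eqP-> _ /eqP p1 /eqP-> _].
  case: ifP => [|]; rewrite ?eqxx // => /and4P[/eqP-> _ /eqP p2 /eqP-> _].
  by move: p2; rewrite p1 => -[->].
move=> [[[P2 X2] q2] d2] + + /bw_st XE /bw_st X1E; rewrite /bstep -XE in X1E *; rewrite X1E.
case: ifP => [|]; rewrite ?eqxx // => /and5P[/eqP-> _ _ /eqP p1 /eqP-> _].
case: ifP => [|]; rewrite ?eqxx // => /and5P[/eqP-> _ _ /eqP p2 /eqP-> _].
by move: p2; rewrite p1 => -[->].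
Qed.

Lemma daut_fwd x i : fwd daut x i != 0 -> let: (P, X, q, d) := enum_val i in
  [/\ P = Pw A (Init A) x, exists u, X = st A u & q \in X.2 P].
Proof.
elim/last_ind: x i => [|x a IH] i.
  rewrite fwd_nil mxE; case: (enum_val i) => -[[P X] q] d; rewrite /binit.
  case: ifP => [|]; rewrite ?eqxx // => /and4P[/eqP-> /asboolP[u XE] pE _] _.
  by split=> //; [exists u | move: pE; case: pickP => // t /andP[_ tP] /eqP[<-]].
rewrite fwd_rcons => s0; have [j _ jE] := mp_sum_attain s0.
move: s0; rewrite jE mp_mul_neq0 => /andP[/IH]; rewrite mxE.
case: (enum_val j) => -[[P X] q] d [-> _ _].
case: (enum_val i) => -[[P' X'] q'] d'; rewrite /bstep.
case: ifP => [|]; rewrite ?eqxx // => /and5P[/eqP-> /asboolP[u XE] _ pE _] _.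
split; first by rewrite -cats1 Pw_cat.
  by exists u.
by move: pE; case: pickP => // t /andP[_ tP] /eqP[<-].
Qed.

(** A path projects to a path of [A] of the same weight, because [bstep] copies the weights of the
    followed run. *)
Lemma daut_steps v i p : steps daut i v p ->
  let: (P, X, q, d) := enum_val i in let: (P', X', q', d') := enum_val (last i p) in
  [/\ Pw A P v = P', Cw A v X'.1 = X.1 & exists2 p', steps A q v p' /\ last q p' = q' &
    pwt daut i v p = pwt A q v p'].
Proof.
elim: v i p => [|a v IH] i [|j p] //=.
  by move=> _; case: (enum_val i) => -[[P X] q] d; split=> //; exists [::].
move=> /andP[+ /IH]; rewrite /transition !mxE.
case: (enum_val i) => -[[P X] q] d; case: (enum_val j) => -[[P1 X1] q1] d1.
case: (enum_val (last j p)) => -[[P' X'] q'] d'; rewrite /bstep.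
case: ifP => [|]; rewrite ?eqxx // => /and5P[/eqP PE _ /eqP XE _ _] qq1.
move=> [P'E X'E [p' [s1 l1] pE]]; split; first by rewrite -P'E PE.
  by rewrite X'E XE.
by exists (q1 :: p'); rewrite /= ?s1 ?andbT // pE.
Qed.

Lemma daut_twins : twins A -> forall x i j, fwd daut x i != 0 -> fwd daut x j != 0 ->
  forall v p1 p2, steps daut i v p1 -> steps daut j v p2 -> last i p1 = i -> last j p2 = j ->
  pwt daut i v p1 = pwt daut j v p2.
Proof.
move=> tw x i j /daut_fwd + /daut_fwd + v p1 p2 /daut_steps + /daut_steps + l1 l2.
rewrite l1 l2; case: (enum_val i) => -[[P X] q] d [-> [y ->] qst].
case: (enum_val j) => -[[P1 X1] q1] d1 [-> [y' ->] q1st].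
rewrite !st1 => -[vP vC [p [s1 e1] ->]] [_ vD [p' [s2 e2] ->]].
have [w] := paths_nwalk (Pw A (Init A) x) (Cw A y (Fin A)) (Cw A y' (Fin A)) s1 s2.
rewrite vP vC vD e1 e2 => -[ww _ we wsE].
have := tw x y y' q q1 (st2_good qst) (st2_good q1st) w ww we; rewrite wsE.
move: s1 s2; rewrite -!pwt_neq0; case: pwt => // b _; case: pwt => // c _ /= cb.
by congr Some; lra.
Qed.

End Automaton.

Theorem dominant_unambiguous : dominant A -> unambiguous_series (series A).
Proof.
move=> dom; have [T T0 gapT] := good_gap; have [Fs FsP] := offset_finite T.
by do 2![eexists]; split; [exact: daut_unambiguous | exact: (daut_series T0 gapT FsP)].
Qed.

Theorem dominant_twins_sequential : dominant A -> twins A -> sequential_series (series A).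
Proof.
move=> dom tw; have [T T0 gapT] := good_gap; have [Fs FsP] := offset_finite T.
have [m [D [sD DE]]] := determinization (@daut_twins T Fs tw).
by exists m, D; split=> // u; rewrite DE; apply: (daut_series T0 gapT FsP).
Qed.

End Disambiguation.

(** * The two characterizations *)

Section Characterization.
Variables (R : realType) (Sigma : finType) (n : nat) (A : automaton R Sigma n).
Hypothesis finA : finitely_ambiguous A.

Theorem unambiguous_seriesP : unambiguous_series (series A) <-> dominant A.
Proof.
split=> [[m [B [uB AB]]]|]; last exact: dominant_unambiguous.
exact: (unambiguous_dominant finA uB AB).
Qed.

Theorem sequential_seriesP : sequential_series (series A) <-> dominant A /\ twins A.
Proof.
split=> [[m [B [sB AB]]]|[]]; last exact: dominant_twins_sequential.
split; last exact: (sequential_twins sB AB finA).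
exact: (unambiguous_dominant finA (sequential_unambiguous sB) AB).
Qed.

End Characterization.

(** * The decision procedures *)

(** The sequences over [X] that are at most as long as [fuel]. *)
Definition seqs (T U : Type) (fuel : seq T) (X : seq U) : seq (seq U) :=
  foldr (fun _ acc => [::] :: [seq x :: w | x <- X, w <- acc]) [:: [::]] fuel.

Lemma mem_seqs (T : Type) (U : eqType) (fuel : seq T) (X : seq U) w :
  (size w <= size fuel)%N -> {subset w <= X} -> w \in seqs fuel X.
Proof.
elim: fuel w => [|f fuel IH] [|x w] //= sw wX.
rewrite in_cons /=; apply/allpairsP; exists (x, w); split=> //=.
  by apply: wX; rewrite mem_head.
by apply: IH => // y yw; apply: wX; rewrite in_cons yw orbT.
Qed.

Lemma card_le_size (T : finType) (s : seq T) : (forall x, x \in s) -> (#|T| <= size s)%N.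
Proof. by move=> sP; rewrite cardT; apply: uniq_leq_size (enum_uniq T) _ => x _. Qed.

Section Decision.
Variables (R : realType) (Sigma : finType) (n : nat) (A : automaton R Sigma n).
Implicit Types (a : Sigma) (u v x y : seq Sigma) (P C D : {set 'I_n}) (q r : 'I_n).
Implicit Types (z : node n) (w : seq (Sigma * node n)).

(** An explicit recursion that a program can follow, in place of the abstract enumeration of the
    type of sets. *)
Definition subsets : seq {set 'I_n} :=
  foldr (fun i acc => acc ++ [seq i |: P | P <- acc]) [:: set0] (enum 'I_n).

Lemma mem_subsets P : P \in subsets.
Proof.
have : {subset P <= enum 'I_n} by move=> i; rewrite mem_enum.
rewrite /subsets; elim: (enum 'I_n) P => [|i s IH] P Ps /=.
  rewrite inE; apply/eqP/setP => j; rewrite inE.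
  by apply/negbTE/negP => /Ps.
rewrite mem_cat; have [iP|iP] := boolP (i \in P); last first.
  rewrite IH // => j jP; have := Ps j jP; rewrite in_cons => /orP[/eqP ji|//].
  by rewrite -ji jP in iP.
apply/orP; right; apply/mapP; exists (P :\ i); last by rewrite setD1K.
apply: IH => j; rewrite !inE => /andP[ji /Ps]; rewrite in_cons => /orP[|//].
by rewrite (negPf ji).
Qed.

Definition nodes : seq (node n) :=
  [seq (e, r) | e <- [seq (e, q) | e <- [seq (e, D) | e <- [seq (P, C) | P <- subsets,
    C <- subsets], D <- subsets], q <- enum 'I_n], r <- enum 'I_n].

Lemma mem_nodes z : z \in nodes.
Proof.
case: z => [[[[P C] D] q] r].
apply/allpairsP; exists (P, C, D, q, r); split; rewrite ?mem_enum //=.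
apply/allpairsP; exists (P, C, D, q); split; rewrite ?mem_enum //=.
apply/allpairsP; exists (P, C, D); split; rewrite ?mem_subsets //=.
by apply/allpairsP; exists (P, C); split; rewrite ?mem_subsets.
Qed.

(** [nodes] also serves as fuel: its length is at least the number of nodes, which bounds the
    relevant walks without any arithmetic. *)
Definition walks : seq (seq (Sigma * node n)) :=
  seqs nodes [seq (a, z) | a <- enum Sigma, z <- nodes].

Lemma mem_walks w : (size w <= #|{: node n}|)%N -> w \in walks.
Proof.
move=> sw; apply: mem_seqs; first exact: leq_trans sw (card_le_size mem_nodes).
move=> [a z] _; apply/allpairsP; exists (a, z).
by rewrite mem_enum mem_nodes.
Qed.

(** The current node, a flag telling whether all steps so far were edges, and the separate weights
    of the two runs. *)
Definition wstate : Type := (node n * bool * (maxplus R * maxplus R))%type.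

Definition wstep (s : wstate) (l : Sigma * node n) : wstate :=
  (l.2, s.1.2 && edge A s.1.1 l.1 l.2,
   (s.2.1 * letmx A l.1 s.1.1.1.2 l.2.1.2, s.2.2 * letmx A l.1 s.1.1.2 l.2.2)).

Definition wrun z w : wstate := foldl wstep (z, true, (1, 1)) w.

Lemma wrunP z w : let s := wrun z w in [/\ s.1.1 = wend z w, s.1.2 = walk (edge A) z w &
  s.1.2 -> exists b c, s.2 = (Some b, Some c) /\ wsum (gain A) z w = c - b].
Proof.
have dead w' : forall s : wstate, s.1.2 = false -> (foldl wstep s w').1.2 = false /\
    (foldl wstep s w').1.1 = wend s.1.1 w'.
  elim: w' => [|l w' IH] s s0 //=.
  by have [|-> ->] := IH (wstep s l); rewrite ?s0 /= ?s0.
suff H b0 c0 : let s := foldl wstep (z, true, (Some b0, Some c0)) w in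
    [/\ s.1.1 = wend z w, s.1.2 = walk (edge A) z w &
      s.1.2 -> exists b c, s.2 = (Some b, Some c) /\
        wsum (gain A) z w = (c - c0) - (b - b0)].
  have [H1 H2 H3] := H 0 0; split=> // /H3[b [c [-> ->]]].
  by exists b, c; rewrite !subr0.
elim: w z b0 c0 => [|[a z'] w IH] z b0 c0 /=.
  by split=> // _; exists b0, c0; rewrite !subrr.
rewrite {2 4 6 8}/wstep /=; have [zz'|zz'] /= := boolP (edge A z a z'); last first.
  by have [|-> ->] := dead w (z', false, ((Some b0 : maxplus R) * letmx A a z.1.2 z'.1.2,
    (Some c0 : maxplus R) * letmx A a z.2 z'.2)).
have [] : letmx A a z.1.2 z'.1.2 != 0 /\ letmx A a z.2 z'.2 != 0.
  by move: zz'; case: (z) (z') => [[[[? ?] ?] ?] ?] [[[[? ?] ?] ?] ?] /and5P[].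
rewrite /gain; case: (letmx A a z.1.2 z'.1.2) => // b _; case: (letmx A a z.2 z'.2) => // c _.
have [h1 h2 h3] := IH z' (b0 + b) (c0 + c); split; [exact: h1 | exact: h2 |].
move=> /h3[b1 [c1 [e1 e2]]]; exists b1, c1; split; first exact: e1.
by rewrite e2 /=; lra.
Qed.

Definition reachb z z' := 
  has (fun w => (wrun z w).1.2 && ((wrun z w).1.1 == z')) walks.

Definition cycb (test : maxplus R -> maxplus R -> bool) z :=
  has (fun w => [&& (wrun z w).1.2, (wrun z w).1.1 == z &
    test (wrun z w).2.1 (wrun z w).2.2]) walks.

Definition badb test z :=
  has (fun z' => [&& reachb z z', reachb z' z & cycb test z']) nodes.

(** The weights along the two components of a walk are compared without computing
    their difference, as programs cannot subtract. *)
Definition gtb (b c : maxplus R) := ~~ mp_le c b.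
Definition neqb (b c : maxplus R) := ~~ (mp_le c b && mp_le b c).

Lemma reachbP z z' : reflect (exists2 w, walk (edge A) z w & wend z w = z') (reachb z z').
Proof.
apply: (iffP hasP) => [[w _]|[w ww we]].
  have [-> -> _] := wrunP z w; move=> /andP[ww /eqP we]; by exists w.
have [w' [w1 w2 w3]] := walk_shorten ww.
exists w'; first exact: mem_walks.
by have [-> -> _] := wrunP z w'; rewrite w1 w2 we eqxx.
Qed.

(** [prD] extracts a short cycle from a closed walk through [cycle_witness]. Conversely, [prM]
    allows enough turns of the cycle to outweigh the way to it and back. *)
Lemma badb_walk test (pr : pred R) z :
  (forall b c, test (Some b) (Some c) = pr (c - b)) ->
  (forall c d, pr (c + d) -> pr c || pr d) ->
  (forall c d, pr c -> exists k, pr (d + c *+ k)) ->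
  reflect (exists w, [/\ walk (edge A) z w, wend z w = z & pr (wsum (gain A) z w)])
    (badb test z).
Proof.
move=> testE prD prM; apply: (iffP hasP).
  move=> [z' _ /and3P[/reachbP[w1 w1w w1e] /reachbP[w2 w2w w2e] /hasP[c _]]].
  have [-> -> H] := wrunP z' c; move=> /and3P[cw /eqP ce].
  have [b [d [-> dE]]] := H cw; rewrite testE -dE => pc.
  have [k kP] := prM _ (wsum (gain A) z w1 + wsum (gain A) z' w2) pc.
  have [kw ke kE] := wrepP (gain A) k cw ce.
  exists (w1 ++ wrep c k ++ w2); rewrite !walk_cat !wend_cat !wsum_cat w1e ke w1w kw w2w kE.
  by split=> //; rewrite addrCA addrC.
move=> [w [ww we wp]].
have [z' [w1 [w2 [c [[w1w w1e] [w2w w2e] [cw ce] cs cp]]]]] := cycle_witness prD ww we wp.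
exists z'; first exact: mem_nodes.
apply/and3P; split; [by apply/reachbP; exists w1 | by apply/reachbP; exists w2 |].
apply/hasP; exists c; first exact: mem_walks.
have [-> -> H] := wrunP z' c; rewrite cw ce eqxx /=.
have [|b [d [-> dE]]] := H; first by have [_ -> _] := wrunP z' c.
by rewrite testE -dE.
Qed.

Lemma badb_gtP z : reflect (exists w, [/\ walk (edge A) z w, wend z w = z &
  0 < wsum (gain A) z w]) (badb gtb z).
Proof.
apply: badb_walk => [b c|c d|c d c0].
- by rewrite /gtb /= -ltNge subr_gt0.
- by move=> cd; apply: contraTT cd; rewrite negb_or -!leNgt => /andP[? ?]; lra.
- exists (Num.bound (`|d| / c)); rewrite -mulr_natl.
  have : `|d| / c < (Num.bound (`|d| / c))%:R by apply: archi_boundP; apply: divr_ge0; rewrite ?normr_ge0 ?(ltW c0).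
  rewrite ltr_pdivrMr //; move: (_%:R * c) => e H.
  by have := ler_norm (- d); rewrite normrN; lra.
Qed.

Lemma badb_neqP z : reflect (exists w, [/\ walk (edge A) z w, wend z w = z &
  wsum (gain A) z w != 0]) (badb neqb z).
Proof.
apply: (@badb_walk neqb (fun c => c != 0)) => [b c|c d|c d c0] /=.
- by rewrite /neqb /= -eq_le subr_eq0.
- by apply: contraTT => /=; rewrite negb_or !negbK => /andP[/eqP-> /eqP->]; rewrite addr0.
- have [d0|d0] := eqVneq (d + c *+ 0) 0; last by exists 0%N.
  by exists 1%N; move: d0; rewrite mulr0n addr0 => ->; rewrite add0r.
Qed.

Definition goodc P C q := [&& q \in P, q \in C &
  all (fun r => (r \in P) && (r \in C) ==> ~~ badb gtb (P, C, C, q, r)) (enum 'I_n)].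

Lemma goodcE P C q : goodc P C q = goodb A P C q.
Proof.
apply/idP/idP => [/and3P[qP qC H]|/asboolP[qP qC H]]; [apply/asboolP|apply/and3P]; split=> //.
  move=> r rP rC w ww we; have /allP/(_ r) := H; rewrite mem_enum rP rC => /(_ isT) Nb.
  by rewrite leNgt; apply/negP => w0; case/badb_gtP: Nb; exists w.
apply/allP => r _; apply/implyP => /andP[rP rC]; apply/badb_gtP => -[w [ww we]].
by rewrite ltNge H.
Qed.

(** Only its length matters: a type is determined by a set and the table of its function, so there
    are at most this many types. *)
Definition fuel : seq ({set 'I_n} * seq {set 'I_n}) :=
  [seq (C, G) | C <- subsets, G <- seqs subsets subsets].

Definition words := seqs fuel (enum Sigma).
Definition pwords := seqs subsets (enum Sigma).

(** Types form a graph with edges given by [stnext]. A shortened walk from [st0 A] spells a word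
    from right to left, hence the reversal. *)
Lemma words_st u : exists2 u', u' \in words & st A u' = st A u.
Proof.
pose e (X : stype n) a X' := X' == stnext A a X.
have ewalk (X : stype n) (w : seq (Sigma * stype n)) : walk e X w -> wend X w = foldr (stnext A) X (rev (map fst w)).
  elim: w X => [|[a X'] w IH] X //= /andP[/eqP XE /IH wE].
  by rewrite /wend /= -/(wend X' w) wE XE rev_cons -cats1 foldr_cat.
have [w [ww we]] : exists w : seq (Sigma * stype n), walk e (st0 A) w /\ wend (st0 A) w = st A u.
  elim: u => [|a u [w [ww we]]]; first by exists [::].
  exists (rcons w (a, stnext A a (st A u))); rewrite -cats1 walk_cat ww we /=.
  by rewrite /e eqxx wend_cat.
have [w' [w1 w2 w3]] := walk_shorten ww.
exists (rev (map fst w')); last by rewrite /st -ewalk // w2.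
apply: mem_seqs => [|a _]; last by rewrite mem_enum.
rewrite size_rev size_map; apply: leq_trans w3 _.
pose h (X : stype n) := (X.1, [seq X.2 P | P : {set 'I_n}]).
have hI : injective h.
  move=> [C f] [C' f'] [-> ff]; congr (_, _); apply/ffunP => P.
  by have /eq_in_map := ff; apply; rewrite mem_enum.
rewrite cardT -(size_map h); apply: uniq_leq_size; first by rewrite map_inj_uniq ?enum_uniq.
move=> _ /mapP[X _ ->]; apply/allpairsP; exists (h X); split=> //; first exact: mem_subsets.
apply: mem_seqs => [|P _]; last exact: mem_subsets.
by rewrite size_map -cardT; apply: card_le_size mem_subsets.
Qed.

Lemma pwords_Pw x : exists2 x', x' \in pwords & Pw A (Init A) x' = Pw A (Init A) x.
Proof.
pose e P a P' := P' == Psucc A a P.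
have ewalk P (w : seq (Sigma * {set 'I_n})) : walk e P w -> wend P w = Pw A P (map fst w).
  elim: w P => [|[a P'] w IH] P //= /andP[/eqP PE /IH wE].
  by rewrite /wend /= -/(wend P' w) wE PE.
have [w [ww we]] : exists w : seq (Sigma * {set 'I_n}), walk e (Init A) w /\ wend (Init A) w = Pw A (Init A) x.
  elim: x (Init A) => [|a x IH] P; first by exists [::].
  by have [w [ww we]] := IH (Psucc A a P); exists ((a, Psucc A a P) :: w); rewrite /= /e eqxx.
have [w' [w1 w2 w3]] := walk_shorten ww.
exists (map fst w'); last by rewrite -ewalk // w2.
apply: mem_seqs => [|a _]; last by rewrite mem_enum.
by rewrite size_map; apply: leq_trans w3 (card_le_size mem_subsets).
Qed.

Definition meets (P C : {set 'I_n}) := has (fun q => (q \in P) && (q \in C)) (enum 'I_n).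

Lemma meetsE P C : meets P C = [exists q in P, q \in C].
Proof.
apply/hasP/exists_inP => [[q _ /andP[qP qC]]|[q qP qC]]; first by exists q.
by exists q; rewrite ?mem_enum // qP.
Qed.

Definition dominantb := all (fun u =>
  meets (Init A) (st A u).1 ==> meets (Init A) ((st A u).2 (Init A))) words.

Lemma dominantbP : reflect (dominant A) dominantb.
Proof.
apply: (iffP allP) => H u.
  by have [u' u'w <-] := words_st u; have /implyP := H _ u'w; rewrite !meetsE.
by move=> _; apply/implyP; rewrite !meetsE; apply: H.
Qed.

Definition twin_at P C D := all (fun q => all (fun r =>
  goodc P C q && goodc P D r ==> ~~ badb neqb (P, C, D, q, r)) (enum 'I_n)) (enum 'I_n).

Definition twinsb := all (fun x => all (fun y => all (fun y' =>
  twin_at (Pw A (Init A) x) (Cw A y (Fin A)) (Cw A y' (Fin A))) words) words) pwords.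

Lemma twinsbP : reflect (twins A) twinsb.
Proof.
apply: (iffP allP) => H.
  move=> x y y' q q' P C D gq gq' w ww we.
  have [x' /H/allP xP xE] := pwords_Pw x.
  have [y1 /xP/allP yP yE] := words_st y; have [y2 y2w y'E] := words_st y'.
  have /allP := yP _ y2w; rewrite -!st1 xE yE y'E !st1 => /(_ q); rewrite mem_enum => /(_ isT).
  move=> /allP/(_ q'); rewrite mem_enum => /(_ isT)/implyP; rewrite !goodcE => Nb.
  apply/eqP; apply: contraT => w0; have /badb_neqP : ~~ badb neqb (P, C, D, q, q').
    by apply: Nb; apply/andP; split; apply/asboolP.
  by case; exists w.
move=> x _; apply/allP => y _; apply/allP => y' _; apply/allP => q _; apply/allP => r _.
apply/implyP; rewrite !goodcE => /andP[/asboolP gq /asboolP gr].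
apply/badb_neqP => -[w [ww we]]; rewrite (H x y y' q r) ?eqxx //.
Qed.

End Decision.

(** * Programs *)

Section Computability.
Variable R : realType.
Implicit Types (G : Type).

(** The tree [t g] can be computed from [e g], uniformly in [g]; [e] encodes the
    values of the variables on which [t] depends. *)
Definition cmp G (e t : G -> tree R) : Prop := exists p, forall g, eval p (e g) (t g).

Lemma cmp_id G (e : G -> tree R) : cmp e e.
Proof. by exists (Do IId) => g; apply: (eval_Do IId). Qed.

Lemma cmp_trans G (e t u : G -> tree R) : cmp e t -> cmp t u -> cmp e u.
Proof. by move=> [p pP] [q qP]; exists (Seq p q) => g; apply: eval_Seq (pP g) (qP g). Qed.

Lemma cmp_pull G H (h : H -> G) (e t : G -> tree R) :
  cmp e t -> cmp (fun x => e (h x)) (fun x => t (h x)).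
Proof. by move=> [p pP]; exists p. Qed.

Lemma cmp_ext G (e t u : G -> tree R) : t =1 u -> cmp e t -> cmp e u.
Proof. by move=> tu [p pP]; exists p => g; rewrite -tu. Qed.

Lemma cmp_do c G (e t : G -> tree R) : cmp e t -> cmp e (fun g => exec c (t g)).
Proof. by move=> et; apply: cmp_trans et _; exists (Do c) => g; apply: eval_Do. Qed.

Lemma cmp_node G (e t u : G -> tree R) :
  cmp e t -> cmp e u -> cmp e (fun g => Node (t g) (u g)).
Proof. by move=> [p pP] [q qP]; exists (Fork p q) => g; apply: eval_Fork. Qed.

Lemma cmp_nil G (e : G -> tree R) : cmp e (fun=> Defs.Nil).
Proof. by exists (Do INil) => g; apply: (eval_Do INil). Qed.

Lemma cmp_fst G (e t u : G -> tree R) : cmp e (fun g => Node (t g) (u g)) -> cmp e t.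
Proof. exact: (cmp_do ILeft). Qed.

Lemma cmp_snd G (e t u : G -> tree R) : cmp e (fun g => Node (t g) (u g)) -> cmp e u.
Proof. exact: (cmp_do IRight). Qed.

Lemma cmp_if G (e : G -> tree R) (b : G -> bool) t u : cmp e (fun g => tbool R (b g)) ->
  cmp e t -> cmp e u -> cmp e (fun g => if b g then t g else u g).
Proof.
move=> [c cP] [p pP] [q qP]; exists (If c p q) => g.
case E: (b g); have := cP g; rewrite E => cg.
  exact: eval_If_true cg _ (pP g).
exact: eval_If_false cg (qP g).
Qed.

(** The context [e] extended with one more variable. *)
Definition ctx G (e : G -> tree R) (X : G -> Type) (eX : forall g, X g -> tree R)
  (h : {g : G & X g}) : tree R := Node (e (tag h)) (eX (tag h) (tagged h)).

Lemma cmp_wk G (e t : G -> tree R) (X : G -> Type) (eX : forall g, X g -> tree R) :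
  cmp e t -> cmp (ctx e eX) (fun h => t (tag h)).
Proof.
move=> et; have /cmp_fst H := cmp_id (ctx e eX).
exact: cmp_trans H (cmp_pull (fun h : {g : G & X g} => tag h) et).
Qed.

Lemma cmp_var G (e : G -> tree R) (X : G -> Type) (eX : forall g, X g -> tree R) :
  cmp (ctx e eX) (fun h => eX (tag h) (tagged h)).
Proof. exact: cmp_snd (cmp_id _). Qed.

Definition epair (X Y : Type) (eX : X -> tree R) (eY : Y -> tree R) (p : X * Y) :=
  Node (eX p.1) (eY p.2).

Definition elist (X : Type) (eX : X -> tree R) (s : seq X) := tlist (map eX s).

Section Fold.
Variables (G : Type) (e : G -> tree R) (X Y : G -> Type).
Variables (eX : forall g, X g -> tree R) (eY : forall g, Y g -> tree R).

(** The one loop that is programmed by hand: its state holds the context, the remaining list and the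
    accumulator. Every other iteration reduces to it. *)
Lemma cmp_foldl (f : forall g, Y g -> X g -> Y g) (z : forall g, Y g) (s : forall g, seq (X g)) :
  cmp e (fun g => elist (@eX g) (s g)) -> cmp e (fun g => eY (z g)) ->
  cmp (ctx e (fun g => epair (@eY g) (@eX g)))
    (fun h => eY (f (tag h) (tagged h).1 (tagged h).2)) ->
  cmp e (fun g => eY (foldl (f g) (z g) (s g))).
Proof.
move=> [ps psP] [pz pzP] [pf pfP].
pose body := Fork (Do ILeft) (Fork (Seq (Do IRight) (Seq (Do ILeft) (Do IRight)))
  (Seq (Fork (Do ILeft) (Fork (Seq (Do IRight) (Do IRight))
    (Seq (Do IRight) (Seq (Do ILeft) (Do ILeft))))) pf)).
pose cond := Seq (Do IRight) (Seq (Do ILeft) (Do IIsNode)).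
exists (Seq (Seq (Fork (Do IId) (Fork ps pz)) (While cond body)) (Seq (Do IRight) (Do IRight))).
move=> g; have D c (t u : tree R) : exec c t = u -> eval (Do c) t u.
  by move=> <-; apply: eval_Do.
apply: (@eval_Seq _ _ _ _ (Node (e g) (Node Defs.Nil (eY (foldl (f g) (z g) (s g)))))); last first.
  by apply: eval_Seq; apply: D.
apply: (@eval_Seq _ _ _ _ (Node (e g) (Node (elist (@eX g) (s g)) (eY (z g))))).
  by apply: eval_Fork; [apply: D | apply: eval_Fork].
elim: (s g) (z g) => [|x l IH] y.
  by apply: eval_While_stop; apply: eval_Seq; [apply: D | apply: eval_Seq; apply: D].
apply: (@eval_While_step _ _ _ _ (Node Defs.Nil Defs.Nil) _ _ _ _ _ (IH (f g y x))) => //.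
  by apply: eval_Seq; [apply: D | apply: eval_Seq; apply: D].
apply: eval_Fork; first exact: D.
apply: eval_Fork.
  by apply: eval_Seq; [apply: D | apply: eval_Seq; apply: D].
apply: eval_Seq (pfP (existT _ g (y, x))).
apply: eval_Fork; first exact: D.
apply: eval_Fork; first by apply: eval_Seq; apply: D.
by apply: eval_Seq; [apply: D | apply: eval_Seq; apply: D].
Qed.

End Fold.

Section Lists.
Variables (G : Type) (e : G -> tree R) (X : G -> Type) (eX : forall g, X g -> tree R).
Variable s : forall g, seq (X g).
Hypothesis sP : cmp e (fun g => elist (@eX g) (s g)).

(** A right fold is a left fold over the reversed list, and reversal is a left fold too. *)
Lemma cmp_foldr (Y : G -> Type) (eY : forall g, Y g -> tree R) (f : forall g, X g -> Y g -> Y g)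
    (z : forall g, Y g) : cmp e (fun g => eY g (z g)) ->
  cmp (ctx e (fun g => epair (@eX g) (@eY g)))
    (fun h => eY _ (f (tag h) (tagged h).1 (tagged h).2)) ->
  cmp e (fun g => eY g (foldr (f g) (z g) (s g))).
Proof.
move=> zP fP.
have revP : cmp e (fun g => elist (@eX g) (rev (s g))).
  apply: (cmp_ext (t := fun g => elist (@eX g) (foldl (fun l x => x :: l) [::] (s g)))).
    by move=> g; rewrite -[s g in LHS]revK foldl_rev; congr elist; elim: (rev _) => //= x l ->.
  apply: (@cmp_foldl _ e X (fun g => seq (X g)) eX (fun g => elist (@eX g))
    (fun g l x => x :: l) (fun=> [::]) s sP (cmp_nil e)).
  apply: cmp_node; first exact: cmp_snd (cmp_var _ _).
  exact: cmp_fst (cmp_var _ _).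
apply: (cmp_ext (t := fun g => eY g (foldl (fun y x => f g x y) (z g) (rev (s g))))).
  by move=> g; rewrite foldl_rev.
apply: (@cmp_foldl _ e X Y eX eY (fun g y x => f g x y) z (fun g => rev (s g)) revP zP).
pose sw (h : {g : G & (Y g * X g)%type}) : {g : G & (X g * Y g)%type} :=
  existT _ (tag h) ((tagged h).2, (tagged h).1).
apply: cmp_trans (cmp_pull sw fP); apply: cmp_node.
  exact: cmp_fst (cmp_id _).
apply: cmp_node; first exact: cmp_snd (cmp_var _ _).
exact: cmp_fst (cmp_var _ _).
Qed.

Lemma cmp_map (t : forall g, X g -> tree R) :
  cmp (ctx e eX) (fun h => t (tag h) (tagged h)) ->
  cmp e (fun g => elist (t g) (s g)).
Proof.
move=> tP; apply: (cmp_ext (t := fun g => foldr (fun x l => Node (t g x) l) Defs.Nil (s g))).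
  by move=> g; elim: (s g) => //= x l ->.
apply: (@cmp_foldr (fun=> tree R) (fun _ t => t) (fun g x l => Node (t g x) l)).
  exact: cmp_nil.
apply: cmp_node; last exact: cmp_snd (cmp_var _ _).
pose pr (h : {g : G & (X g * tree R)%type}) : {g : G & X g} := existT _ (tag h) (tagged h).1.
apply: cmp_trans (cmp_pull pr tP); apply: cmp_node; first exact: cmp_fst (cmp_id _).
exact: cmp_fst (cmp_var _ _).
Qed.

Lemma cmp_all (b : forall g, X g -> bool) :
  cmp (ctx e eX) (fun h => tbool R (b (tag h) (tagged h))) ->
  cmp e (fun g => tbool R (all (b g) (s g))).
Proof.
move=> bP; apply: (@cmp_foldr (fun=> bool) (fun _ => tbool R) (fun g x c => b g x && c)).
  exact: cmp_node (cmp_nil _) (cmp_nil _).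
pose pr (h : {g : G & (X g * bool)%type}) : {g : G & X g} := existT _ (tag h) (tagged h).1.
apply: (cmp_ext (t := fun h => if b (tag h) (tagged h).1 then tbool R (tagged h).2 else Defs.Nil)).
  by move=> h; case: (b _ _).
apply: cmp_if (cmp_nil _); last exact: cmp_snd (cmp_var _ _).
apply: cmp_trans (cmp_pull pr bP); apply: cmp_node; first exact: cmp_fst (cmp_id _).
exact: cmp_fst (cmp_var _ _).
Qed.

End Lists.

Section Booleans.
Variables (G : Type) (e : G -> tree R) (b c : G -> bool).
Hypotheses (bP : cmp e (fun g => tbool R (b g))) (cP : cmp e (fun g => tbool R (c g))).

Lemma cmp_true : cmp e (fun=> tbool R true).
Proof. exact: cmp_node (cmp_nil _) (cmp_nil _). Qed.

Lemma cmp_neg : cmp e (fun g => tbool R (~~ b g)).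
Proof.
apply: cmp_ext (cmp_if bP (cmp_nil _) cmp_true) => g; by case: (b g).
Qed.

Lemma cmp_and : cmp e (fun g => tbool R (b g && c g)).
Proof. apply: cmp_ext (cmp_if bP cP (cmp_nil _)) => g; by case: (b g). Qed.

Lemma cmp_imp : cmp e (fun g => tbool R (b g ==> c g)).
Proof. apply: cmp_ext (cmp_if bP cP cmp_true) => g; by case: (b g). Qed.

Lemma cmp_eqb : cmp e (fun g => tbool R (b g == c g)).
Proof.
have cN : cmp e (fun g => tbool R (~~ c g)).
  apply: cmp_ext (cmp_if cP (cmp_nil _) cmp_true) => g; by case: (c g).
apply: cmp_ext (cmp_if bP cP cN) => g; by case: (b g) (c g) => -[].
Qed.

End Booleans.

Lemma cmp_has G (e : G -> tree R) (X : G -> Type) (eX : forall g, X g -> tree R)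
    (s : forall g, seq (X g)) (b : forall g, X g -> bool) :
  cmp e (fun g => elist (@eX g) (s g)) ->
  cmp (ctx e eX) (fun h => tbool R (b (tag h) (tagged h))) ->
  cmp e (fun g => tbool R (has (b g) (s g))).
Proof.
move=> sP bP; apply: (cmp_ext (t := fun g => tbool R (~~ all (fun x => ~~ b g x) (s g)))).
  by move=> g; rewrite -has_predC; congr tbool; apply: eq_has => x /=; rewrite negbK.
by apply: cmp_neg; apply: (cmp_all sP); apply: cmp_neg.
Qed.

Lemma cmp_cat G (e : G -> tree R) (X : G -> Type) (eX : forall g, X g -> tree R)
    (s t : forall g, seq (X g)) :
  cmp e (fun g => elist (@eX g) (s g)) -> cmp e (fun g => elist (@eX g) (t g)) ->
  cmp e (fun g => elist (@eX g) (s g ++ t g)).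
Proof.
move=> sP tP.
apply: (cmp_ext (t := fun g => foldr (fun x l => Node (eX g x) l) (elist (@eX g) (t g)) (s g))).
  by move=> g; elim: (s g) => //= x l ->.
apply: (@cmp_foldr _ _ _ _ _ sP (fun=> tree R) (fun _ t => t) (fun g x l => Node (eX g x) l)) => //.
by apply: cmp_node; [apply: cmp_fst (cmp_var _ _) | apply: cmp_snd (cmp_var _ _)].
Qed.

Lemma cmp_allpairs G (e : G -> tree R) (X Y Z : G -> Type) (eX : forall g, X g -> tree R)
    (eY : forall g, Y g -> tree R) (eZ : forall g, Z g -> tree R)
    (s : forall g, seq (X g)) (t : forall g, seq (Y g)) (f : forall g, X g -> Y g -> Z g) :
  cmp e (fun g => elist (@eX g) (s g)) -> cmp e (fun g => elist (@eY g) (t g)) ->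
  cmp (ctx (ctx e eX) (fun h => @eY (tag h))) (fun h => eZ (tag (tag h)) (f _ (tagged (tag h)) (tagged h))) ->
  cmp e (fun g => elist (@eZ g) [seq f g x y | x <- s g, y <- t g]).
Proof.
move=> sP tP fP.
apply: (cmp_ext (t := fun g => elist (@eZ g)
  (foldr (fun x l => [seq f g x y | y <- t g] ++ l) [::] (s g)))).
  by move=> g; congr elist; elim: (s g) => //= x l ->.
apply: (@cmp_foldr _ _ _ _ _ sP (fun g => seq (Z g)) (fun g => elist (@eZ g))
  (fun g x l => [seq f g x y | y <- t g] ++ l)); first exact: cmp_nil.
apply: cmp_cat; last exact: cmp_snd (cmp_var _ _).
pose pr (h : {g : G & (X g * seq (Z g))%type}) : {g : G & X g} := existT _ (tag h) (tagged h).1.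
have H : cmp (ctx e eX) (fun h => elist (@eZ (tag h)) [seq f (tag h) (tagged h) y | y <- t (tag h)]).
  apply: (cmp_ext (t := fun h => elist (fun y => eZ (tag h) (f (tag h) (tagged h) y)) (t (tag h)))).
    by move=> h; rewrite /elist -map_comp.
  exact: (cmp_map (cmp_wk eX tP) fP).
apply: cmp_trans (cmp_pull pr H); apply: cmp_node; first exact: cmp_fst (cmp_id _).
exact: cmp_fst (cmp_var _ _).
Qed.

Lemma cmp_seqs G (e : G -> tree R) (X Y : G -> Type) (eX : forall g, X g -> tree R)
    (eY : forall g, Y g -> tree R) (s : forall g, seq (X g)) (t : forall g, seq (Y g)) :
  cmp e (fun g => elist (@eX g) (s g)) -> cmp e (fun g => elist (@eY g) (t g)) ->
  cmp e (fun g => elist (elist (@eY g)) (seqs (s g) (t g))).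
Proof.
move=> sP tP; apply: (@cmp_foldr _ _ _ _ _ sP (fun g => seq (seq (Y g)))
  (fun g => elist (elist (@eY g))) (fun g _ acc => [::] :: [seq y :: w | y <- t g, w <- acc])).
  exact: cmp_node (cmp_nil _) (cmp_nil _).
apply: cmp_node; first exact: cmp_nil.
apply: (@cmp_allpairs _ _ (fun h => Y (tag h)) (fun h => seq (Y (tag h)))
  (fun h => seq (Y (tag h))) (fun h => @eY (tag h)) (fun h => elist (@eY (tag h)))
  (fun h => elist (@eY (tag h))) (fun h => t (tag h)) (fun h => (tagged h).2)
  (fun h y w => y :: w)).
- exact: (cmp_wk _ tP).
- exact: cmp_snd (cmp_var _ _).
- by apply: cmp_node; [apply: cmp_wk (cmp_var _ _) | apply: cmp_var].
Qed.

End Computability.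

(** * Ordinals, weights and sets as trees *)

Section Numbers.
Variables (R : realType) (G : Type) (e : G -> tree R).

(** Unary numbers have the shape of lists, so they can drive a fold. Taking right subtrees
    repeatedly then gives both truncated subtraction and access to the entries of a list. *)
Definition tnat k : tree R := iter k (Node Defs.Nil) Defs.Nil.
Definition eord N (i : 'I_N) : tree R := tnat i.

Lemma tnatE k : tnat k = elist (fun=> Defs.Nil) (nseq k tt).
Proof. by elim: k => //= k ->. Qed.

Lemma cmp_drop (k : G -> nat) (t : G -> tree R) : cmp e (fun g => tnat (k g)) -> cmp e t ->
  cmp e (fun g => iter (k g) (exec IRight) (t g)).
Proof.
move=> kP tP.
apply: (cmp_ext (t := fun g => foldl (fun t _ => exec IRight t) (t g) (nseq (k g) tt))).
  by move=> g; elim: (k g) (t g) => // l IH u; rewrite iterSr -IH.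
apply: (@cmp_foldl _ _ e (fun=> unit) (fun=> tree R) (fun _ _ => Defs.Nil) (fun _ t => t)
  (fun _ t _ => exec IRight t) t (fun g => nseq (k g) tt)) => //.
  by apply: cmp_ext kP => g; rewrite tnatE.
exact: cmp_do (cmp_fst (cmp_var _ _)).
Qed.

Lemma cmp_eqn (k l : G -> nat) : cmp e (fun g => tnat (k g)) -> cmp e (fun g => tnat (l g)) ->
  cmp e (fun g => tbool R (k g == l g)).
Proof.
move=> kP lP.
have subE i j : iter i (exec IRight) (tnat j) = tnat (j - i)%N.
  elim: i => [|i IH]; first by rewrite subn0.
  by rewrite iterS IH subnS; case: (j - i)%N.
have isn j : exec IIsNode (tnat j) = tbool R (j != 0%N) by case: j.
apply: (cmp_ext (t := fun g => tbool R (~~ (k g - l g != 0)%N && ~~ (l g - k g != 0)%N))).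
  by move=> g; congr tbool; rewrite !negbK [RHS]eqn_leq.
apply: cmp_and; apply: cmp_neg.
  apply: cmp_ext (cmp_do IIsNode (cmp_drop lP kP)) => g; by rewrite subE isn.
apply: cmp_ext (cmp_do IIsNode (cmp_drop kP lP)) => g; by rewrite subE isn.
Qed.

Variable n : G -> nat.

Lemma cmp_eqQ (q r : forall g, 'I_(n g)) : cmp e (fun g => eord (q g)) ->
  cmp e (fun g => eord (r g)) -> cmp e (fun g => tbool R (q g == r g)).
Proof. exact: cmp_eqn. Qed.

Lemma cmp_nth (t : forall g, 'I_(n g) -> tree R) (q : forall g, 'I_(n g)) :
  cmp e (fun g => elist (t g) (enum 'I_(n g))) -> cmp e (fun g => eord (q g)) ->
  cmp e (fun g => t g (q g)).
Proof.
move=> tP qP; apply: cmp_ext (cmp_do ILeft (cmp_drop qP tP)) => g.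
have -> (l : seq (tree R)) k : iter k (exec IRight) (tlist l) = tlist (drop k l).
  elim: k => [|k IH]; first by rewrite drop0.
  by rewrite iterS IH -addn1 addnC -drop_drop; case: (drop k l) => //= x l'; rewrite drop0.
have qn : (q g < size (enum 'I_(n g)))%N by rewrite size_enum_ord.
rewrite (drop_nth (t g (q g))); last by rewrite size_map.
by rewrite (nth_map (q g)) // nth_ord_enum.
Qed.

(** The input contains lists indexed by ordinals but no ordinals; the length of one such list is
    enough to produce them. *)
Lemma cmp_enum_ord (t : forall g, 'I_(n g) -> tree R) :
  cmp e (fun g => elist (t g) (enum 'I_(n g))) ->
  cmp e (fun g => elist (@eord (n g)) (enum 'I_(n g))).
Proof.
move=> tP; apply: (cmp_ext (t := fun g => elist tnat (foldr (fun _ l => 0%N :: map S l) [::]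
    (enum 'I_(n g))))).
  move=> g; rewrite /elist /eord (map_comp tnat val) val_enum_ord; congr (tlist (map _ _)).
  transitivity (iota 0 (size (enum 'I_(n g)))); last by rewrite size_enum_ord.
  by elim: (enum _) => //= _ l ->; rewrite -(iotaDl 1).
apply: (@cmp_foldr _ _ e (fun g => 'I_(n g)) t (fun g => enum 'I_(n g)) tP (fun=> seq nat)
  (fun _ => elist tnat) (fun _ _ l => 0%N :: map S l)); first exact: cmp_nil.
apply: cmp_node; first exact: cmp_nil.
apply: (cmp_ext (t := fun h => elist (fun k => tnat k.+1) (tagged h).2)).
  by move=> h; exact: (congr1 (@tlist R) (map_comp tnat S _)).
apply: (@cmp_map _ _ _ (fun=> nat) (fun _ => tnat) (fun h => (tagged h).2) _ (fun _ k => tnat k.+1)).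
  exact: cmp_snd (cmp_var _ _).
by apply: cmp_node; [apply: cmp_nil | apply: cmp_var].
Qed.

Lemma cmp_neq0 (x : G -> maxplus R) : cmp e (fun g => Defs.Num (x g)) ->
  cmp e (fun g => tbool R (x g != 0)).
Proof.
move=> xP; have zP : cmp e (fun=> Defs.Num (None : maxplus R)) by apply: (cmp_do INegInf xP).
apply: cmp_neg; apply: cmp_ext (cmp_do ILe (cmp_node xP zP)) => g /=.
by case: (x g).
Qed.

Lemma cmp_mul (x y : G -> maxplus R) : cmp e (fun g => Defs.Num (x g)) ->
  cmp e (fun g => Defs.Num (y g)) -> cmp e (fun g => Defs.Num (x g * y g)).
Proof. by move=> xP yP; apply: (cmp_do IAdd (cmp_node xP yP)). Qed.

Lemma cmp_le (x y : G -> maxplus R) : cmp e (fun g => Defs.Num (x g)) ->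
  cmp e (fun g => Defs.Num (y g)) -> cmp e (fun g => tbool R (mp_le (x g) (y g))).
Proof. by move=> xP yP; apply: (cmp_do ILe (cmp_node xP yP)). Qed.

Definition eset N (P : {set 'I_N}) : tree R :=
  elist (fun q => tbool R (q \in P)) (enum 'I_N).

Lemma cmp_mem (P : forall g, {set 'I_(n g)}) (q : forall g, 'I_(n g)) :
  cmp e (fun g => eset (P g)) -> cmp e (fun g => eord (q g)) ->
  cmp e (fun g => tbool R (q g \in P g)).
Proof. exact: cmp_nth. Qed.

End Numbers.
Arguments tnat {R}.
Arguments eord {R N}.
Arguments eset {R N}.

Section Sets.
Variables (R : realType) (G : Type) (e : G -> tree R) (n : G -> nat).
Hypothesis nP : cmp e (fun g => elist (@eord R (n g)) (enum 'I_(n g))).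

Lemma cmp_set (b : forall g, 'I_(n g) -> bool) :
  cmp (ctx e (fun g => @eord R (n g))) (fun h => tbool R (b (tag h) (tagged h))) ->
  cmp e (fun g => eset [set q | b g q]).
Proof.
move=> bP; apply: (cmp_ext (t := fun g => elist (fun q => tbool R (b g q)) (enum 'I_(n g)))).
  by move=> g; rewrite /eset /elist; congr tlist; apply: eq_map => q; rewrite inE.
exact: (cmp_map nP bP).
Qed.

Lemma cmp_exists_in (P : forall g, {set 'I_(n g)}) (b : forall g, 'I_(n g) -> bool) :
  cmp e (fun g => eset (P g)) ->
  cmp (ctx e (fun g => @eord R (n g))) (fun h => tbool R (b (tag h) (tagged h))) ->
  cmp e (fun g => tbool R [exists q in P g, b g q]).
Proof.
move=> PP bP.
apply: (cmp_ext (t := fun g => tbool R (has (fun q => (q \in P g) && b g q) (enum 'I_(n g))))).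
  move=> g; congr tbool; apply/hasP/exists_inP => [[q _ /andP[qP bq]]|[q qP bq]]; exists q => //.
    by rewrite mem_enum.
  by rewrite qP.
apply: (cmp_has nP); apply: cmp_and bP.
apply: (@cmp_mem _ _ _ (fun h : {g : G & 'I_(n g)} => n (tag h)) (fun h => P (tag h))
  (fun h => tagged h)); [exact: (cmp_wk _ PP) | exact: cmp_var].
Qed.

Lemma cmp_eq_set (P C : forall g, {set 'I_(n g)}) : cmp e (fun g => eset (P g)) ->
  cmp e (fun g => eset (C g)) -> cmp e (fun g => tbool R (P g == C g)).
Proof.
move=> PP CP.
apply: (cmp_ext (t := fun g => tbool R (all (fun q => (q \in P g) == (q \in C g)) (enum 'I_(n g))))).
  move=> g; congr tbool; apply/allP/eqP => [H|-> //]; apply/setP => q.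
  by apply/eqP/H; rewrite mem_enum.
apply: (cmp_all nP); apply: cmp_eqb.
  apply: (@cmp_mem _ _ _ (fun h : {g : G & 'I_(n g)} => n (tag h)) (fun h => P (tag h))
    (fun h => tagged h)); [exact: (cmp_wk _ PP) | exact: cmp_var].
apply: (@cmp_mem _ _ _ (fun h : {g : G & 'I_(n g)} => n (tag h)) (fun h => C (tag h))
  (fun h => tagged h)); [exact: (cmp_wk _ CP) | exact: cmp_var].
Qed.

End Sets.

Section Subsets.
Variables (R : realType) (G : Type) (e : G -> tree R) (n : G -> nat).
Hypothesis nP : cmp e (fun g => elist (@eord R (n g)) (enum 'I_(n g))).

Lemma cmp_set0 : cmp e (fun g => eset (set0 : {set 'I_(n g)})).
Proof.
apply: (cmp_ext (t := fun g => eset [set q : 'I_(n g) | false])).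
  by move=> g; congr eset; apply/setP => q; rewrite !inE.
exact: (cmp_set nP (b := fun _ _ => false) (cmp_nil _)).
Qed.

Lemma cmp_insert (P : forall g, {set 'I_(n g)}) (q : forall g, 'I_(n g)) :
  cmp e (fun g => eset (P g)) -> cmp e (fun g => eord (q g)) ->
  cmp e (fun g => eset (q g |: P g)).
Proof.
move=> PP qP.
apply: (cmp_ext (t := fun g => eset [set r | ~~ (~~ (r == q g) && ~~ (r \in P g))])).
  by move=> g; congr eset; apply/setP => r; rewrite !inE negb_and !negbK.
apply: (cmp_set nP); apply: cmp_neg; apply: cmp_and; apply: cmp_neg.
  apply: (@cmp_eqQ _ _ _ (fun h : {g : G & 'I_(n g)} => n (tag h)) (fun h => tagged h)
    (fun h => q (tag h))); [exact: cmp_var | exact: (cmp_wk _ qP)].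
apply: (@cmp_mem _ _ _ (fun h : {g : G & 'I_(n g)} => n (tag h)) (fun h => P (tag h))
  (fun h => tagged h)); [exact: (cmp_wk _ PP) | exact: cmp_var].
Qed.

End Subsets.

Lemma cmp_subsets (R : realType) (G : Type) (e : G -> tree R) (n : G -> nat) :
  cmp e (fun g => elist (@eord R (n g)) (enum 'I_(n g))) ->
  cmp e (fun g => elist (@eset R (n g)) (subsets (n g))).
Proof.
move=> nP; apply: (@cmp_foldr _ _ _ _ _ _ nP (fun g => seq {set 'I_(n g)})
  (fun g => elist (@eset R (n g))) (fun g i acc => acc ++ [seq i |: P | P <- acc])).
  by apply: cmp_node (cmp_nil _); apply: cmp_set0.
pose H := {g : G & ('I_(n g) * seq {set 'I_(n g)})%type}.
have acc := cmp_snd (cmp_var e (fun g => epair (@eord R (n g)) (elist (@eset R (n g))))).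
have i := cmp_fst (cmp_var e (fun g => epair (@eord R (n g)) (elist (@eset R (n g))))).
apply: (@cmp_cat _ _ _ (fun h : H => {set 'I_(n (tag h))}) (fun h => @eset R (n (tag h)))
  (fun h => (tagged h).2)); first exact: acc.
apply: (cmp_ext (t := fun h : H => elist (fun P => eset ((tagged h).1 |: P)) (tagged h).2)).
  by move=> h; rewrite /elist -map_comp.
apply: (cmp_map acc).
apply: (@cmp_insert _ _ _ (fun h : {h : H & {set 'I_(n (tag h))}} => n (tag (tag h)))
  _ (fun h => tagged h) (fun h => (tagged (tag h)).1)).
- exact: (cmp_wk _ (cmp_wk _ nP)).
- exact: cmp_var.
- exact: (cmp_wk _ i).
Qed.

(** * Programs on encoded automata *)

(** Bundling the alphabet and the dimension with the automaton lets one program serve all of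
    them. *)
Record inst (R : realType) := Inst {
  inst_letters : finType;
  inst_size : nat;
  inst_aut : automaton R inst_letters inst_size }.

Section Instances.
Variable R : realType.

Local Notation sz i := (inst_size i).
Local Notation au i := (inst_aut i).
Local Notation lt i := (inst_letters i).

(** The input does not name its letters, so a letter is represented by its matrix. Letters with
    equal matrices share a code, which is harmless: the procedures never compare letters. *)
Definition elet (i : inst R) (a : lt i) : tree R := tmx (letmx (au i) a).
Definition ewords (i : inst R) : seq (lt i) -> tree R := elist (@elet i).
Definition enode N : node N -> tree R :=
  epair (epair (epair (epair (@eset R N) (@eset R N)) (@eset R N)) (@eord R N)) (@eord R N).

Section Basic.
Variables (G : Type) (e : G -> tree R) (I : G -> inst R).
Hypothesis HI : cmp e (fun g => encode (au (I g))).

Lemma cmp_ords : cmp e (fun g => elist (@eord R (sz (I g))) (enum 'I_(sz (I g)))).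
Proof.
exact: (@cmp_enum_ord _ _ _ (fun g => sz (I g))
  (fun g i => elist (fun j => Defs.Num (final_wt (au (I g)) i j)) (enum 'I_1))
  (cmp_snd (cmp_snd HI))).
Qed.

Lemma cmp_letters : cmp e (fun g => ewords (enum (lt (I g)))).
Proof. exact: (cmp_fst (cmp_snd HI)). Qed.

Variables (a : forall g, lt (I g)) (q r : forall g, 'I_(sz (I g))).
Hypotheses (aP : cmp e (fun g => elet (a g))).
Hypotheses (qP : cmp e (fun g => eord (q g))) (rP : cmp e (fun g => eord (r g))).

Lemma cmp_letmx : cmp e (fun g => Defs.Num (letmx (au (I g)) (a g) (q g) (r g))).
Proof.
have H := @cmp_nth _ _ _ _ (fun g i => elist (fun j => Defs.Num (letmx (au (I g)) (a g) i j))
  (enum 'I_(sz (I g)))) q aP qP.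
exact: (@cmp_nth _ _ _ _ (fun g j => Defs.Num (letmx (au (I g)) (a g) (q g) j)) r H rP).
Qed.

Lemma cmp_transition : cmp e (fun g => tbool R (transition (au (I g)) (q g) (a g) (r g))).
Proof. exact: cmp_neq0 cmp_letmx. Qed.

Let zP : cmp e (fun=> eord (ord0 : 'I_1)).
Proof. exact: cmp_nil. Qed.

Lemma cmp_initial : cmp e (fun g => tbool R (initial (au (I g)) (q g))).
Proof.
apply: cmp_neq0.
have H := @cmp_nth _ _ _ (fun=> 1%N) (fun g i => elist (fun j =>
  Defs.Num (init_wt (au (I g)) i j)) (enum 'I_(sz (I g)))) (fun=> ord0) (cmp_fst HI) zP.
exact: (@cmp_nth _ _ _ _ (fun g j => Defs.Num (init_wt (au (I g)) 0 j)) q H qP).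
Qed.

Lemma cmp_final : cmp e (fun g => tbool R (final (au (I g)) (q g))).
Proof.
apply: cmp_neq0.
have H := @cmp_nth _ _ _ _ (fun g i => elist (fun j =>
  Defs.Num (final_wt (au (I g)) i j)) (enum 'I_1)) q (cmp_snd (cmp_snd HI)) qP.
exact: (@cmp_nth _ _ _ (fun=> 1%N) (fun g j => Defs.Num (final_wt (au (I g)) (q g) j))
  (fun=> ord0) H zP).
Qed.

End Basic.

Section SetFunctions.
Variables (G : Type) (e : G -> tree R) (I : G -> inst R).
Hypothesis HI : cmp e (fun g => encode (au (I g))).

Let H1 (X : G -> Type) (eX : forall g, X g -> tree R) := cmp_wk eX HI.

Lemma cmp_Init : cmp e (fun g => eset (Init (au (I g)))).
Proof.
apply: (cmp_set (cmp_ords HI)).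
apply: (@cmp_initial _ _ (fun h => I (tag h)) (H1 _) (fun h => tagged h)); exact: cmp_var.
Qed.

Lemma cmp_Fin : cmp e (fun g => eset (Fin (au (I g)))).
Proof.
apply: (cmp_set (cmp_ords HI)).
apply: (@cmp_final _ _ (fun h => I (tag h)) (H1 _) (fun h => tagged h)); exact: cmp_var.
Qed.

Variables (a : forall g, lt (I g)) (P : forall g, {set 'I_(sz (I g))}).
Hypotheses (aP : cmp e (fun g => elet (a g))) (PP : cmp e (fun g => eset (P g))).

Lemma cmp_Psucc : cmp e (fun g => eset (Psucc (au (I g)) (a g) (P g))).
Proof.
apply: (cmp_set (cmp_ords HI)).
apply: (@cmp_exists_in _ _ _ _ (cmp_ords (I := fun h => I (tag h)) (H1 _)) (fun h => P (tag h))).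
  exact: (cmp_wk _ PP).
apply: (@cmp_transition _ _ (fun h => I (tag (tag h))) (fun h => a (tag (tag h)))
  (fun h => tagged h) (fun h => tagged (tag h))).
- exact: (cmp_wk _ (cmp_wk _ aP)).
- exact: cmp_var.
- exact: (cmp_wk _ (cmp_var _ _)).
Qed.

Lemma cmp_Cpre : cmp e (fun g => eset (Cpre (au (I g)) (a g) (P g))).
Proof.
apply: (cmp_set (cmp_ords HI)).
apply: (@cmp_exists_in _ _ _ _ (cmp_ords (I := fun h => I (tag h)) (H1 _)) (fun h => P (tag h))).
  exact: (cmp_wk _ PP).
apply: (@cmp_transition _ _ (fun h => I (tag (tag h))) (fun h => a (tag (tag h)))
  (fun h => tagged (tag h)) (fun h => tagged h)).
- exact: (cmp_wk _ (cmp_wk _ aP)).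
- exact: (cmp_wk _ (cmp_var _ _)).
- exact: cmp_var.
Qed.

End SetFunctions.

Section WordFunctions.
Variables (G : Type) (e : G -> tree R) (I : G -> inst R).
Hypothesis HI : cmp e (fun g => encode (au (I g))).
Variables (u : forall g, seq (lt (I g))) (P : forall g, {set 'I_(sz (I g))}).
Hypotheses (uP : cmp e (fun g => ewords (u g))) (PP : cmp e (fun g => eset (P g))).

Lemma cmp_Pw : cmp e (fun g => eset (Pw (au (I g)) (P g) (u g))).
Proof.
apply: (@cmp_foldl _ _ _ (fun g => lt (I g)) (fun g => {set 'I_(sz (I g))}) (fun g => @elet (I g))
  (fun g => @eset R (sz (I g))) (fun g P a => Psucc (au (I g)) a P) P u uP PP).
apply: (@cmp_Psucc _ _ (fun h => I (tag h)) (cmp_wk _ HI) (fun h => (tagged h).2)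
  (fun h => (tagged h).1)).
- exact: cmp_snd (cmp_var _ _).
- exact: cmp_fst (cmp_var _ _).
Qed.

Lemma cmp_Cw : cmp e (fun g => eset (Cw (au (I g)) (u g) (P g))).
Proof.
apply: (@cmp_foldr _ _ _ (fun g => lt (I g)) (fun g => @elet (I g)) u uP
  (fun g => {set 'I_(sz (I g))}) (fun g => @eset R (sz (I g))) (fun g => Cpre (au (I g))) P PP).
apply: (@cmp_Cpre _ _ (fun h => I (tag h)) (cmp_wk _ HI) (fun h => (tagged h).1)
  (fun h => (tagged h).2)).
- exact: cmp_fst (cmp_var _ _).
- exact: cmp_snd (cmp_var _ _).
Qed.

End WordFunctions.

Section NodeFunctions.
Variables (G : Type) (e : G -> tree R) (n : G -> nat).
Hypothesis nP : cmp e (fun g => elist (@eord R (n g)) (enum 'I_(n g))).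

Lemma cmp_eq_node (z z' : forall g, node (n g)) : cmp e (fun g => enode (z g)) ->
  cmp e (fun g => enode (z' g)) -> cmp e (fun g => tbool R (z g == z' g)).
Proof.
move=> zP zP'.
apply: (cmp_ext (t := fun g => tbool R ((((((z g).1.1.1.1 == (z' g).1.1.1.1) &&
  ((z g).1.1.1.2 == (z' g).1.1.1.2)) && ((z g).1.1.2 == (z' g).1.1.2)) &&
  ((z g).1.2 == (z' g).1.2)) && ((z g).2 == (z' g).2)))) => //.
apply: cmp_and; last exact: (cmp_eqQ (cmp_snd zP) (cmp_snd zP')).
have zP1 := cmp_fst zP; have zP1' := cmp_fst zP'.
apply: cmp_and; last exact: (cmp_eqQ (cmp_snd zP1) (cmp_snd zP1')).
have zP2 := cmp_fst zP1; have zP2' := cmp_fst zP1'.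
apply: cmp_and; last exact: (cmp_eq_set nP (cmp_snd zP2) (cmp_snd zP2')).
have zP3 := cmp_fst zP2; have zP3' := cmp_fst zP2'.
apply: cmp_and; last exact: (cmp_eq_set nP (cmp_snd zP3) (cmp_snd zP3')).
exact: (cmp_eq_set nP (cmp_fst zP3) (cmp_fst zP3')).
Qed.

Lemma cmp_nodes : cmp e (fun g => elist (@enode (n g)) (nodes (n g))).
Proof.
have sP := cmp_subsets nP.
have pair (X Y : G -> Type) (eX : forall g, X g -> tree R) (eY : forall g, Y g -> tree R)
  (s : forall g, seq (X g)) (t : forall g, seq (Y g)) :
  cmp e (fun g => elist (@eX g) (s g)) -> cmp e (fun g => elist (@eY g) (t g)) ->
  cmp e (fun g => elist (epair (@eX g) (@eY g)) [seq (x, y) | x <- s g, y <- t g]).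
  move=> sX tY; apply: (@cmp_allpairs _ _ _ _ _ _ _ _ (fun g => epair (@eX g) (@eY g)) _ _
    (fun g x y => (x, y)) sX tY).
  by apply: cmp_node; [apply: (cmp_wk _ (cmp_var _ _)) | apply: cmp_var].
exact: (pair _ _ _ _ _ _ (pair _ _ _ _ _ _ (pair _ _ _ _ _ _ (pair _ _ _ _ _ _ sP sP) sP) nP) nP).
Qed.

Lemma cmp_meets (P C : forall g, {set 'I_(n g)}) : cmp e (fun g => eset (P g)) ->
  cmp e (fun g => eset (C g)) -> cmp e (fun g => tbool R (meets (P g) (C g))).
Proof.
move=> PP CP; apply: (cmp_has nP); apply: cmp_and.
  apply: (@cmp_mem _ _ _ (fun h : {g : G & 'I_(n g)} => n (tag h)) (fun h => P (tag h))
    (fun h => tagged h)); [exact: (cmp_wk _ PP) | exact: cmp_var].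
apply: (@cmp_mem _ _ _ (fun h : {g : G & 'I_(n g)} => n (tag h)) (fun h => C (tag h))
  (fun h => tagged h)); [exact: (cmp_wk _ CP) | exact: cmp_var].
Qed.

End NodeFunctions.

Section Walks.
Variables (G : Type) (e : G -> tree R) (I : G -> inst R).
Hypothesis HI : cmp e (fun g => encode (au (I g))).

Lemma cmp_edge (z z' : forall g, node (sz (I g))) (a : forall g, lt (I g)) :
  cmp e (fun g => enode (z g)) -> cmp e (fun g => elet (a g)) ->
  cmp e (fun g => enode (z' g)) ->
  cmp e (fun g => tbool R (edge (au (I g)) (z g) (a g) (z' g))).
Proof.
move=> zP aP zP'; have nP := cmp_ords HI.
apply: (cmp_ext (t := fun g => tbool R ([&& (z' g).1.1.1.1 == Psucc (au (I g)) (a g) (z g).1.1.1.1,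
  (z g).1.1.1.2 == Cpre (au (I g)) (a g) (z' g).1.1.1.2,
  (z g).1.1.2 == Cpre (au (I g)) (a g) (z' g).1.1.2,
  transition (au (I g)) (z g).1.2 (a g) (z' g).1.2 &
  transition (au (I g)) (z g).2 (a g) (z' g).2]))).
  by move=> g; case: (z g) (z' g) => [[[[? ?] ?] ?] ?] [[[[? ?] ?] ?] ?].
have zP1 := cmp_fst zP; have zP1' := cmp_fst zP'.
have zP2 := cmp_fst zP1; have zP2' := cmp_fst zP1'.
have zP3 := cmp_fst zP2; have zP3' := cmp_fst zP2'.
apply: cmp_and; first exact: (cmp_eq_set nP (cmp_fst zP3') (cmp_Psucc HI aP (cmp_fst zP3))).
apply: cmp_and; first exact: (cmp_eq_set nP (cmp_snd zP3) (cmp_Cpre HI aP (cmp_snd zP3'))).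
apply: cmp_and; first exact: (cmp_eq_set nP (cmp_snd zP2) (cmp_Cpre HI aP (cmp_snd zP2'))).
by apply: cmp_and; [exact: (cmp_transition aP (cmp_snd zP1) (cmp_snd zP1'))
  | exact: (cmp_transition aP (cmp_snd zP) (cmp_snd zP'))].
Qed.

Definition estep (i : inst R) : lt i * node (sz i) -> tree R := epair (@elet i) (@enode (sz i)).
Definition ewstate (i : inst R) : wstate R (sz i) -> tree R :=
  epair (epair (@enode (sz i)) (tbool R)) (epair (@Defs.Num R) (@Defs.Num R)).

End Walks.

Lemma cmp_wrun G (e : G -> tree R) (I : G -> inst R) (z : forall g, node (sz (I g)))
    (w : forall g, seq (lt (I g) * node (sz (I g)))) :
  cmp e (fun g => encode (au (I g))) ->
  cmp e (fun g => enode (z g)) -> cmp e (fun g => elist (@estep (I g)) (w g)) ->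
  cmp e (fun g => ewstate (wrun (au (I g)) (z g) (w g))).
Proof.
move=> HI zP wP.
have oneP : cmp e (fun=> Defs.Num (1 : maxplus R)) by apply: (cmp_do IZero (cmp_id e)).
apply: (@cmp_foldl _ _ _ (fun g => (lt (I g) * node (sz (I g)))%type)
  (fun g => wstate R (sz (I g))) (fun g => @estep (I g)) (fun g => @ewstate (I g))
  (fun g => @wstep R _ _ (au (I g))) (fun g => (z g, true, (1, 1))) w wP).
  apply: cmp_node; last exact: (cmp_node oneP oneP).
  by apply: cmp_node zP _; apply: cmp_true.
pose V : Type := {g : G & (wstate R (sz (I g)) * (lt (I g) * node (sz (I g))))%type}.
pose J (h : V) := I (tag h).
have HJ : cmp (ctx e (fun g => epair (@ewstate (I g)) (@estep (I g)))) (fun h : V => encode (au (J h))).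
  exact: (cmp_wk _ HI).
have v := cmp_var e (fun g => epair (@ewstate (I g)) (@estep (I g))).
have s := cmp_fst v; have l := cmp_snd v.
have s1 := cmp_fst s; have s2 := cmp_snd s.
have s11 := cmp_fst s1; have la := cmp_fst l; have lz := cmp_snd l.
apply: cmp_node; first apply: cmp_node.
- exact: lz.
- apply: cmp_and; first exact: (cmp_snd s1).
  exact: (@cmp_edge _ _ J HJ (fun h => (tagged h).1.1.1) (fun h => (tagged h).2.2)
    (fun h => (tagged h).2.1) s11 la lz).
apply: cmp_node; apply: cmp_mul.
- exact: (cmp_fst s2).
- exact: (@cmp_letmx _ _ J (fun h => (tagged h).2.1) (fun h => (tagged h).1.1.1.1.2)
    (fun h => (tagged h).2.2.1.2) la (cmp_snd (cmp_fst s11)) (cmp_snd (cmp_fst lz))).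
- exact: (cmp_snd s2).
- exact: (@cmp_letmx _ _ J (fun h => (tagged h).2.1) (fun h => (tagged h).1.1.1.2)
    (fun h => (tagged h).2.2.2) la (cmp_snd s11) (cmp_snd lz)).
Qed.

Lemma cmp_walks G (e : G -> tree R) (I : G -> inst R) :
  cmp e (fun g => encode (au (I g))) ->
  cmp e (fun g => elist (elist (@estep (I g))) (walks (lt (I g)) (sz (I g)))).
Proof.
move=> HI; have nP := cmp_nodes (cmp_ords HI); apply: (cmp_seqs nP).
apply: (@cmp_allpairs _ _ _ _ _ _ _ _ (fun g => @estep (I g)) _ _
  (fun g a z => (a, z)) (cmp_letters HI) nP).
by apply: cmp_node; [apply: (cmp_wk _ (cmp_var _ _)) | apply: cmp_var].
Qed.

Section Cycles.
Variables (G : Type) (e : G -> tree R) (I : G -> inst R).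
Hypothesis HI : cmp e (fun g => encode (au (I g))).

Let W g : Type := seq (lt (I g) * node (sz (I g))).
Let HJ : cmp (ctx e (fun g => elist (@estep (I g)))) (fun h => encode (au (I (tag h)))).
Proof. exact: (cmp_wk _ HI). Qed.

Lemma cmp_reachb (z z' : forall g, node (sz (I g))) :
  cmp e (fun g => enode (z g)) -> cmp e (fun g => enode (z' g)) ->
  cmp e (fun g => tbool R (reachb (au (I g)) (z g) (z' g))).
Proof.
move=> zP zP'; apply: (cmp_has (cmp_walks HI)).
have := @cmp_wrun _ _ (fun h : {g : G & W g} => I (tag h)) (fun h => z (tag h))
  (fun h => tagged h) HJ (cmp_wk _ zP) (cmp_var _ _).
move=> /cmp_fst r; apply: cmp_and; first exact: (cmp_snd r).
exact: (@cmp_eq_node _ _ (fun h : {g : G & W g} => sz (I (tag h))) (cmp_ords HJ)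
  _ (fun h => z' (tag h)) (cmp_fst r) (cmp_wk _ zP')).
Qed.

Lemma cmp_cycb (test : maxplus R -> maxplus R -> bool) (z : forall g, node (sz (I g))) :
  (forall H (f : H -> tree R) b c, cmp f (fun h => Defs.Num (b h)) ->
     cmp f (fun h => Defs.Num (c h)) -> cmp f (fun h => tbool R (test (b h) (c h)))) ->
  cmp e (fun g => enode (z g)) -> cmp e (fun g => tbool R (cycb (au (I g)) test (z g))).
Proof.
move=> tP zP; apply: (cmp_has (cmp_walks HI)).
have := @cmp_wrun _ _ (fun h : {g : G & W g} => I (tag h)) (fun h => z (tag h))
  (fun h => tagged h) HJ (cmp_wk _ zP) (cmp_var _ _).
move=> rr; have r := cmp_fst rr; have t := cmp_snd rr.
apply: cmp_and; first exact: (cmp_snd r).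
apply: cmp_and; last exact: (tP _ _ _ _ (cmp_fst t) (cmp_snd t)).
exact: (@cmp_eq_node _ _ (fun h : {g : G & W g} => sz (I (tag h))) (cmp_ords HJ)
  _ (fun h => z (tag h)) (cmp_fst r) (cmp_wk _ zP)).
Qed.

End Cycles.

Lemma cmp_badb G (e : G -> tree R) (I : G -> inst R) (test : maxplus R -> maxplus R -> bool)
    (z : forall g, node (sz (I g))) :
  cmp e (fun g => encode (au (I g))) ->
  (forall H (f : H -> tree R) b c, cmp f (fun h => Defs.Num (b h)) ->
     cmp f (fun h => Defs.Num (c h)) -> cmp f (fun h => tbool R (test (b h) (c h)))) ->
  cmp e (fun g => enode (z g)) -> cmp e (fun g => tbool R (badb (au (I g)) test (z g))).
Proof.
move=> HI tP zP; apply: (cmp_has (cmp_nodes (cmp_ords HI))).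
pose V : Type := {g : G & node (sz (I g))}; pose J (h : V) := I (tag h).
have HJ : cmp (ctx e (fun g => @enode (sz (I g)))) (fun h : V => encode (au (J h))).
  exact: (cmp_wk _ HI).
have zJ : cmp (ctx e (fun g => @enode (sz (I g)))) (fun h : V => enode (z (tag h))).
  exact: (cmp_wk _ zP).
have z'J := cmp_var e (fun g => @enode (sz (I g))).
apply: cmp_and; first exact: (@cmp_reachb _ _ J HJ (fun h => z (tag h)) (fun h => tagged h)).
apply: cmp_and; first exact: (@cmp_reachb _ _ J HJ (fun h => tagged h) (fun h => z (tag h))).
exact: (@cmp_cycb _ _ J HJ test (fun h => tagged h)).
Qed.

Lemma cmp_gtb H (f : H -> tree R) (b c : H -> maxplus R) : cmp f (fun h => Defs.Num (b h)) ->
  cmp f (fun h => Defs.Num (c h)) -> cmp f (fun h => tbool R (gtb (b h) (c h))).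
Proof. by move=> bP cP; apply: cmp_neg; apply: cmp_le. Qed.

Lemma cmp_neqb H (f : H -> tree R) (b c : H -> maxplus R) : cmp f (fun h => Defs.Num (b h)) ->
  cmp f (fun h => Defs.Num (c h)) -> cmp f (fun h => tbool R (neqb (b h) (c h))).
Proof. by move=> bP cP; apply: cmp_neg; apply: cmp_and; apply: cmp_le. Qed.

End Instances.

(** * Programs for the two decision procedures *)

Section Programs.
Variable R : realType.

Local Notation sz i := (inst_size i).
Local Notation au i := (inst_aut i).
Local Notation lt i := (inst_letters i).

Lemma cmp_goodc G (e : G -> tree R) (I : G -> inst R) (P C : forall g, {set 'I_(sz (I g))})
    (q : forall g, 'I_(sz (I g))) :
  cmp e (fun g => encode (au (I g))) -> cmp e (fun g => eset (P g)) ->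
  cmp e (fun g => eset (C g)) -> cmp e (fun g => eord (q g)) ->
  cmp e (fun g => tbool R (goodc (au (I g)) (P g) (C g) (q g))).
Proof.
move=> HI PP CP qP; apply: cmp_and; first exact: cmp_mem.
apply: cmp_and; first exact: cmp_mem.
apply: (cmp_all (cmp_ords HI)).
pose V : Type := {g : G & 'I_(sz (I g))}; pose J (h : V) := I (tag h).
have HJ : cmp (ctx e (fun g => @eord R (sz (I g)))) (fun h : V => encode (au (J h))).
  exact: (cmp_wk _ HI).
have PJ := cmp_wk (fun g => @eord R (sz (I g))) PP.
have CJ := cmp_wk (fun g => @eord R (sz (I g))) CP.
have qJ := cmp_wk (fun g => @eord R (sz (I g))) qP.
have rJ := cmp_var e (fun g => @eord R (sz (I g))).
apply: cmp_imp; first apply: cmp_and.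
- exact: (@cmp_mem _ _ _ (fun h : V => sz (J h)) (fun h => P (tag h)) (fun h => tagged h)).
- exact: (@cmp_mem _ _ _ (fun h : V => sz (J h)) (fun h => C (tag h)) (fun h => tagged h)).
apply: cmp_neg; apply: (@cmp_badb _ _ _ J (@gtb R)
  (fun h => (P (tag h), C (tag h), C (tag h), q (tag h), tagged h)) HJ).
  by move=> H f b c; apply: cmp_gtb.
by do 4!apply: cmp_node => //.
Qed.

(** The function is stored as its table over [subsets], in which [cmp_lookup] searches. *)
Definition est N (X : stype N) : tree R :=
  Node (eset X.1) (elist (fun P => Node (eset P) (eset (X.2 P))) (subsets N)).

Lemma cmp_lookup G (e : G -> tree R) (n : G -> nat) (X : forall g, stype (n g))
    (P : forall g, {set 'I_(n g)}) :
  cmp e (fun g => elist (@eord R (n g)) (enum 'I_(n g))) ->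
  cmp e (fun g => est (X g)) -> cmp e (fun g => eset (P g)) ->
  cmp e (fun g => eset ((X g).2 (P g))).
Proof.
move=> nP XP PP.
apply: (cmp_ext (t := fun g => eset (foldr (fun S acc => if S == P g then (X g).2 S else acc)
    set0 (subsets (n g))))).
  move=> g; congr eset; have : P g \in subsets (n g) by exact: mem_subsets.
  elim: (subsets (n g)) => //= S s IH; rewrite in_cons eq_sym.
  by case: (S =P P g) => [-> //|_ /= /IH].
apply: (@cmp_foldr _ _ _ (fun g => {set 'I_(n g)}) (fun g S => Node (eset S) (eset ((X g).2 S)))
  (fun g => subsets (n g)) (cmp_snd XP) (fun g => {set 'I_(n g)}) (fun g => @eset R (n g))
  (fun g S acc => if S == P g then (X g).2 S else acc)).
  exact: cmp_set0.
pose V : Type := {g : G & ({set 'I_(n g)} * {set 'I_(n g)})%type}.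
have v := cmp_var e (fun g => epair (fun S => Node (eset S) (eset ((X g).2 S))) (@eset R (n g))).
have s := cmp_fst v.
apply: (cmp_ext (t := fun h : V => if (tagged h).1 == P (tag h)
  then eset ((X (tag h)).2 (tagged h).1) else eset (tagged h).2)).
  by move=> h; case: ifP.
apply: cmp_if; [|exact: (cmp_snd s) | exact: (cmp_snd v)].
exact: (@cmp_eq_set _ _ _ (fun h : V => n (tag h)) (cmp_wk _ nP) (fun h => (tagged h).1)
  (fun h => P (tag h)) (cmp_fst s) (cmp_wk _ PP)).
Qed.

Lemma cmp_table G (e : G -> tree R) (n : G -> nat) (X : forall g, stype (n g))
    (b : forall g, {set 'I_(n g)} -> 'I_(n g) -> bool) :
  (forall g P, (X g).2 P = [set q in P | b g P q]) ->
  cmp e (fun g => elist (@eord R (n g)) (enum 'I_(n g))) ->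
  cmp e (fun g => eset (X g).1) ->
  cmp (ctx (ctx e (fun g => @eset R (n g))) (fun h => @eord R (n (tag h))))
    (fun h => tbool R (b _ (tagged (tag h)) (tagged h))) ->
  cmp e (fun g => est (X g)).
Proof.
move=> XE nP X1P bP; apply: cmp_node => //.
apply: (cmp_map (cmp_subsets nP)); apply: cmp_node; first exact: cmp_var.
apply: (cmp_ext (t := fun h : {g : G & {set 'I_(n g)}} =>
    eset [set q | (q \in tagged h) && b (tag h) (tagged h) q])).
  by move=> h; rewrite XE.
apply: (@cmp_set _ _ _ (fun h : {g : G & {set 'I_(n g)}} => n (tag h)) (cmp_wk _ nP)).
apply: cmp_and bP.
apply: (@cmp_mem _ _ _ (fun h : {h : {g : G & {set 'I_(n g)}} & 'I_(n (tag h))} =>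
  n (tag (tag h))) (fun h => tagged (tag h)) (fun h => tagged h)).
  exact: (cmp_wk _ (cmp_var _ _)).
exact: cmp_var.
Qed.

Section States.
Variables (G : Type) (e : G -> tree R) (I : G -> inst R).
Hypothesis HI : cmp e (fun g => encode (au (I g))).

Let V : Type := {h : {g : G & {set 'I_(sz (I g))}} & 'I_(sz (I (tag h)))}.
Let J (h : V) := I (tag (tag h)).
Let f : V -> tree R :=
  ctx (ctx e (fun g => @eset R (sz (I g)))) (fun h => @eord R (sz (I (tag h)))).
Let HJ : cmp f (fun h => encode (au (J h))).
Proof. exact: (cmp_wk _ (cmp_wk _ HI)). Qed.
Let vP : cmp f (fun h => eset (tagged (tag h))).
Proof. exact: (cmp_wk _ (cmp_var _ _)). Qed.
Let vq : cmp f (fun h => eord (tagged h)).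
Proof. exact: (cmp_var _ _). Qed.

Lemma cmp_st0 : cmp e (fun g => est (st0 (au (I g)))).
Proof.
apply: (@cmp_table _ _ (fun g => sz (I g)) (fun g => st0 (au (I g)))
  (fun g P q => goodc (au (I g)) P (Fin (au (I g))) q)).
- by move=> g P; rewrite ffunE; apply/setP => q; rewrite !inE goodcE.
- exact: (cmp_ords HI).
- exact: cmp_Fin.
- exact: (@cmp_goodc _ _ J (fun h => tagged (tag h)) (fun h => Fin (au (J h)))
    (fun h => tagged h) HJ vP (cmp_Fin HJ) vq).
Qed.

Lemma cmp_stnext (a : forall g, lt (I g)) (X : forall g, stype (sz (I g))) :
  cmp e (fun g => elet (a g)) -> cmp e (fun g => est (X g)) ->
  cmp e (fun g => est (stnext (au (I g)) (a g) (X g))).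
Proof.
move=> aP XP; have CP := cmp_Cpre HI aP (cmp_fst XP).
apply: (@cmp_table _ _ (fun g => sz (I g)) (fun g => stnext (au (I g)) (a g) (X g))
  (fun g P q => goodc (au (I g)) P (Cpre (au (I g)) (a g) (X g).1) q &&
     [exists r in (X g).2 (Psucc (au (I g)) (a g) P), transition (au (I g)) q (a g) r])).
- by move=> g P; rewrite ffunE; apply/setP => q; rewrite !inE goodcE.
- exact: (cmp_ords HI).
- exact: CP.
have wk2 (t : G -> tree R) : cmp e t -> cmp f (fun h => t (tag (tag h))).
  by move=> tP; apply: (cmp_wk _ (cmp_wk _ tP)).
apply: cmp_and.
  exact: (@cmp_goodc _ _ J (fun h => tagged (tag h)) (fun h => Cpre (au (J h)) (a (tag (tag h)))
    (X (tag (tag h))).1) (fun h => tagged h) HJ vP (wk2 _ CP) vq).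
have SP := @cmp_Psucc _ _ _ J HJ (fun h => a (tag (tag h))) (fun h => tagged (tag h)) (wk2 _ aP) vP.
have LP := @cmp_lookup _ _ (fun h => sz (J h)) (fun h => X (tag (tag h))) _ (cmp_ords HJ)
  (wk2 _ XP) SP.
apply: (@cmp_exists_in _ _ _ (fun h => sz (J h)) (cmp_ords HJ) _ _ LP).
exact: (@cmp_transition _ _ _ (fun h => J (tag h)) (fun h => a (tag (tag (tag h))))
  (fun h => tagged (tag h)) (fun h => tagged h) (cmp_wk _ (wk2 _ aP)) (cmp_wk _ vq) (cmp_var _ _)).
Qed.

End States.

Lemma cmp_st G (e : G -> tree R) (I : G -> inst R) (u : forall g, seq (lt (I g))) :
  cmp e (fun g => encode (au (I g))) -> cmp e (fun g => ewords (u g)) ->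
  cmp e (fun g => est (st (au (I g)) (u g))).
Proof.
move=> HI uP; apply: (@cmp_foldr _ _ _ (fun g => lt (I g)) (fun g => @elet R (I g)) u uP
  (fun g => stype (sz (I g))) (fun g => @est (sz (I g))) (fun g => stnext (au (I g)))
  (fun g => st0 (au (I g))) (cmp_st0 HI)).
exact: (@cmp_stnext _ _ (fun h => I (tag h)) (cmp_wk _ HI) (fun h => (tagged h).1)
  (fun h => (tagged h).2) (cmp_fst (cmp_var _ _)) (cmp_snd (cmp_var _ _))).
Qed.

Section Decide.
Let I (i : inst R) := i.
Let e (i : inst R) : tree R := encode (au i).
Let HI : cmp e (fun i => encode (au (I i))).
Proof. exact: cmp_id. Qed.

Lemma cmp_pwords : cmp e (fun i => elist (@ewords R i) (pwords (lt i) (sz i))).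
Proof. exact: (cmp_seqs (cmp_subsets (cmp_ords HI)) (cmp_letters HI)). Qed.

Lemma cmp_words : cmp e (fun i => elist (@ewords R i) (words (lt i) (sz i))).
Proof.
have sP := cmp_subsets (cmp_ords HI).
apply: (@cmp_seqs _ _ _ _ _ (fun i => epair (@eset R (sz i)) (elist (@eset R (sz i)))) _ _ _ _
  (cmp_letters HI)).
apply: (@cmp_allpairs _ _ _ _ _ _ _ _ _ _ _ (fun i C G => (C, G)) sP (cmp_seqs sP sP)).
by apply: cmp_node; [apply: (cmp_wk _ (cmp_var _ _)) | apply: cmp_var].
Qed.

Lemma cmp_dominantb : cmp e (fun i => tbool R (dominantb (au i))).
Proof.
apply: (cmp_all cmp_words).
pose V : Type := {i : inst R & seq (lt i)}; pose J (h : V) := tag h.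
have HJ : cmp (ctx e (@ewords R)) (fun h : V => encode (au (J h))) by exact: (cmp_wk _ HI).
have stP := @cmp_st _ _ J (fun h => tagged h) HJ (cmp_var _ _).
have IP := cmp_Init HJ; have oP := cmp_ords HJ.
apply: cmp_imp.
  exact: (@cmp_meets _ _ _ (fun h => sz (J h)) oP _ _ IP (cmp_fst stP)).
exact: (@cmp_meets _ _ _ (fun h => sz (J h)) oP _ _ IP
  (@cmp_lookup _ _ (fun h => sz (J h)) _ _ oP stP IP)).
Qed.

Lemma cmp_twin_at G (f : G -> tree R) (K : G -> inst R)
    (P C D : forall g, {set 'I_(sz (K g))}) :
  cmp f (fun g => encode (au (K g))) -> cmp f (fun g => eset (P g)) ->
  cmp f (fun g => eset (C g)) -> cmp f (fun g => eset (D g)) ->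
  cmp f (fun g => tbool R (twin_at (au (K g)) (P g) (C g) (D g))).
Proof.
move=> HK PP CP DP; apply: (cmp_all (cmp_ords HK)).
apply: (@cmp_all _ _ _ (fun h : {g : G & 'I_(sz (K g))} => 'I_(sz (K (tag h)))) _ _
  (@cmp_ords _ _ _ (fun h : {g : G & 'I_(sz (K g))} => K (tag h)) (cmp_wk _ HK))).
pose V : Type := {h : {g : G & 'I_(sz (K g))} & 'I_(sz (K (tag h)))}.
pose J (h : V) := K (tag (tag h)).
pose f2 : V -> tree R := ctx (ctx f (fun g => @eord R (sz (K g)))) (fun h => @eord R (sz (K (tag h)))).
have wk2 (t : G -> tree R) : cmp f t -> cmp f2 (fun h => t (tag (tag h))).
  by move=> tP; apply: (cmp_wk _ (cmp_wk _ tP)).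
have qP : cmp f2 (fun h : V => eord (tagged (tag h))) by apply: (cmp_wk _ (cmp_var _ _)).
have rP : cmp f2 (fun h : V => eord (tagged h)) by apply: cmp_var.
apply: cmp_imp; first apply: cmp_and.
- exact: (@cmp_goodc _ _ J _ _ _ (wk2 _ HK) (wk2 _ PP) (wk2 _ CP) qP).
- exact: (@cmp_goodc _ _ J _ _ _ (wk2 _ HK) (wk2 _ PP) (wk2 _ DP) rP).
apply: cmp_neg; apply: (@cmp_badb _ _ _ J (@neqb R)
  (fun h => (P (tag (tag h)), C (tag (tag h)), D (tag (tag h)), tagged (tag h), tagged h))
  (wk2 _ HK)).
  by move=> H f' b c; apply: cmp_neqb.
exact: (cmp_node (cmp_node (cmp_node (cmp_node (wk2 _ PP) (wk2 _ CP)) (wk2 _ DP)) qP) rP).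
Qed.

Lemma cmp_twinsb : cmp e (fun i => tbool R (twinsb (au i))).
Proof.
apply: (cmp_all cmp_pwords).
pose f1 := ctx e (@ewords R).
apply: (@cmp_all _ _ f1 (fun h => seq (lt (tag h))) (fun h => @ewords R (tag h)) _ (cmp_wk _ cmp_words)).
pose f2 := ctx f1 (fun h => @ewords R (tag h)).
apply: (@cmp_all _ _ f2 (fun h => seq (lt (tag (tag h)))) (fun h => @ewords R (tag (tag h))) _
  (cmp_wk _ (cmp_wk _ cmp_words))).
pose f3 := ctx f2 (fun h => @ewords R (tag (tag h))).
pose V : Type := {h : {h : {i : inst R & seq (lt i)} & seq (lt (tag h))} & seq (lt (tag (tag h)))}.
pose J (h : V) := tag (tag (tag h)).
have HJ : cmp f3 (fun h => encode (au (J h))) by exact: (cmp_wk _ (cmp_wk _ (cmp_wk _ HI))).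
have FJ := cmp_Fin HJ.
apply: (@cmp_twin_at _ f3 J _ _ _ HJ).
- apply: (@cmp_Pw _ _ _ J HJ (fun h => tagged (tag (tag h))) _ _ (cmp_Init HJ)).
  exact: (cmp_wk _ (cmp_wk _ (cmp_var _ _))).
- apply: (@cmp_Cw _ _ _ J HJ (fun h => tagged (tag h)) _ _ FJ).
  exact: (cmp_wk _ (cmp_var _ _)).
- exact: (@cmp_Cw _ _ _ J HJ (fun h => tagged h) _ (cmp_var _ _) FJ).
Qed.

End Decide.
End Programs.

Theorem theorem14 (R : realType) :
  (exists p : prog,
     forall (Sigma : finType) (n : nat) (A : automaton R Sigma n),
       finitely_ambiguous A ->
       decides p (encode A) (unambiguous_series (series A))) /\
  (exists p : prog,
     forall (Sigma : finType) (n : nat) (A : automaton R Sigma n),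
       finitely_ambiguous A ->
       decides p (encode A) (sequential_series (series A))).
Proof.
split.
  have [p pP] := cmp_dominantb R; exists p => Sigma n A finA.
  exists (dominantb A); first exact: (pP (Inst A)).
  by rewrite (unambiguous_seriesP finA); split=> /dominantbP.
have [p pP] := cmp_and (cmp_dominantb R) (cmp_twinsb R).
exists p => Sigma n A finA.
exists (dominantb A && twinsb A); first exact: (pP (Inst A)).
rewrite (sequential_seriesP finA); split=> [/andP[/dominantbP ? /twinsbP ?]|[? ?]] //.
by apply/andP; split; [apply/dominantbP | apply/twinsbP].
Qed.
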